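(* Let $\mathbb{F}$ be an algebraically closed field, $\Gamma$ a digraph, $I$ a graded ideal of $L(\Gamma)=L_{\mathbb{F}}(\Gamma)$, $\beta$ a set of (geometric) cycles with no exit in $\Gamma/I$ and $d$ a function from $\beta$ to the positive integers. Then in each affine factor $A_{d(C)}$, $C\in\beta$, of $\mathcal{J}(I,\beta,d)=\prod_{C\in\beta}A_{d(C)}$, the set of points corresponding to dlf ideals, i.e. the set of $(a_1,\dots,a_{d(C)})\in A_{d(C)}$ such that $1+a_1x+\cdots+a_{d(C)}x^{d(C)}$ is a product of distinct linear factors in $\mathbb{F}[x]$, is open and dense in the Zariski topology (and also in the Euclidean topology when $\mathbb{F}=\mathbb{C}$). In this sense the property of being a dlf ideal is generic, and therefore a generic quotient of a Leavitt path algebra is isomorphic to a Leavitt path algebra: for every ideal $J\in\mathcal{J}(I,\beta,d)$ all of whose coordinates lie in these open dense subsets, $L(\Gamma)/J$ is isomorphic to a Leavitt path algebra over $\mathbb{F}$.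
   Context: A digraph $\Gamma=(V,E,s,t)$ consists of arbitrary (possibly infinite) sets $V$ of vertices and $E$ of arrows and functions $s,t:E\to V$ (source, target). The Leavitt path algebra $L(\Gamma)=L_{\mathbb{F}}(\Gamma)$ is the (not necessarily unital) $\mathbb{F}$-algebra generated by $V\sqcup E\sqcup\{e^*: e\in E\}$ subject to: $uv=\delta_{u,v}u$ for $u,v\in V$; $s(e)e=e=e\,t(e)$ and $t(e)e^*=e^*=e^*s(e)$ for $e\in E$; (CK1) $e^*f=\delta_{e,f}t(e)$; (CK2) $v=\sum_{s(e)=v}ee^*$ for every $v$ with $0<|s^{-1}(v)|<\infty$. It is $\mathbb{Z}$-graded with $\deg v=0$, $\deg e=1$, $\deg e^*=-1$; graded ideals are those generated by homogeneous elements. Ideals are two-sided. A path of length $n>0$ is a sequence of arrows $e_1\cdots e_n$ with $t(e_i)=s(e_{i+1})$. A cycle is a path $C=e_1\cdots e_n$ with $n>0$, $s(C)=t(C)$ and $s(e_1),\dots,s(e_n)$ distinct; cyclic rotations are identified (geometric cycles). An exit of a path $p$ is an arrow not on $p$ whose source is a vertex on $p$. The digraph $\Gamma/J$: for an ideal $J$ let $H=J\cap V$, $B_H=\{v\in V: s^{-1}(v)\text{ infinite},\ 0<|s^{-1}(v)\cap t^{-1}(V\setminus H)|<\infty\}$, $v^H=v-\sum_{s(e)=v,\,t(e)\notin H}ee^*$ for $v\in B_H$, and $S_J=\{v\in B_H: v^H\in J\}$. Then $\Gamma/J$ has vertex set $(V\setminus H)\cup\{v': v\in B_H\setminus S_J\}$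 and arrow set $\{e\in E: t(e)\notin H\}\cup\{e': e\in E,\ t(e)\in B_H\setminus S_J\}$, with $s(e')=s(e)$, $t(e')=t(e)'$. Canonical polynomial generators: for a cycle $C$, $\mathbb{F}[C]$ is the subalgebra spanned by $s(C),C,C^2,\dots$, isomorphic to $\mathbb{F}[x]$ via $C\leftrightarrow x$. For each cycle $C$ of $\Gamma$ such that $J\cap\mathbb{F}[C]$ is a proper nonzero ideal of $\mathbb{F}[C]$, $f_C(x)$ is the unique generator with $f_C(0)=1$ of the corresponding ideal of $\mathbb{F}[x]$; the $f_C(C)$ are the canonical polynomial generators of $J$ (the $f_C$ depend only on the geometric cycle, and such $C$ have no exit in $\Gamma/J$). The ideal $J$ is dlf if every such $f_C(x)$ is a product of distinct linear factors in $\mathbb{F}[x]$. Strata: $\mathcal{J}(I,\beta)$ is the set of ideals $J$ of $L(\Gamma)$ such that $I$ is the largest graded ideal contained in $J$ and $\beta$ is the set of cycles with no exit in $\Gamma/I=\Gamma/J$ contributing canonical polynomial generators to $J$; $\mathcal{J}(I,\beta,d)$ is the set of those $J\in\mathcal{J}(I,\beta)$ with $\deg f_C=d(C)$ for all $C\in\beta$. It is identified with $\prod_{C\in\beta}A_{d(C)}$, where $A_d=\{(a_1,\dots,a_d)\in\mathbb{F}^d: a_d\neq 0\}$, by taking as the $C$-coordinate of $J$ the coefficients of $f_C(x)=1+a_1x+\cdots+a_{d(C)}x^{d(C)}$. The topology on $\mathcal{J}(I,\beta)$ is the one generated by those of the $\mathcal{J}(I,\beta,d)$: a subset of $\mathcal{J}(I,\beta)$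 is open iff its intersection with $\mathcal{J}(I,\beta,d)$ is open for every $d$. *)

(* Defs.v *)
From HB Require Import structures.
From mathcomp Require Import all_boot all_order all_algebra.
From mathcomp Require Import mathcomp_extra boolp classical_sets functions.
From mathcomp Require Import cardinality fsbigop reals topology normedtype.
From mathcomp Require Import complex.
From mathcomp Require mpoly.

Set Implicit Arguments.
Unset Strict Implicit.
Unset Printing Implicit Defensive.

Import Order.TTheory GRing.Theory Num.Theory.
Import numFieldNormedType.Exports.

Local Open Scope classical_set_scope.
Local Open Scope ring_scope.

(* Not necessarily unital associative algebras: the product is that of the
   underlying semigroup.                                                    *)
HB.mixin Record isBilinearMul (F : fieldType) A
    of GRing.Lmodule F A & Semigroup A := {
  nuDl : forall x y z : A, ((x + y)%R * z)%g = ((x * z)%g + (y * z)%g)%R;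
  nuDr : forall x y z : A, (x * (y + z)%R)%g = ((x * y)%g + (x * z)%g)%R;
  nuZl : forall (a : F) (x y : A), ((a *: x)%R * y)%g = (a *: (x * y)%g)%R;
  nuZr : forall (a : F) (x y : A), (x * (a *: y)%R)%g = (a *: (x * y)%g)%R }.

HB.structure Definition NUAlgebra (F : fieldType) :=
  { A of GRing.Lmodule F A & Semigroup A & isBilinearMul F A }.

Notation nualgType := NUAlgebra.type.

Notation "x ** y" := (x * y)%g
  (at level 40, left associativity, only parsing) : ring_scope.

Definition nualg_isomorphic (F : fieldType) (A B : nualgType F) : Prop :=
  exists f : {linear A -> B}, {morph f : x y / x ** y} /\ bijective f.

Section Ideals.
Context (F : fieldType) (A : nualgType F).

Record is_ideal (J : set A) : Prop := IsIdeal {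
  is_ideal0 : J 0;
  is_idealD : forall x y, J x -> J y -> J (x + y);
  is_idealZ : forall (a : F) x, J x -> J (a *: x);
  is_idealMl : forall x y, J y -> J (x ** y);
  is_idealMr : forall x y, J x -> J (x ** y) }.

Record ideal : Type := Ideal {
  ideal_set :> A -> Prop;
  idealP : is_ideal ideal_set }.

Lemma is_ideal_smallest (S : set A) : is_ideal (smallest is_ideal S).
Proof.
split.
- by move=> M [[]].
- move=> x y Sx Sy M MS; have [[_ MD _ _ _] _] := MS.
  by apply: MD; [exact: Sx|exact: Sy].
- by move=> a x Sx M MS; have [[_ _ MZ _ _] _] := MS; apply: MZ; exact: Sx.
- by move=> x y Sy M MS; have [[_ _ _ Ml _] _] := MS; apply: Ml; exact: Sy.
- by move=> x y Sx M MS; have [[_ _ _ _ Mr] _] := MS; apply: Mr; exact: Sx.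
Qed.

Definition ideal_gen (S : set A) : ideal := Ideal (is_ideal_smallest S).

Lemma mem_ideal_gen (S : set A) x : S x -> ideal_gen S x.
Proof. by move=> Sx M [_]; apply. Qed.

End Ideals.

Section Quotient.
Context (F : fieldType) (A : nualgType F) (J : ideal A).

Definition nuquot_rel (x y : A) : bool := `[< J (x - y) >].

Lemma nuquot_relxx : reflexive nuquot_rel.
Proof. by move=> x; apply/asboolP; rewrite subrr; case: (idealP J). Qed.

Lemma nuquot_relC : symmetric nuquot_rel.
Proof.
have H x y : nuquot_rel x y -> nuquot_rel y x.
  move=> /asboolP Jxy; apply/asboolP; rewrite -opprB -scaleN1r.
  by case: (idealP J) => _ _ + _ _; apply.
by move=> x y; apply/idP/idP; exact: H.
Qed.

Lemma nuquot_rel_trans : transitive nuquot_rel.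
Proof.
move=> y x z /asboolP Jxy /asboolP Jyz; apply/asboolP.
by rewrite -(subrKA y); case: (idealP J) => _ + _ _ _; apply.
Qed.

Definition nuquot_equiv := EquivRel nuquot_rel
  nuquot_relxx nuquot_relC nuquot_rel_trans.

Definition nuquot : Type := {eq_quot nuquot_equiv}%qT.
HB.instance Definition _ := Choice.copy nuquot {eq_quot nuquot_equiv}%qT.

Definition nupi (x : A) : nuquot := \pi_({eq_quot nuquot_equiv})%qT x.
Definition nurepr (p : nuquot) : A := repr (p : {eq_quot nuquot_equiv}%qT).

Lemma nureprK : cancel nurepr nupi.
Proof. by move=> p; rewrite /nupi /nurepr reprK. Qed.

Lemma nupi_eq x y : nupi x = nupi y <-> J (x - y).
Proof.
split; last by move=> Jxy; apply/eqmodP; apply/asboolP.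
by move=> /eqmodP/asboolP.
Qed.

Lemma nupi_repr x : J (nurepr (nupi x) - x).
Proof. by apply/nupi_eq; rewrite nureprK. Qed.

Definition nuquot_add (p q : nuquot) := nupi (nurepr p + nurepr q).
Definition nuquot_opp (p : nuquot) := nupi (- nurepr p).
Definition nuquot_scale (a : F) (p : nuquot) := nupi (a *: nurepr p).
Definition nuquot_mul (p q : nuquot) := nupi (nurepr p ** nurepr q).

Lemma nupi_addE x y : nuquot_add (nupi x) (nupi y) = nupi (x + y).
Proof.
apply/nupi_eq; rewrite opprD addrACA.
by case: (idealP J) => _ + _ _ _; apply; exact: nupi_repr.
Qed.

Lemma nupi_oppE x : nuquot_opp (nupi x) = nupi (- x).
Proof.
apply/nupi_eq; rewrite -opprD -scaleN1r.
by case: (idealP J) => _ _ + _ _; apply; exact: nupi_repr.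
Qed.

Lemma nupi_scaleE a x : nuquot_scale a (nupi x) = nupi (a *: x).
Proof.
apply/nupi_eq; rewrite -scalerBr.
by case: (idealP J) => _ _ + _ _; apply; exact: nupi_repr.
Qed.

Lemma nupi_mulE x y : nuquot_mul (nupi x) (nupi y) = nupi (x ** y).
Proof.
apply/nupi_eq; set x' := nurepr _; set y' := nurepr _.
have -> : x' ** y' - x ** y = (x' - x) ** y' + x ** (y' - y).
  by rewrite nuDl nuDr -!scaleN1r nuZl nuZr !scaleN1r addrA addrNK.
case: (idealP J) => _ JD _ Jl Jr.
by apply: JD; [apply: Jr|apply: Jl]; exact: nupi_repr.
Qed.

Lemma nuquot_addA : associative nuquot_add.
Proof.
move=> p q r; rewrite -(nureprK p) -(nureprK q) -(nureprK r).
by rewrite !nupi_addE addrA.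
Qed.

Lemma nuquot_addC : commutative nuquot_add.
Proof. by move=> p q; rewrite /nuquot_add addrC. Qed.

Lemma nuquot_add0 : left_id (nupi 0) nuquot_add.
Proof. by move=> p; rewrite -(nureprK p) nupi_addE add0r. Qed.

Lemma nuquot_addN : left_inverse (nupi 0) nuquot_opp nuquot_add.
Proof. by move=> p; rewrite -(nureprK p) nupi_oppE nupi_addE addNr. Qed.

HB.instance Definition _ := GRing.isZmodule.Build nuquot
  nuquot_addA nuquot_addC nuquot_add0 nuquot_addN.

Lemma nupiD x y : nupi (x + y) = nupi x + nupi y.
Proof. by rewrite -nupi_addE. Qed.

Lemma nuquot_scaleA a b p :
  nuquot_scale a (nuquot_scale b p) = nuquot_scale (a * b) p.
Proof. by rewrite -(nureprK p) !nupi_scaleE scalerA. Qed.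

Lemma nuquot_scale1 : left_id 1 nuquot_scale.
Proof. by move=> p; rewrite -(nureprK p) nupi_scaleE scale1r. Qed.

Lemma nuquot_scaleDr : right_distributive nuquot_scale +%R.
Proof.
move=> a p q; rewrite -(nureprK p) -(nureprK q).
by rewrite -nupiD !nupi_scaleE -nupiD scalerDr.
Qed.

Lemma nuquot_scaleDl p :
  {morph nuquot_scale^~ p : a b / a + b}.
Proof.
by move=> a b; rewrite -(nureprK p) !nupi_scaleE -nupiD scalerDl.
Qed.

HB.instance Definition _ := GRing.Zmodule_isLmodule.Build F nuquot
  nuquot_scaleA nuquot_scale1 nuquot_scaleDr nuquot_scaleDl.

HB.instance Definition _ := hasMul.Build nuquot nuquot_mul.

Lemma nupiM x y : nupi (x ** y) = nupi x ** nupi y.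
Proof. by rewrite -nupi_mulE. Qed.

Lemma nupiZ a x : nupi (a *: x) = a *: nupi x.
Proof. by rewrite -nupi_scaleE. Qed.

Lemma nuquot_mulA (p q r : nuquot) : p ** (q ** r) = p ** q ** r.
Proof.
rewrite -(nureprK p) -(nureprK q) -(nureprK r).
by rewrite -!nupiM mulgA.
Qed.

HB.instance Definition _ := Magma_isSemigroup.Build nuquot nuquot_mulA.

Fact nuquot_mulDl (p q r : nuquot) : (p + q) ** r = p ** r + q ** r.
Proof.
rewrite -(nureprK p) -(nureprK q) -(nureprK r).
by rewrite -nupiD -!nupiM -nupiD nuDl.
Qed.

Fact nuquot_mulDr (p q r : nuquot) : p ** (q + r) = p ** q + p ** r.
Proof.
rewrite -(nureprK p) -(nureprK q) -(nureprK r).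
by rewrite -nupiD -!nupiM -nupiD nuDr.
Qed.

Fact nuquot_mulZl a (p q : nuquot) : (a *: p) ** q = a *: (p ** q).
Proof.
rewrite -(nureprK p) -(nureprK q).
by rewrite -nupiZ -!nupiM -nupiZ nuZl.
Qed.

Fact nuquot_mulZr a (p q : nuquot) : p ** (a *: q) = a *: (p ** q).
Proof.
rewrite -(nureprK p) -(nureprK q).
by rewrite -nupiZ -!nupiM -nupiZ nuZr.
Qed.

HB.instance Definition _ := isBilinearMul.Build F nuquot
  nuquot_mulDl nuquot_mulDr nuquot_mulZl nuquot_mulZr.

End Quotient.

(* The free algebra on X: formal expressions modulo the congruence generated
   by the axioms of (not necessarily unital) associative algebras.          *)
Section FreeAlgebra.
Context (F : fieldType) (X : Type).

Inductive nuterm : Type :=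
  | TGen of X
  | TZero
  | TAdd of nuterm & nuterm
  | TScale of F & nuterm
  | TMul of nuterm & nuterm.

Inductive nucong : nuterm -> nuterm -> Prop :=
  | cong_refl x : nucong x x
  | cong_sym x y : nucong x y -> nucong y x
  | cong_trans y x z : nucong x y -> nucong y z -> nucong x z
  | cong_add x x' y y' :
      nucong x x' -> nucong y y' -> nucong (TAdd x y) (TAdd x' y')
  | cong_scale a x x' : nucong x x' -> nucong (TScale a x) (TScale a x')
  | cong_mul x x' y y' :
      nucong x x' -> nucong y y' -> nucong (TMul x y) (TMul x' y')
  | cong_addA x y z : nucong (TAdd x (TAdd y z)) (TAdd (TAdd x y) z)
  | cong_addC x y : nucong (TAdd x y) (TAdd y x)
  | cong_add0 x : nucong (TAdd TZero x) x
  | cong_addN x : nucong (TAdd (TScale (-1) x) x) TZero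
  | cong_scaleA a b x : nucong (TScale a (TScale b x)) (TScale (a * b) x)
  | cong_scale1 x : nucong (TScale 1 x) x
  | cong_scaleDr a x y :
      nucong (TScale a (TAdd x y)) (TAdd (TScale a x) (TScale a y))
  | cong_scaleDl a b x :
      nucong (TScale (a + b) x) (TAdd (TScale a x) (TScale b x))
  | cong_mulA x y z : nucong (TMul x (TMul y z)) (TMul (TMul x y) z)
  | cong_mulDl x y z : nucong (TMul (TAdd x y) z) (TAdd (TMul x z) (TMul y z))
  | cong_mulDr x y z : nucong (TMul x (TAdd y z)) (TAdd (TMul x y) (TMul x z))
  | cong_mulZl a x y : nucong (TMul (TScale a x) y) (TScale a (TMul x y))
  | cong_mulZr a x y : nucong (TMul x (TScale a y)) (TScale a (TMul x y)).

HB.instance Definition _ := gen_eqMixin nuterm.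
HB.instance Definition _ := gen_choiceMixin nuterm.

Definition nufree_rel (x y : nuterm) : bool := `[< nucong x y >].

Lemma nufree_relxx : reflexive nufree_rel.
Proof. by move=> x; apply/asboolP; exact: cong_refl. Qed.

Lemma nufree_relC : symmetric nufree_rel.
Proof. by move=> x y; apply/idP/idP => /asboolP /cong_sym ?; apply/asboolP. Qed.

Lemma nufree_rel_trans : transitive nufree_rel.
Proof.
move=> y x z /asboolP xy /asboolP yz; apply/asboolP.
exact: (cong_trans xy yz).
Qed.

Definition nufree_equiv := EquivRel nufree_rel
  nufree_relxx nufree_relC nufree_rel_trans.

Definition nufree : Type := {eq_quot nufree_equiv}%qT.
HB.instance Definition _ := Choice.copy nufree {eq_quot nufree_equiv}%qT.

Definition fpi (x : nuterm) : nufree := \pi_({eq_quot nufree_equiv})%qT x.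
Definition frepr (p : nufree) : nuterm := repr (p : {eq_quot nufree_equiv}%qT).

Lemma freprK : cancel frepr fpi.
Proof. by move=> p; rewrite /fpi /frepr reprK. Qed.

Lemma fpi_eq x y : fpi x = fpi y <-> nucong x y.
Proof.
split; last by move=> xy; apply/eqmodP; apply/asboolP.
by move=> /eqmodP/asboolP.
Qed.

Lemma fpi_repr x : nucong (frepr (fpi x)) x.
Proof. by apply/fpi_eq; rewrite freprK. Qed.

Definition nufree_add (p q : nufree) := fpi (TAdd (frepr p) (frepr q)).
Definition nufree_scale a (p : nufree) := fpi (TScale a (frepr p)).
Definition nufree_mul (p q : nufree) := fpi (TMul (frepr p) (frepr q)).

Lemma fpi_addE x y : nufree_add (fpi x) (fpi y) = fpi (TAdd x y).
Proof. by apply/fpi_eq; apply: cong_add; exact: fpi_repr. Qed.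

Lemma fpi_scaleE a x : nufree_scale a (fpi x) = fpi (TScale a x).
Proof. by apply/fpi_eq; apply: cong_scale; exact: fpi_repr. Qed.

Lemma fpi_mulE x y : nufree_mul (fpi x) (fpi y) = fpi (TMul x y).
Proof. by apply/fpi_eq; apply: cong_mul; exact: fpi_repr. Qed.

Lemma nufree_ind (P : nufree -> Prop) : (forall x, P (fpi x)) -> forall p, P p.
Proof. by move=> Pp p; rewrite -(freprK p). Qed.

Lemma nufree_addA : associative nufree_add.
Proof.
elim/nufree_ind=> x; elim/nufree_ind=> y; elim/nufree_ind=> z.
by rewrite !fpi_addE; apply/fpi_eq; exact: cong_addA.
Qed.

Lemma nufree_addC : commutative nufree_add.
Proof. by move=> p q; apply/fpi_eq; exact: cong_addC. Qed.

Lemma nufree_add0 : left_id (fpi TZero) nufree_add.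
Proof.
by elim/nufree_ind=> x; rewrite fpi_addE; apply/fpi_eq; exact: cong_add0.
Qed.

Lemma nufree_addN :
  left_inverse (fpi TZero) (nufree_scale (-1)) nufree_add.
Proof.
elim/nufree_ind=> x; rewrite fpi_scaleE fpi_addE.
by apply/fpi_eq; exact: cong_addN.
Qed.

HB.instance Definition _ := GRing.isZmodule.Build nufree
  nufree_addA nufree_addC nufree_add0 nufree_addN.

Lemma fpiD x y : fpi (TAdd x y) = fpi x + fpi y.
Proof. by rewrite -fpi_addE. Qed.

Lemma nufree_scaleA a b p :
  nufree_scale a (nufree_scale b p) = nufree_scale (a * b) p.
Proof.
elim/nufree_ind: p => x; rewrite !fpi_scaleE.
by apply/fpi_eq; exact: cong_scaleA.
Qed.

Lemma nufree_scale1 : left_id 1 nufree_scale.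
Proof.
by elim/nufree_ind=> x; rewrite fpi_scaleE; apply/fpi_eq; exact: cong_scale1.
Qed.

Lemma nufree_scaleDr : right_distributive nufree_scale +%R.
Proof.
move=> a; elim/nufree_ind=> x; elim/nufree_ind=> y.
rewrite -fpiD !fpi_scaleE -fpiD.
by apply/fpi_eq; exact: cong_scaleDr.
Qed.

Lemma nufree_scaleDl p : {morph nufree_scale^~ p : a b / a + b}.
Proof.
elim/nufree_ind: p => x a b; rewrite !fpi_scaleE -fpiD.
by apply/fpi_eq; exact: cong_scaleDl.
Qed.

HB.instance Definition _ := GRing.Zmodule_isLmodule.Build F nufree
  nufree_scaleA nufree_scale1 nufree_scaleDr nufree_scaleDl.

HB.instance Definition _ := hasMul.Build nufree nufree_mul.

Lemma fpiM x y : fpi (TMul x y) = fpi x ** fpi y.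
Proof. by rewrite -fpi_mulE. Qed.

Lemma fpiZ a x : fpi (TScale a x) = a *: fpi x.
Proof. by rewrite -fpi_scaleE. Qed.

Lemma nufree_mulA (p q r : nufree) : p ** (q ** r) = p ** q ** r.
Proof.
elim/nufree_ind: p => x; elim/nufree_ind: q => y; elim/nufree_ind: r => z.
by rewrite -!fpiM; apply/fpi_eq; exact: cong_mulA.
Qed.

HB.instance Definition _ := Magma_isSemigroup.Build nufree nufree_mulA.

Fact nufree_mulDl (p q r : nufree) : (p + q) ** r = p ** r + q ** r.
Proof.
elim/nufree_ind: p => x; elim/nufree_ind: q => y; elim/nufree_ind: r => z.
by rewrite -fpiD -!fpiM -fpiD; apply/fpi_eq; exact: cong_mulDl.
Qed.

Fact nufree_mulDr (p q r : nufree) : p ** (q + r) = p ** q + p ** r.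
Proof.
elim/nufree_ind: p => x; elim/nufree_ind: q => y; elim/nufree_ind: r => z.
by rewrite -fpiD -!fpiM -fpiD; apply/fpi_eq; exact: cong_mulDr.
Qed.

Fact nufree_mulZl a (p q : nufree) : (a *: p) ** q = a *: (p ** q).
Proof.
elim/nufree_ind: p => x; elim/nufree_ind: q => y.
by rewrite -fpiZ -!fpiM -fpiZ; apply/fpi_eq; exact: cong_mulZl.
Qed.

Fact nufree_mulZr a (p q : nufree) : p ** (a *: q) = a *: (p ** q).
Proof.
elim/nufree_ind: p => x; elim/nufree_ind: q => y.
by rewrite -fpiZ -!fpiM -fpiZ; apply/fpi_eq; exact: cong_mulZr.
Qed.

HB.instance Definition _ := isBilinearMul.Build F nufree
  nufree_mulDl nufree_mulDr nufree_mulZl nufree_mulZr.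

Definition nugen (x : X) : nufree := fpi (TGen x).

End FreeAlgebra.

(* Classically every type carries a choiceType structure ({classic T}), so
   the vertex and arrow sets are arbitrary.                                 *)
Record digraph : Type := Digraph {
  vertex : choiceType;
  arrow : choiceType;
  src : arrow -> vertex;
  tgt : arrow -> vertex }.

Arguments src {_} _.
Arguments tgt {_} _.

Inductive leavitt_gen (G : digraph) : Type :=
  | GVertex of vertex G
  | GArrow of arrow G
  | GGhost of arrow G.

Arguments GVertex {_} _.
Arguments GArrow {_} _.
Arguments GGhost {_} _.

Section Leavitt.
Context (F : fieldType) (G : digraph).

Local Notation free := (nufree F (leavitt_gen G)).
Local Notation fv v := (nugen F (@GVertex G v)).
Local Notation fa e := (nugen F (@GArrow G e)).
Local Notation fg e := (nugen F (@GGhost G e)).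

Inductive leavitt_rel : free -> free -> Prop :=
  | rel_vv u v : leavitt_rel (fv u ** fv v) (if u == v then fv u else 0)
  | rel_sa e : leavitt_rel (fv (src e) ** fa e) (fa e)
  | rel_at e : leavitt_rel (fa e ** fv (tgt e)) (fa e)
  | rel_tg e : leavitt_rel (fv (tgt e) ** fg e) (fg e)
  | rel_gs e : leavitt_rel (fg e ** fv (src e)) (fg e)
  | rel_CK1 e f :
      leavitt_rel (fg e ** fa f) (if e == f then fv (tgt e) else 0)
  | rel_CK2 v : finite_set [set e | src e = v] ->
      [set e | src e = v] !=set0 ->
      leavitt_rel (fv v) (\sum_(e \in [set e | src e = v]) (fa e ** fg e)).

Definition leavitt_ideal : ideal free :=
  ideal_gen [set z | exists x y, leavitt_rel x y /\ z = x - y].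

Definition leavitt : nualgType F := nuquot leavitt_ideal.

Lemma leavitt_relP x y :
  leavitt_rel x y -> nupi leavitt_ideal x = nupi leavitt_ideal y.
Proof.
by move=> xy; apply/nupi_eq; apply: mem_ideal_gen; exists x, y.
Qed.

Definition lv (v : vertex G) : leavitt := nupi leavitt_ideal (fv v).
Definition la (e : arrow G) : leavitt := nupi leavitt_ideal (fa e).
Definition lg (e : arrow G) : leavitt := nupi leavitt_ideal (fg e).

(* homogeneous n is the component of degree n of the Z-grading *)
Inductive homogeneous : int -> leavitt -> Prop :=
  | homog_v v : homogeneous 0 (lv v)
  | homog_a e : homogeneous 1 (la e)
  | homog_g e : homogeneous (-1) (lg e)
  | homog_mul m n x y :
      homogeneous m x -> homogeneous n y -> homogeneous (m + n) (x ** y)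
  | homog_0 n : homogeneous n 0
  | homog_add n x y :
      homogeneous n x -> homogeneous n y -> homogeneous n (x + y)
  | homog_scale n a x : homogeneous n x -> homogeneous n (a *: x).

Definition graded_ideal (J : ideal leavitt) : Prop :=
  exists S : set leavitt,
    (forall x, S x -> exists n, homogeneous n x) /\
    ideal_set J = ideal_gen S.

Definition largest_graded_in (I J : ideal leavitt) : Prop :=
  [/\ graded_ideal I, ideal_set I `<=` ideal_set J &
      forall K : ideal leavitt, graded_ideal K ->
        ideal_set K `<=` ideal_set J -> ideal_set K `<=` ideal_set I].

End Leavitt.

Arguments lv F {G} v.
Arguments la F {G} e.
Arguments lg F {G} e.

Section Cycles.
Context (G : digraph).

Definition is_cycle (c : seq (arrow G)) : bool :=
  [&& c != [::], cycle (fun e f => tgt e == src f) c & uniq (map src c)].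

(* The vertices on a cycle are the sources of its arrows. *)
Definition no_exit (c : seq (arrow G)) : Prop :=
  forall e, src e \in map src c -> e \in c.

End Cycles.

Section QuotientDigraph.
Context (F : fieldType) (G : digraph) (J : ideal (leavitt F G)).

Definition ideal_vertices : set (vertex G) := [set v | J (lv F v)].

Definition arrows_off (v : vertex G) : set (arrow G) :=
  [set e | src e = v /\ ~ ideal_vertices (tgt e)].

Definition breaking_vertices : set (vertex G) :=
  [set v | [/\ infinite_set [set e | src e = v],
               arrows_off v !=set0 & finite_set (arrows_off v)]].

Definition breaking_elt (v : vertex G) : leavitt F G :=
  lv F v - \sum_(e \in arrows_off v) (la F e ** lg F e).

Definition ideal_breaking : set (vertex G) :=
  [set v | breaking_vertices v /\ J (breaking_elt v)].

Definition primed : set (vertex G) := breaking_vertices `\` ideal_breaking.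

Lemma ideal_vertices_hereditary (e : arrow G) :
  ideal_vertices (src e) -> ideal_vertices (tgt e).
Proof.
rewrite /ideal_vertices /= => Js; have [_ _ _ Jl Jr] := idealP J.
have -> : lv F (tgt e) = lg F e ** (lv F (src e) ** la F e).
  have -> : lv F (src e) ** la F e = la F e.
    by rewrite -nupiM; apply: leavitt_relP; exact: rel_sa.
  by rewrite -nupiM (leavitt_relP (rel_CK1 F e e)) eqxx.
by apply: Jl; apply: Jr.
Qed.

Lemma src_off (e : arrow G) :
  ~ ideal_vertices (tgt e) -> ~ ideal_vertices (src e).
Proof. by move=> Ht Hs; apply: Ht; exact: ideal_vertices_hereditary. Qed.

Lemma src_primed (e : arrow G) : primed (tgt e) -> ~ ideal_vertices (src e).
Proof.
move=> [[_ [f [fe Hf]] _] _]; apply: src_off => He; apply: Hf.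
by apply: ideal_vertices_hereditary; rewrite fe.
Qed.

Definition quot_vertex : choiceType :=
  (set_type (~` ideal_vertices) + set_type primed)%type.

Definition quot_arrow : choiceType :=
  (set_type [set e : arrow G | ~ ideal_vertices (tgt e)] +
   set_type [set e : arrow G | primed (tgt e)])%type.

Definition quot_src (a : quot_arrow) : quot_vertex :=
  match a with
  | inl e => inl (exist _ (src (val e)) (mem_set (src_off (set_mem (valP e)))))
  | inr e => inl (exist _ (src (val e)) (mem_set (src_primed (set_mem (valP e)))))
  end.

Definition quot_tgt (a : quot_arrow) : quot_vertex :=
  match a with
  | inl e => inl (exist _ (tgt (val e)) (mem_set (set_mem (valP e))))
  | inr e => inr (exist _ (tgt (val e)) (mem_set (set_mem (valP e))))
  end.

Definition quot_digraph : digraph := Digraph quot_src quot_tgt.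

(* c is a cycle of the quotient digraph, without exit there. The primed
   vertices are sinks, so a cycle of the quotient has unprimed arrows only. *)
Definition no_exit_cycle_in_quot (c : seq (arrow G)) : Prop :=
  exists c' : seq (set_type [set e : arrow G | ~ ideal_vertices (tgt e)]),
    let c1 : seq (arrow quot_digraph) := map inl c' in
    [/\ c = map val c', is_cycle c1 & no_exit c1].

End QuotientDigraph.

Section Strata.
Context (F : fieldType) (G : digraph).
Implicit Types (I J : ideal (leavitt F G)) (c : seq (arrow G)).

(* C^n in the Leavitt path algebra, with C^0 the source vertex of C *)
Definition cycle_pow c (n : nat) : leavitt F G :=
  if c is e :: _ then
    iter n (fun x => foldr (fun f y => la F f ** y) x c) (lv F (src e))
  else 0.

(* the element f(C) of F[C] *)
Definition cycle_eval c (f : {poly F}) : leavitt F G :=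
  \sum_(i < size f) f`_i *: cycle_pow c i.

(* the intersection of J with F[C] is a proper nonzero ideal of F[C] *)
Definition meets_properly J c : Prop :=
  (exists f, J (cycle_eval c f) /\ cycle_eval c f <> 0) /\
  (exists f, ~ J (cycle_eval c f)).

Definition is_canon_poly J c (f : {poly F}) : Prop :=
  f.[0] = 1 /\ forall g, J (cycle_eval c g) <-> f %| g.

(* f_C, when the intersection of J with F[C] is proper and nonzero *)
Definition canon_poly J c : {poly F} := xget 1 [set f | is_canon_poly J c f].

(* Linear factors are distinct when they are not associate, that is, when
   their roots are distinct.                                                *)
Definition distinct_linear_factors (f : {poly F}) : Prop :=
  exists (a : F) (rs : seq F),
    [/\ a != 0, uniq rs & f = a *: \prod_(r <- rs) ('X - r%:P)].

Definition dlf J : Prop :=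
  forall c, is_cycle c -> meets_properly J c ->
    distinct_linear_factors (canon_poly J c).

(* A geometric cycle is a cycle up to rotation: a set of geometric cycles is
   encoded by the rotation-stable set of all the cycles representing them.  *)
Definition geometric_cycle_set (beta : set (seq (arrow G))) : Prop :=
  forall c k, beta c -> is_cycle c /\ beta (rot k c).

Definition stratum I (beta : set (seq (arrow G))) : set (ideal (leavitt F G)) :=
  [set J | largest_graded_in I J /\
    beta = [set c | no_exit_cycle_in_quot I c /\ meets_properly J c]].

Definition stratum_deg I beta (d : seq (arrow G) -> nat) :
    set (ideal (leavitt F G)) :=
  [set J | stratum I beta J /\
    forall c, beta c -> size (canon_poly J c) = (d c).+1].

(* The point (a_1, ..., a_n) for f_C = 1 + a_1 x + ... + a_n x^n. *)
Definition coordinate J c (n : nat) : 'rV[F]_n :=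
  \row_(i < n) (canon_poly J c)`_(i.+1).

End Strata.

Section AffineFactors.
Context (F : fieldType) (n : nat).

(* A_n: the tuples (a_1, ..., a_n) with a_n nonzero; a_i is a 0 (i - 1). *)
Definition affine_factor : set 'rV[F]_n :=
  [set a | forall i : 'I_n, i.+1 = n -> a 0 i != 0].

Definition poly_of_point (a : 'rV[F]_n) : {poly F} :=
  1 + \sum_(i < n) a 0 i *: 'X^(i.+1).

Definition dlf_points : set 'rV[F]_n :=
  [set a | affine_factor a /\ distinct_linear_factors (poly_of_point a)].

Definition zariski_closed (Z : set 'rV[F]_n) : Prop :=
  exists S : set (mpoly.mpoly n F),
    Z = [set a | forall p, S p -> mpoly.meval (fun i => a 0 i) p = 0].

Definition zariski_open (U : set 'rV[F]_n) : Prop := zariski_closed (~` U).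

End AffineFactors.

Arguments affine_factor F n : clear implicits.
Arguments dlf_points F n : clear implicits.

(* U is an open dense subset of A, for the topology induced on A by a
   topology given by its open sets.                                         *)
Definition open_dense_in (T : Type) (opens : set (set T)) (A U : set T) : Prop :=
  (exists O, opens O /\ U = A `&` O) /\
  (forall O, opens O -> A `&` O !=set0 -> U `&` O !=set0).

(* The usual topology on C^n, for C = R[i]; the cast selects the topology given
   by the modulus.                                                          *)
Definition euclidean_open (R : realType) (n : nat) : set (set 'rV[R[i]]_n) :=
  @open 'rV[(R[i] : numFieldType)]_n.

(* Main.v *)
(* For the topological part, the points of [A_n] whose polynomial [f] is a
   product of distinct linear factors are those where the Sylvester determinant
   of [f] and [f'] does not vanish.  Through any point of [A_n] passes a line
   meeting this set, and a nonzero polynomial in one variable has few roots.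

   For the quotient by [J], let [r_1, ..., r_d] be the distinct roots of [f_C]
   for a cycle [C] of [beta].  Modulo [J] the Lagrange polynomials of these
   roots, evaluated at the rotations of [C], split each vertex of [C] into [d]
   orthogonal idempotents, on which [C] acts as the nonzero scalars [r_i].
   Hence one arrow of the cycle is redundant, and the idempotents together with
   the arrows cut down by them satisfy the Leavitt relations of the digraph
   obtained from [Gamma/J] by replacing each cycle of [beta] by [d] copies of
   the cycle with one arrow removed.  The resulting homomorphism onto the
   quotient by [J] is injective by the reduction theorem: a nonzero ideal of a
   Leavitt path algebra contains a vertex or some [q(C)] with [q(0) != 0] and
   [C] a cycle without exit.  The first is impossible as the idempotents are
   not in [J]; the second would make [C] a cycle of [beta], and these have
   been cut.  No description of generators of [J] is needed. *)

From HB Require Import structures.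
Require Import Defs.
From mathcomp Require Import all_boot all_order all_algebra separable.
From mathcomp Require Import boolp classical_sets functions cardinality fsbigop.
From mathcomp Require Import reals topology normedtype complex.
From mathcomp Require Import finmap zify.
From mathcomp Require mpoly.
Import (canonicals, coercions) mpoly.

Set Implicit Arguments.
Unset Strict Implicit.
Unset Printing Implicit Defensive.

Import Order.TTheory GRing.Theory Num.Theory.
Import numFieldNormedType.Exports.
Local Open Scope ring_scope.

(** * Algebras without unit and their ideals *)

(** The algebras are given by generators and relations, with no basis or faithful representation at
    hand, so nothing is known beforehand to be nonzero. Independence is extracted from the ideal
    itself: paths are linearly independent modulo any ideal that contains no vertex and no [q(C)] as
    in the reduction theorem, and this drives its proof. The quotient by [J] carries no grading in
    general, so uniqueness theorems for graded homomorphisms do not apply, and cycles without exit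
    need separate care.

    Cutting an arrow is forced: an uncut copy of a cycle would give Laurent polynomials at its
    vertices, whereas modulo [J] the powers of [C] span only a copy of [F^d]. The cut arrow is still
    in the image because [f_C(0) = 1] makes every root nonzero, so that [C] acts invertibly on each
    idempotent.

    The ideals [I] and [J] are compared only through vertices and the elements [v^H]. These are
    homogeneous, hence lie in [I] as soon as they lie in [J], so the two quotient digraphs
    coincide. *)

Section NUAlgebraTheory.
Context (F : fieldType) (A : nualgType F).
Implicit Types x y z : A.

Lemma nu0l x : 0 ** x = 0.
Proof. by rewrite -[X in X ** x](scale0r (0 : A)) nuZl scale0r. Qed.

Lemma nu0r x : x ** 0 = 0.
Proof. by rewrite -[X in x ** X](scale0r (0 : A)) nuZr scale0r. Qed.

Lemma nuNl x y : (- x) ** y = - (x ** y).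
Proof. by rewrite -scaleN1r nuZl scaleN1r. Qed.

Lemma nuNr x y : x ** (- y) = - (x ** y).
Proof. by rewrite -scaleN1r nuZr scaleN1r. Qed.

Lemma nuBl x y z : (x - y) ** z = x ** z - y ** z.
Proof. by rewrite nuDl nuNl. Qed.

Lemma nuBr x y z : x ** (y - z) = x ** y - x ** z.
Proof. by rewrite nuDr nuNr. Qed.

Lemma nu_suml (I : Type) (r : seq I) (P : pred I) (E : I -> A) y :
  (\sum_(i <- r | P i) E i) ** y = \sum_(i <- r | P i) (E i ** y).
Proof.
by elim/big_rec2: _ => [|i x z _ <-]; rewrite ?nu0l ?nuDl.
Qed.

Lemma nu_sumr (I : Type) (r : seq I) (P : pred I) (E : I -> A) y :
  y ** (\sum_(i <- r | P i) E i) = \sum_(i <- r | P i) (y ** E i).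
Proof.
by elim/big_rec2: _ => [|i x z _ <-]; rewrite ?nu0r ?nuDr.
Qed.

End NUAlgebraTheory.

Section IdealTheory.
Context (F : fieldType) (A : nualgType F) (J : ideal A).
Implicit Types x y : A.

Lemma nuideal0 : J 0. Proof. by case: (idealP J). Qed.

Lemma nuidealD x y : J x -> J y -> J (x + y).
Proof. by case: (idealP J) => _ + _ _ _; apply. Qed.

Lemma nuidealZ a x : J x -> J (a *: x).
Proof. by case: (idealP J) => _ _ + _ _; apply. Qed.

Lemma nuidealN x : J x -> J (- x).
Proof. by rewrite -scaleN1r; apply: nuidealZ. Qed.

Lemma nuidealB x y : J x -> J y -> J (x - y).
Proof. by move=> Jx /nuidealN; apply: nuidealD. Qed.

Lemma nuidealMl x y : J y -> J (x ** y).
Proof. by case: (idealP J) => _ _ _ + _; apply. Qed.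

Lemma nuidealMr x y : J x -> J (x ** y).
Proof. by case: (idealP J) => _ _ _ _; apply. Qed.

Lemma nupi0P x : nupi J x = 0 <-> J x.
Proof. by rewrite -[0]/(nupi J 0) nupi_eq subr0. Qed.

Lemma nupiN x : nupi J (- x) = - nupi J x.
Proof. by rewrite -!scaleN1r nupiZ. Qed.

Lemma nupiB x y : nupi J (x - y) = nupi J x - nupi J y.
Proof. by rewrite nupiD nupiN. Qed.

Lemma nupi_sum (I : Type) (r : seq I) (P : pred I) (E : I -> A) :
  nupi J (\sum_(i <- r | P i) E i) = \sum_(i <- r | P i) nupi J (E i).
Proof. by elim/big_rec2: _ => // i x z _ <-; rewrite nupiD. Qed.

End IdealTheory.

Lemma ideal_gen_min (F : fieldType) (A : nualgType F) (S : set A) (J : ideal A)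
  :
  (S `<=` ideal_set J)%classic -> (ideal_gen S `<=` ideal_set J)%classic.
Proof. by move=> SJ x; apply; split=> //; exact: idealP. Qed.

(** * The defining relations in the Leavitt path algebra *)

Section LeavittRelations.
Context (F : fieldType) (G : digraph).
Local Notation V := (@lv F G).
Local Notation a := (@la F G).
Local Notation g := (@lg F G).

Lemma lvv u v : V u ** V v = if u == v then V u else 0.
Proof. by rewrite -nupiM (leavitt_relP (rel_vv F u v)); case: ifP. Qed.

Lemma lvvid v : V v ** V v = V v.
Proof. by rewrite lvv eqxx. Qed.

Lemma lva e : V (src e) ** a e = a e.
Proof. by rewrite -nupiM (leavitt_relP (rel_sa F e)). Qed.

Lemma lav e : a e ** V (tgt e) = a e.
Proof. by rewrite -nupiM (leavitt_relP (rel_at F e)). Qed.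

Lemma lvg e : V (tgt e) ** g e = g e.
Proof. by rewrite -nupiM (leavitt_relP (rel_tg F e)). Qed.

Lemma lgv e : g e ** V (src e) = g e.
Proof. by rewrite -nupiM (leavitt_relP (rel_gs F e)). Qed.

Lemma lga e f : g e ** a f = if e == f then V (tgt e) else 0.
Proof. by rewrite -nupiM (leavitt_relP (rel_CK1 F e f)); case: ifP. Qed.

Lemma lgaid e : g e ** a e = V (tgt e).
Proof. by rewrite lga eqxx. Qed.

Lemma lga_neq e f : e != f -> g e ** a f = 0.
Proof. by rewrite lga => /negPf->. Qed.

Lemma lva_neq v e : v != src e -> V v ** a e = 0.
Proof. by move=> ve; rewrite -lva mulgA lvv (negPf ve) nu0l. Qed.

Lemma lgv_neq v e : src e != v -> g e ** V v = 0.
Proof. by move=> ve; rewrite -lgv -mulgA lvv (negPf ve) nu0r. Qed.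

Lemma set_of_seq (T : choiceType) (r : seq T) (D : set T) :
  (forall e, e \in r <-> D e) -> D = [set` r]%classic.
Proof. by move=> rD; apply/seteqP; split=> e /= /rD. Qed.

Lemma lCK2 v (r : seq (arrow G)) : uniq r -> r != [::] ->
    (forall e, e \in r <-> src e = v) -> V v = \sum_(e <- r) a e ** g e.
Proof.
move=> ur r0 rv; have Dr := set_of_seq rv.
have fin : finite_set [set e | src e = v]%classic by rewrite Dr;
  exact: finite_seq.
have ne : ([set e | src e = v] !=set0)%classic.
  by case: r r0 rv {ur Dr} => // e r _ rv; exists e => /=; apply/rv;
    rewrite mem_head.
rewrite [LHS](leavitt_relP (rel_CK2 F fin ne)) Dr -fsbig_seq //.
by rewrite nupi_sum; apply: eq_bigr => e _; rewrite nupiM.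
Qed.

End LeavittRelations.

(** * Universal property of Leavitt path algebras *)

Section UniversalProperty.
Context (F : fieldType) (G : digraph) (A : nualgType F).
Variable h : leavitt_gen G -> A.

Fixpoint term_eval (t : nuterm F (leavitt_gen G)) : A :=
  match t with
  | TGen x => h x
  | TZero => 0
  | TAdd t u => term_eval t + term_eval u
  | TScale k t => k *: term_eval t
  | TMul t u => term_eval t ** term_eval u
  end.

Lemma term_eval_cong t u : nucong t u -> term_eval t = term_eval u.
Proof.
elim=> //= *; try congruence.
- exact: addrA.
- exact: addrC.
- exact: add0r.
- by rewrite scaleN1r addNr.
- exact: scalerA.
- exact: scale1r.
- exact: scalerDr.
- exact: scalerDl.
- exact: mulgA.
- exact: nuDl.
- exact: nuDr.
- exact: nuZl.
- exact: nuZr.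
Qed.

Definition free_eval (p : nufree F (leavitt_gen G)) : A := term_eval (frepr p).

Lemma free_evalE t : free_eval (fpi t) = term_eval t.
Proof. by apply: term_eval_cong; exact: fpi_repr. Qed.

Lemma free_evalD p q : free_eval (p + q) = free_eval p + free_eval q.
Proof. by rewrite -{1}(freprK p) -{1}(freprK q) -fpiD free_evalE. Qed.

Lemma free_evalZ k p : free_eval (k *: p) = k *: free_eval p.
Proof. by rewrite -{1}(freprK p) -fpiZ free_evalE. Qed.

Lemma free_evalM p q : free_eval (p ** q) = free_eval p ** free_eval q.
Proof. by rewrite -{1}(freprK p) -{1}(freprK q) -fpiM free_evalE. Qed.

Lemma free_eval0 : free_eval 0 = 0.
Proof. by rewrite -(scale0r (0 : nufree _ _)) free_evalZ scale0r. Qed.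

Lemma free_evalB p q : free_eval (p - q) = free_eval p - free_eval q.
Proof. by rewrite -!scaleN1r free_evalD free_evalZ. Qed.

Lemma free_eval_sum (I : Type) (r : seq I) (E : I -> nufree F (leavitt_gen G)) :
  free_eval (\sum_(i <- r) E i) = \sum_(i <- r) free_eval (E i).
Proof.
by elim/big_rec2: _ => [|i x z _ <-]; rewrite ?free_eval0 ?free_evalD.
Qed.

Hypothesis hvv : forall u v,
  h (GVertex u) ** h (GVertex v) = if u == v then h (GVertex u) else 0.
Hypothesis hva : forall e, h (GVertex (src e)) ** h (GArrow e) = h (GArrow e).
Hypothesis hav : forall e, h (GArrow e) ** h (GVertex (tgt e)) = h (GArrow e).
Hypothesis hvg : forall e, h (GVertex (tgt e)) ** h (GGhost e) = h (GGhost e).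
Hypothesis hgv : forall e, h (GGhost e) ** h (GVertex (src e)) = h (GGhost e).
Hypothesis hga : forall e f,
  h (GGhost e) ** h (GArrow f) = if e == f then h (GVertex (tgt e)) else 0.
Hypothesis hCK2 : forall v r, uniq r -> r != [::] ->
  (forall e, e \in r <-> src e = v) ->
  h (GVertex v) = \sum_(e <- r) h (GArrow e) ** h (GGhost e).

Lemma free_eval_rel p q : leavitt_rel p q -> free_eval p = free_eval q.
Proof.
case.
- by move=> u v; rewrite free_evalM 2!free_evalE /= hvv; case: ifP => _;
    rewrite ?free_evalE ?free_eval0.
- by move=> e; rewrite free_evalM !free_evalE /= hva.
- by move=> e; rewrite free_evalM !free_evalE /= hav.
- by move=> e; rewrite free_evalM !free_evalE /= hvg.
- by move=> e; rewrite free_evalM !free_evalE /= hgv.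
- by move=> e f; rewrite free_evalM 2!free_evalE /= hga; case: ifP => _;
    rewrite ?free_evalE ?free_eval0.
- move=> v fin [e0 e0v].
  rewrite free_evalE /= fsbig_finite //= free_eval_sum.
  rewrite (@hCK2 v (fset_set [set e | src e = v]%classic)) //.
  + by apply: eq_bigr => e _; rewrite free_evalM !free_evalE.
  + apply/negP => /eqP r0; suff : e0 \in [::] by [].
    by rewrite -r0 in_fset_set //; exact/mem_set.
  + by move=> e; rewrite in_fset_set //; split=> [/set_mem|/mem_set].
Qed.

Definition leavitt_eval (x : leavitt F G) : A := free_eval (nurepr x).

Lemma free_eval_ideal p : leavitt_ideal F G p -> free_eval p = 0.
Proof.
move=> Jp; pose K := [set q | free_eval q = 0]%classic.
have KI : is_ideal K.
  split.
  - exact: free_eval0.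
  - by move=> x y; rewrite /K /= free_evalD => -> ->; rewrite addr0.
  - by move=> k x; rewrite /K /= free_evalZ => ->; rewrite scaler0.
  - by move=> x y; rewrite /K /= free_evalM => ->; rewrite nu0r.
  - by move=> x y; rewrite /K /= free_evalM => ->; rewrite nu0l.
apply: (Jp K); split=> // _ [x [y [xy ->]]].
by rewrite /K /= free_evalB (free_eval_rel xy) subrr.
Qed.

Lemma leavitt_evalE p : leavitt_eval (nupi (leavitt_ideal F G) p) = free_eval p.
Proof.
apply/eqP; rewrite -subr_eq0 -free_evalB; apply/eqP/free_eval_ideal.
exact: nupi_repr.
Qed.

Lemma leavitt_eval_is_linear : linear leavitt_eval.
Proof.
move=> k x y; rewrite -(nureprK x) -(nureprK y).
by rewrite -nupiZ -nupiD !leavitt_evalE free_evalD free_evalZ.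
Qed.

HB.instance Definition _ :=
  GRing.isLinear.Build F (leavitt F G) A *:%R leavitt_eval
    leavitt_eval_is_linear.

Lemma leavitt_hom_exists : exists f : {linear leavitt F G -> A},
  [/\ {morph f : x y / x ** y}, forall v, f (lv F v) = h (GVertex v),
      forall e, f (la F e) = h (GArrow e) & forall e,
        f (lg F e) = h (GGhost e)].
Proof.
by exists leavitt_eval; split=> [x y|v|e|e] /=;
  rewrite ?leavitt_evalE ?free_evalE.
Qed.

End UniversalProperty.

Lemma leavitt_ind (F : fieldType) (G : digraph) (P : leavitt F G -> Prop) :
  (forall v, P (lv F v)) -> (forall e, P (la F e)) -> (forall e, P (lg F e)) ->
  P 0 -> (forall x y, P x -> P y -> P (x + y)) ->
  (forall k x, P x -> P (k *: x)) ->
  (forall x y, P x -> P y -> P (x ** y)) -> forall x, P x.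
Proof.
move=> Pv Pa Pg P0 PD PZ PM x; rewrite -(nureprK x) -(freprK (nurepr x)).
elim: (frepr _) => [[]||t Pt u Pu|k t Pt|t Pt u Pu] //.
- by rewrite fpiD nupiD; apply: PD.
- by rewrite fpiZ nupiZ; apply: PZ.
- by rewrite fpiM nupiM; apply: PM.
Qed.

(** * Walks, cycles and paths *)

Section Walks.
Context (G : digraph).
Implicit Types (v w : vertex G) (e f : arrow G) (s t c : seq (arrow G)).

Fixpoint walk v s : bool :=
  if s is e :: s' then (src e == v) && walk (tgt e) s' else true.

Definition wend v s : vertex G := last v (map tgt s).

Lemma wend_cat v s t : wend v (s ++ t) = wend (wend v s) t.
Proof. by rewrite /wend map_cat last_cat. Qed.

Lemma walk_cat v s t : walk v (s ++ t) = walk v s && walk (wend v s) t.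
Proof. by elim: s v => //= e s IH v; rewrite IH andbA. Qed.

Lemma is_cycleE e s : is_cycle (e :: s) =
  [&& walk (tgt e) s, wend (tgt e) s == src e & uniq (map src (e :: s))].
Proof.
have pathE h : path (fun e f => tgt e == src f) e (rcons s h) =
    walk (tgt e) s && (wend (tgt e) s == src h).
  elim: s e => [|f s IH] e /=; first by rewrite andbT.
  by rewrite IH eq_sym andbA.
by rewrite /is_cycle /= pathE -andbA.
Qed.

Lemma is_cycle_cons c : is_cycle c -> exists e s, c = e :: s.
Proof. by case: c => // e s _; exists e, s. Qed.

Lemma is_cycle_rot k c : is_cycle (rot k c) = is_cycle c.
Proof.
by rewrite /is_cycle rot_cycle map_rot rot_uniq -!size_eq0 size_rot.
Qed.

Lemma is_cycle_tgt c e : is_cycle c -> e \in c -> tgt e \in map src c.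
Proof.
move=> cc ec; have [k s rk] := rot_to ec.
have : is_cycle (e :: s) by rewrite -rk is_cycle_rot.
rewrite is_cycleE => /and3P[ws ends _].
rewrite -(mem_rot k) -map_rot rk.
case: s ws ends {rk} => [|h s] /=; first by rewrite /wend /= => _ /eqP->;
  rewrite mem_head.
by case/andP => /eqP<- _ _; rewrite !inE eqxx orbT.
Qed.

Lemma is_cycle_pred c v : is_cycle c -> v \in map src c ->
  exists2 e, e \in c & tgt e = v.
Proof.
move=> cc /mapP[f fc ->]; have [k s rk] := rot_to fc.
have : is_cycle (f :: s) by rewrite -rk is_cycle_rot.
rewrite is_cycleE => /and3P[ws /eqP ends _].
have : last f s \in c by rewrite -(mem_rot k) rk mem_last.
by exists (last f s) => //; rewrite -ends /wend last_map.
Qed.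

Lemma is_cycle_src_inj c e f : is_cycle c -> e \in c -> f \in c ->
  src e = src f -> e = f.
Proof.
case/and3P => _ _ uc ec fc; apply: contra_eq => /negP ef.
have [k s rk] := rot_to ec.
have : uniq (map src (rot k c)) by rewrite map_rot rot_uniq.
rewrite rk /= => /andP[/negP es _]; apply/negP => /eqP ef'; apply: es.
move: fc; rewrite -(mem_rot k) rk inE => /orP[/eqP fe|fs]; first by case: ef;
  rewrite fe.
by rewrite ef'; exact: map_f.
Qed.

Section Deterministic.
Variable P : pred (arrow G).

(** The predicate [P] selects the admissible arrows: all of them for cycles without exit in the
    digraph itself, those with target outside [J] for cycles without exit in the quotient
    digraph. *)
Definition sole_exits c := forall e f, e \in c -> P f -> src f = src e -> f = e.

(** At each vertex along [s] only one arrow is available to [t], so the two walks agree until one of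
    them stops. *)
Lemma sole_exits_cmp v s t : sole_exits s -> all P t -> walk v s -> walk v t ->
  (exists r, t = s ++ r) \/ (exists r, s = t ++ r).
Proof.
elim: s v t => [|e s IH] v [|f t] os /=; [by left; exists [::]|by left;
  exists (f :: t)|by right; exists (e :: s)|].
case/andP => Pf Pt /andP[/eqP ev ws] /andP[/eqP fv wt].
have fe : f = e by apply: os; rewrite ?mem_head // fv.
rewrite {f Pf fv}fe in wt *.
have os' : sole_exits s by move=> h h' hs; apply: os; rewrite inE hs orbT.
by case: (IH _ t os' Pt ws wt) => -[r ->]; [left|right]; exists r.
Qed.

(** The walk [s] has to follow the cycle; stopping at [src e] before the cycle is complete would
    repeat a source. *)
Lemma cycle_prefix e c s : is_cycle (e :: c) -> sole_exits (e :: c) ->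
  all P s -> s != [::] -> walk (src e) s -> wend (src e) s = src e ->
  exists t, s = (e :: c) ++ t.
Proof.
move=> cc oc Ps s0 ws ends; move: (cc); rewrite is_cycleE => /and3P[wc endc uc].
have wc' : walk (src e) (e :: c) by rewrite /= eqxx.
case: (sole_exits_cmp oc Ps wc' ws) => -[r er]; first by exists r.
case: r er => [|h r] er; first by exists [::]; rewrite er !cats0.
case: s s0 ws er ends {Ps} => // e' s _ ws [ee er] ends.
move: wc' => /=; rewrite er walk_cat /= => /and3P[_ _ /andP[/eqP sh _]].
have {}ends : wend (tgt e) s = src e by rewrite {1}ee.
by move: uc; rewrite er /= map_cat mem_cat /= sh ends mem_head orbT.
Qed.

End Deterministic.

(** Induction on the length: if a source is repeated, the walk contains a shorter closed walk at the
    same [w]. *)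
Lemma sole_exits_cycle w s : sole_exits predT s -> s != [::] -> walk w s ->
  wend w s = w -> exists e c,
  [/\ src e = w, is_cycle (e :: c) & sole_exits predT (e :: c)].
Proof.
have [n] := ubnP (size s).
elim: n w s => // n IH w [|e s] //; rewrite ltnS => sn os _ ws ends.
have se : src e = w by case/andP: ws => /eqP.
case: (boolP (uniq (map src (e :: s)))) => us.
  exists e, s; split=> //; rewrite is_cycleE us andbT.
  by move: ws ends => /= /andP[_ ->] /eqP; rewrite -se.
have [s1 [f [s2 [h [s3 [es fh]]]]]] : exists s1 f s2 h s3,
    e :: s = s1 ++ f :: s2 ++ h :: s3 /\ src f = src h.
  elim: (e :: s) us {IH sn os ws ends} => //= f t IHt; rewrite negb_and negbK.
  case/orP => [/mapP[h ht fh]|/IHt[s1 [f' [s2 [h [s3 [-> fh]]]]]]]; last first.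
    by exists (f :: s1), f', s2, h, s3.
  by case/splitPr: ht => s2 s3; exists [::], f, s2, h, s3.
rewrite es in os ws ends.
move: (ws); rewrite walk_cat => /andP[w1 w2].
move: (w2); rewrite -cat_cons walk_cat => /andP[w3 w4].
have fw : src f = wend w s1 by case/andP: w2 => /eqP.
have hw : src h = wend (wend w s1) (f :: s2) by case/andP: w4 => /eqP.
have o2 : sole_exits predT (f :: s2 ++ h :: s3).
  by move=> x y xs; apply: os; rewrite mem_cat xs orbT.
have o3 : sole_exits predT (h :: s3).
  by move=> x y xs; apply: o2; rewrite -cat_cons mem_cat xs orbT.
have w4' : walk (wend w s1) (h :: s3) by rewrite /= -fw fh eqxx; case/andP: w4.
(* From the repeated vertex the walk is forced, so its tail [h :: s3] is also a prefix of
   [f :: s2 ++ h :: s3]. As this tail ends at [w], the remainder [r] is a closed walk at [w], as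
   long as the loop [f :: s2]. *)
have [[r er]|[r er]] := sole_exits_cmp o3 (all_predT _) w4' w2; last first.
  by move/(congr1 size): er; rewrite /= !size_cat /= ?size_cat /=; lia.
have rend : wend (wend w s1) (h :: s3) = w.
  move: ends; rewrite wend_cat -cat_cons wend_cat -hw => <-.
  by [].
have szr : size r = (size s2).+1.
  by move/(congr1 size): er; rewrite /= !size_cat /=; lia.
apply: (IH w r).
- move: sn => /= sn; move/(congr1 size): es;
    rewrite /= !size_cat /= ?size_cat /=; lia.
- by move=> x y xr; apply: o2; rewrite er mem_cat xr orbT.
- by rewrite -size_eq0 szr.
- by move: w2; rewrite er walk_cat rend => /andP[].
- by have := ends; rewrite wend_cat er wend_cat rend.
Qed.



End Walks.

(** * Paths and polynomials in a cycle as elements of the algebra *)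

Section Paths.
Context (F : fieldType) (G : digraph).
Local Notation V := (@lv F G).
Local Notation a := (@la F G).
Local Notation g := (@lg F G).
Implicit Types (v w : vertex G) (e f : arrow G) (s t c : seq (arrow G)) (q r :
  {poly F}).

(** The base point [v] only matters for the empty walk, whose value is the vertex [v]. *)
Definition lpath v s : leavitt F G := foldr (fun f y => a f ** y) (V (wend v
  s)) s.

Lemma lpath_cons v e s : lpath v (e :: s) = a e ** lpath (tgt e) s.
Proof. by []. Qed.

Lemma lpath_act v s t :
  foldr (fun f y => a f ** y) (lpath (wend v s) t) s = lpath v (s ++ t).
Proof. by elim: s v => //= e s IH v; congr (_ * _)%g; exact: (IH (tgt e)). Qed.

Lemma lv_lpath v s : walk v s -> V v ** lpath v s = lpath v s.
Proof.
case: s => [|e s] /=; first by rewrite lvvid.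
by case/andP => /eqP<- _; rewrite mulgA lva.
Qed.

Lemma lv_lpath_neq u v s : walk v s -> u != v -> V u ** lpath v s = 0.
Proof. by move=> vs uv; rewrite -lv_lpath // mulgA lvv (negPf uv) nu0l. Qed.

Lemma lpath_lv v s : lpath v s ** V (wend v s) = lpath v s.
Proof.
elim: s v => [|e s IH] v; first by rewrite lvvid.
by rewrite lpath_cons -mulgA -{2}(IH (tgt e)).
Qed.

Lemma lpath_lv_neq u v s : wend v s != u -> lpath v s ** V u = 0.
Proof. by move=> vs; rewrite -lpath_lv -mulgA lvv (negPf vs) nu0r. Qed.

Lemma lpath_cat v s t : walk (wend v s) t ->
  lpath v s ** lpath (wend v s) t = lpath v (s ++ t).
Proof.
elim: s v => [|e s IH] v wt /=; first by rewrite lv_lpath.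
by rewrite !lpath_cons -mulgA (IH (tgt e)).
Qed.

Lemma lpath_la v s e : src e = wend v s ->
  lpath v s ** a e = lpath v (rcons s e).
Proof.
move=> se; rewrite -cats1 -lpath_cat /= ?se ?eqxx //.
by rewrite /lpath /= lav.
Qed.

Lemma lpath_la_neq v s e : src e != wend v s -> lpath v s ** a e = 0.
Proof. by move=> se; rewrite -lva mulgA lpath_lv_neq ?nu0l // eq_sym. Qed.

Lemma lg_lpath v e s : walk (tgt e) s ->
  g e ** lpath v (e :: s) = lpath (tgt e) s.
Proof. by move=> ws; rewrite lpath_cons mulgA lgaid lv_lpath. Qed.

Lemma lg_lpath_neq v e f s : e != f -> g e ** lpath v (f :: s) = 0.
Proof. by move=> ef; rewrite lpath_cons mulgA lga_neq // nu0l. Qed.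

Lemma cycle_powE e c n : wend (src e) (e :: c) = src e ->
  cycle_pow F (e :: c) n = lpath (src e) (flatten (nseq n (e :: c))).
Proof.
move=> ec; elim: n => // n IH.
by rewrite -[RHS]/(lpath (src e) ((e :: c) ++ flatten (nseq n (e :: c))))
  -lpath_act ec -IH.
Qed.

Lemma cycle_eval_widen c (q : {poly F}) n : (size q <= n)%N ->
  cycle_eval c q = \sum_(i < n) q`_i *: cycle_pow F c i.
Proof.
move=> qn; rewrite /cycle_eval (big_ord_widen n (fun i => q`_i *: cycle_pow F c
  i) qn).
rewrite big_mkcond /=; apply: eq_bigr => i _; case: ltnP => // qi.
by rewrite nth_default // scale0r.
Qed.

Lemma cycle_evalD c q r : cycle_eval c (q + r) = cycle_eval c q + cycle_eval c
  r.
Proof.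
pose n := maxn (size q) (size r).
rewrite !(@cycle_eval_widen _ _ n) ?leq_maxl ?leq_maxr //;
  last exact: size_polyD.
by rewrite -big_split; apply: eq_bigr => i _; rewrite coefD scalerDl.
Qed.

Lemma cycle_evalZ c k q : cycle_eval c (k *: q) = k *: cycle_eval c q.
Proof.
rewrite (@cycle_eval_widen _ _ (size q)) ?size_scale_leq // scaler_sumr.
by apply: eq_bigr => i _; rewrite coefZ scalerA.
Qed.

Lemma cycle_eval0 c : cycle_eval c 0 = 0 :> leavitt F G.
Proof. by rewrite /cycle_eval size_poly0 big_ord0. Qed.

Lemma cycle_evalN c q : cycle_eval c (- q) = - cycle_eval c q.
Proof. by rewrite -scaleN1r cycle_evalZ scaleN1r. Qed.

Lemma cycle_evalB c q r : cycle_eval c (q - r) = cycle_eval c q - cycle_eval c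
  r.
Proof. by rewrite cycle_evalD cycle_evalN. Qed.

Lemma cycle_eval_sum c (I : Type) (r : seq I) (E : I -> {poly F}) :
  cycle_eval c (\sum_(i <- r) E i) = \sum_(i <- r) cycle_eval c (E i).
Proof.
by elim/big_rec2: _ => [|i x z _ <-]; rewrite ?cycle_eval0 ?cycle_evalD.
Qed.

Lemma cycle_evalXn c n : cycle_eval c 'X^n = cycle_pow F c n.
Proof.
rewrite (@cycle_eval_widen _ _ n.+1) ?size_polyXn // big_ord_recr /= big1
  ?add0r.
  by rewrite coefXn eqxx scale1r.
by move=> i _; rewrite coefXn ltn_eqF ?scale0r.
Qed.

End Paths.

(** * The reduction theorem *)

Section Reduction.
Context (F : fieldType) (G : digraph) (K : ideal (leavitt F G)).
Local Notation V := (@lv F G).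
Local Notation a := (@la F G).
Local Notation g := (@lg F G).
Implicit Types (v w : vertex G) (e f : arrow G) (s t c : seq (arrow G)).

Definition loop_at w s : bool := [&& s != [::], walk w s & wend w s == w].

Definition has_vertex_or_cycle : Prop :=
  (exists v, K (V v)) \/ exists c (q : {poly F}),
    [/\ is_cycle c, no_exit c, q.[0] != 0 & K (cycle_eval c q)].

Lemma loop_at_cons w e s : loop_at w (e :: s) -> loop_at (tgt e) (rcons s e).
Proof.
rewrite /loop_at /= => /andP[/andP[/eqP se ws] /eqP ends].
rewrite -cats1 walk_cat wend_cat ws /= andbT.
have -> : wend (tgt e) s = w by rewrite -[RHS]ends.
by rewrite se /wend /= !eqxx andbT; case: (s).
Qed.

(** By (CK1), conjugation by [e] rotates the loops beginning with [e] and kills the others, while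
    the vertex term keeps its coefficient. *)
Lemma lpath_loops w e (l : seq (F * seq (arrow G))) (k : F) :
  src e = w -> all (fun x => loop_at w x.2) l ->
  g e ** (k *: V w + \sum_(x <- l) x.1 *: lpath F w x.2) ** a e =
  k *: V (tgt e) + \sum_(x <- [seq (x.1, rcons (behead x.2) e) |
     x <- l & ohead x.2 == Some e]) x.1 *: lpath F (tgt e) x.2.
Proof.
move=> se /allP al; rewrite nuDr nuDl nuZr nuZl -se lgv lgaid; congr (_ + _).
rewrite nu_sumr nu_suml big_map big_filter [RHS]big_mkcond.
apply: eq_big_seq => -[k' s] /al /=; rewrite nuZr nuZl.
case: s => [|f s] //= /and3P[_ /= /andP[sf ws] /eqP ends].
rewrite -[Some f == Some e]/(f == e).
case: (eqVneq f e) => [fe|fe];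
  last by rewrite lg_lpath_neq ?nu0l ?scaler0 // eq_sym.
rewrite fe in ws ends *; rewrite lg_lpath // lpath_la //.
by rewrite se -{1}ends.
Qed.

Lemma loops_rot w e (l : seq (F * seq (arrow G))) :
  src e = w -> all (fun x => loop_at w x.2) l ->
  all (fun x => loop_at (tgt e) x.2) [seq (x.1, rcons (behead x.2) e) |
     x <- l & ohead x.2 == Some e].
Proof.
move=> se /allP al; apply/allP => _ /mapP[[k s] + ->] /=.
rewrite mem_filter => /andP[/= + /al /=]; case: s => //= f s /eqP[->].
exact: loop_at_cons.
Qed.


Lemma loop_power e c s : is_cycle (e :: c) -> sole_exits predT (e :: c) ->
  loop_at (src e) s -> exists n, s = flatten (nseq n.+1 (e :: c)).
Proof.
move=> cc oc; have [n] := ubnP (size s); elim: n s => // n IH s.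
rewrite ltnS => sn /and3P[s0 ws /eqP ends].
have [t st] := cycle_prefix cc oc (all_predT s) s0 ws ends.
case: t st => [|h t] st; first by exists 0%N; rewrite st /= cats0.
have wc : wend (src e) (e :: c) = src e.
  by move: cc; rewrite is_cycleE => /and3P[_ /eqP].
have [m ht] : exists m, h :: t = flatten (nseq m.+1 (e :: c)).
  apply: IH; first by move: sn; rewrite st /= size_cat /=; lia.
  apply/and3P; split=> //.
    by move: ws; rewrite st walk_cat wc => /andP[].
  by move: ends; rewrite st wend_cat wc => ->.
by exists m.+1; rewrite st ht.
Qed.

(* Conjugating by an arrow leaving the first loop removes that loop from the
   sum; if no arrow leaves it, every loop is a power of one cycle. *)
Lemma reduce_loops n (l : seq (F * seq (arrow G))) (k : F) w :
  (size l <= n)%N -> k != 0 -> all (fun x => loop_at w x.2) l ->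
  K (k *: V w + \sum_(x <- l) x.1 *: lpath F w x.2) -> has_vertex_or_cycle.
Proof.
elim: n l k w => [|n IHn] [|[k1 s] l] k w // ln k0 al Kx.
- left; exists w; move: Kx; rewrite big_nil addr0 => /(nuidealZ k^-1).
  by rewrite scalerA mulVf // scale1r.
- left; exists w; move: Kx; rewrite big_nil addr0 => /(nuidealZ k^-1).
  by rewrite scalerA mulVf // scale1r.
have [[e [f [es ef fe]]]|noexit] := pselect (exists e f, [/\ e \in s,
  src f = src e & f != e]).
  (* Conjugating by the arrows of [s1] one after the other rotates the loop until [e] stands in
     front; conjugating by [f], which leaves the same vertex, then kills it. *)
  case/splitPr: es ln al Kx => s1 s2; move: k1 w k k0 s2 l.
  elim: s1 => [|h s1 IHs] k1 w k k0 s2 l ln al Kx.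
    have sw : src f = w by case/andP: al => /and3P[_ /andP[/eqP <-]].
    apply: (IHn _ _ _ _ k0 (loops_rot sw al)); last first.
      by rewrite -(lpath_loops _ sw al); apply: nuidealMr; apply: nuidealMl.
    rewrite size_map /= [Some e == _]eq_sym -[Some f == _]/(f == e) (negPf fe).
    by rewrite size_filter (leq_trans (count_size _ _)).
  have sw : src h = w by case/andP: al => /and3P[_ /andP[/eqP <-]].
  have al' := loops_rot sw al; have Kx' := nuidealMr (a h) (nuidealMl (g h) Kx).
  rewrite (lpath_loops _ sw al) /= eqxx /= in Kx'; rewrite /= eqxx /= in al'.
  rewrite rcons_cat /= in Kx' al'; apply: (IHs _ _ _ k0 _ _ _ al' Kx').
  by rewrite /= size_map size_filter (leq_trans _ ln) //= ltnS count_size.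
have os : sole_exits predT s.
  move=> e f es _ ef; apply/eqP; apply/negPn/negP => fe.
  by apply: noexit; exists e, f.
have [s0 ws /eqP ends] : and3 (s != [::]) (walk w s) (wend w s == w).
  by case/andP: al => /and3P.
have [e [c [ew cc oc]]] := sole_exits_cycle os s0 ws ends.
have wc : wend (src e) (e :: c) = src e.
  by move: cc; rewrite is_cycleE => /and3P[_ /eqP].
have [q q0 lq] : exists2 q : {poly F}, q.[0] = 0 &
    \sum_(x <- (k1, s) :: l) x.1 *: lpath F w x.2 = cycle_eval (e :: c) q.
  elim: ((k1, s) :: l) al {Kx} => [_|[k2 t] l' IHl /= /andP[wt /IHl[q q0 lq]]].
    by exists 0; rewrite ?big_nil ?cycle_eval0 ?horner0.
  move: wt; rewrite -ew => /(loop_power cc oc)[m ->].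
  exists (k2 *: 'X^(m.+1) + q).
    by rewrite hornerD hornerZ hornerXn exprS mul0r mulr0 add0r.
  rewrite big_cons /= -ew in lq *.
  by rewrite lq cycle_evalD cycle_evalZ cycle_evalXn cycle_powE.
right; exists (e :: c), (k%:P + q); split=> //.
- by move=> f /mapP[h hc fh]; rewrite (oc h f).
- by rewrite hornerD hornerC q0 addr0.
- rewrite cycle_evalD -lq -[k%:P]mulr1 mul_polyC cycle_evalZ.
  by rewrite -(expr0 'X) cycle_evalXn /= ew.
Qed.

(** Multiplying on the left by the ghost of the first arrow of [p0] strips that arrow from the walks
    beginning with it and kills the others. Since no walk is shorter than [p0], this continues until
    [p0] is a vertex [v]; cutting by [v] on both sides then leaves a multiple of [v] plus loops at
    [v]. *)
Lemma reduce_paths n (P : seq (vertex G * seq (arrow G))) (k : vertex G * seq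
  (arrow G) -> F) p0 :
  uniq P -> (forall p, p \in P -> walk p.1 p.2 /\ (n <= size p.2)%N) ->
  p0 \in P -> size p0.2 = n -> k p0 != 0 ->
  K (\sum_(p <- P) k p *: lpath F p.1 p.2) -> has_vertex_or_cycle.
Proof.
elim: n P k p0 => [|n IHn] P k [v s] uP wP p0P /= sn k0 Kx.
  have {sn} s0 : s = [::] by apply: size0nil.
  rewrite {s}s0 in p0P k0.
  pose b (p : vertex G * seq (arrow G)) := (p.1 == v) && (wend p.1 p.2 == v).
  have := nuidealMl (V v) (nuidealMr (V v) Kx).
  rewrite nu_suml nu_sumr (bigD1_seq (v, [::])) //= nuZl nuZr.
  rewrite {1}/lpath /= !lvvid.
  rewrite (_ : \sum_(p <- P | _) _ = \sum_(x <- [seq (k p,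
    p.2) | p <- P & (p != (v, [::])) && b p])
     x.1 *: lpath F v x.2).
    apply: (@reduce_loops _ _ (k (v, [::])) v (leqnn _) k0).
    apply/allP => _ /mapP[[u t] + ->];
      rewrite mem_filter => /andP[/andP[tv /andP[/= uv ut]] uP'].
    apply/and3P; split=> /=.
    - by apply: contraNneq tv => ->; rewrite (eqP uv).
    - by have [] := wP _ uP'; rewrite /= (eqP uv).
    - by rewrite -{1}(eqP uv).
  rewrite big_map big_filter [LHS]big_mkcond [RHS]big_mkcond.
  apply: eq_big_seq => -[u t] uP'; case: ifP => //= _.
  have [/= wt _] := wP _ uP'; rewrite nuZl nuZr /b /=.
  have [uv|uv] /= := eqVneq u v; last first.
    by rewrite mulgA lv_lpath_neq ?nu0l ?scaler0 // eq_sym.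
  have [tv|tv] := eqVneq (wend u t) v;
    last by rewrite lpath_lv_neq ?nu0r ?scaler0.
  by rewrite -{2}tv lpath_lv -uv lv_lpath.
case: s p0P sn k0 => // e s p0P [sn] k0.
have := nuidealMl (g e) Kx; rewrite nu_sumr.
pose tl (p : vertex G * seq (arrow G)) := (tgt e, behead p.2).
pose P' := [seq tl p | p <- P & ohead p.2 == Some e].
(* Distinct walks beginning with [e] stay distinct when it is stripped, so the coefficient is
   recovered by putting [e] back. *)
pose k' (p : vertex G * seq (arrow G)) := k (src e, e :: p.2).
rewrite (_ : \sum_(p <- P) _ = \sum_(p <- P') k' p *: lpath F p.1 p.2);
  last first.
  rewrite big_map big_filter [RHS]big_mkcond;
    apply: eq_big_seq => -[u t] /wP[/=].
  case: t => // f t /= /andP[/eqP fu wt] _;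
    rewrite nuZr -[Some f == Some e]/(f == e).
  have [fe|fe] := eqVneq f e; last by rewrite lg_lpath_neq ?scaler0 // eq_sym.
  by rewrite fe in wt fu *; rewrite lg_lpath // /k' /= fu.
have ev : src e = v by have [/= /andP[/eqP]] := wP _ p0P.
apply: (IHn P' k' (tgt e, s)) => //.
- rewrite map_inj_in_uniq ?filter_uniq // => -[u1 t1] [u2 t2].
  rewrite !mem_filter /= => /andP[h1 /wP[/= w1 _]] /andP[h2 /wP[/= w2 _]].
  case: t1 h1 w1 => // f1 t1 /eqP[->] /andP[/eqP<- _].
  by case: t2 h2 w2 => // f2 t2 /eqP[->] /andP[/eqP<- _] [->].
- move=> _ /mapP[[u t] + ->]; rewrite mem_filter => /andP[/= h /wP[/=]].
  by case: t h => // f t /eqP[->] /= /andP[_ ->].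
- by apply/mapP; exists (v, e :: s) => //; rewrite mem_filter /= eqxx.
- by rewrite /k' /= ev.
Qed.

End Reduction.

(** * Local units and the filtration by ghost arrows *)

Section Spans.
Context (F : fieldType) (G : digraph).
Local Notation L := (leavitt F G).
Local Notation V := (@lv F G).
Local Notation a := (@la F G).
Local Notation g := (@lg F G).
Implicit Types (v w : vertex G) (e f : arrow G) (s t c : seq (arrow G)) (x y :
  L).

Definition right_unit (W : seq (vertex G)) : L := \sum_(w <- W) V w.

Lemma mul_right_unit x v W : uniq W -> v \in W -> x ** V v = x ->
  x ** right_unit W = x.
Proof.
move=> uW vW xv; rewrite /right_unit nu_sumr (bigD1_seq v) //= xv big1 ?addr0
  //.
by move=> w wv; rewrite -xv -mulgA lvv eq_sym (negPf wv) nu0r.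
Qed.

(** Finite sums of vertices replace the missing unit. Allowing every larger set [W'] makes it
    possible to serve both terms of a sum at once. *)
Lemma right_unit_exists x : exists W : seq (vertex G),
  forall W' : seq (vertex G), uniq W' -> {subset W <= W'} ->
  x ** right_unit W' = x.
Proof.
elim/leavitt_ind: x => [v|e|e||x y [W1 h1] [W2 h2]|k x [W h]|x y _ [W h]].
- exists [:: v] => W' u /(_ v) h; apply: (@mul_right_unit _ v);
    rewrite ?lvvid ?h ?mem_head //.
- exists [:: tgt e] => W' u /(_ (tgt e)) h; apply: (@mul_right_unit _ (tgt e));
    rewrite ?lav ?h ?mem_head //.
- exists [:: src e] => W' u /(_ (src e)) h; apply: (@mul_right_unit _ (src e));
    rewrite ?lgv ?h ?mem_head //.
- by exists [::] => W' _ _; rewrite nu0l.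
- exists (W1 ++ W2) => W' u hW; rewrite nuDl h1 ?h2 // => v vW;
  by apply: hW; rewrite mem_cat vW ?orbT.
- by exists W => W' u hW; rewrite nuZl h.
- by exists W => W' u hW; rewrite -mulgA h.
Qed.

(** The image of the path algebra: elements that can be written without ghost arrows. *)
Definition real_span x : Prop := exists l : seq (F * (vertex G * seq (arrow
  G))),
  all (fun p => walk p.2.1 p.2.2) l /\
    x = \sum_(p <- l) p.1 *: lpath F p.2.1 p.2.2.

Lemma real_span0 : real_span 0.
Proof. by exists [::]; rewrite big_nil. Qed.

Lemma real_spanD x y : real_span x -> real_span y -> real_span (x + y).
Proof.
by move=> [l [wl ->]] [m [wm ->]]; exists (l ++ m);
  rewrite all_cat wl wm big_cat.
Qed.

Lemma real_span_sum (I : Type) (r : seq I) (E : I -> L) :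
  (forall i, real_span (E i)) -> real_span (\sum_(i <- r) E i).
Proof.
by move=> h; elim/big_rec: _ => [|i x _]; [exact: real_span0|exact: real_spanD].
Qed.

Lemma real_spanZ k x : real_span x -> real_span (k *: x).
Proof.
move=> [l [wl ->]]; exists [seq (k * p.1, p.2) | p <- l]; split;
  first by rewrite all_map.
by rewrite big_map scaler_sumr; apply: eq_bigr => y _; rewrite scalerA.
Qed.

Lemma real_span_path v s : walk v s -> real_span (lpath F v s).
Proof.
by move=> ws; exists [:: (1, (v, s))]; rewrite /= ws big_seq1 scale1r.
Qed.

Lemma real_span_map (h : L -> L) :
  (forall x y, h (x + y) = h x + h y) -> (forall k x, h (k *: x) = k *: h x) ->
  (forall v s, walk v s -> real_span (h (lpath F v s))) ->
  forall x, real_span x -> real_span (h x).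
Proof.
move=> hD hZ hp x [l [wl ->]];
  have h0 : h 0 = 0 by rewrite -[0 in LHS](scale0r 0) hZ scale0r.
elim: l wl => [_|[k [v s]] l IH] /=; first by rewrite big_nil h0;
  exact: real_span0.
case/andP => ws /IH rl; rewrite big_cons hD hZ; apply: real_spanD => //.
exact/real_spanZ/hp.
Qed.

Lemma real_span_lvl v x : real_span x -> real_span (V v ** x).
Proof.
move: x; apply: real_span_map => [x y|k x|w s ws]; rewrite ?nuDr ?nuZr //.
have [<-|vw] := eqVneq w v; first by rewrite lv_lpath //; exact: real_span_path.
by rewrite lv_lpath_neq ?(eq_sym v) //; exact: real_span0.
Qed.

Lemma real_span_lvr v x : real_span x -> real_span (x ** V v).
Proof.
move: x; apply: real_span_map => [x y|k x|w s ws]; rewrite ?nuDl ?nuZl //.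
have [<-|vw] := eqVneq (wend w s) v; first by rewrite lpath_lv //;
  exact: real_span_path.
by rewrite lpath_lv_neq //; exact: real_span0.
Qed.

Lemma real_span_lal e x : real_span x -> real_span (a e ** x).
Proof.
move: x; apply: real_span_map => [x y|k x|w s ws]; rewrite ?nuDr ?nuZr //.
have [ew|ew] := eqVneq (tgt e) w; last first.
  by rewrite -lav -mulgA lv_lpath_neq // nu0r; exact: real_span0.
by rewrite -ew -(lpath_cons _ (src e)); apply: real_span_path;
  rewrite /= eqxx ew.
Qed.

Lemma real_span_lar e x : real_span x -> real_span (x ** a e).
Proof.
move: x; apply: real_span_map => [x y|k x|w s ws]; rewrite ?nuDl ?nuZl //.
have [ew|ew] := eqVneq (src e) (wend w s); last first.
  by rewrite lpath_la_neq //; exact: real_span0.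
rewrite lpath_la //; apply: real_span_path.
by rewrite -cats1 walk_cat ws /= ew eqxx.
Qed.

Lemma real_span_uniq x : real_span x ->
  exists (P : seq (vertex G * seq (arrow G))) k,
  [/\ uniq P, forall p, p \in P -> walk p.1 p.2 &
      x = \sum_(p <- P) k p *: lpath F p.1 p.2].
Proof.
move=> [l [/allP wl ->]]; pose P := undup (map snd l).
exists P, (fun p => \sum_(y <- l | y.2 == p) y.1); split.
- exact: undup_uniq.
- by move=> p; rewrite mem_undup => /mapP[y /wl ? ->].
- under [RHS]eq_bigr do rewrite scaler_suml big_mkcond.
  rewrite exchange_big; apply: eq_big_seq => y yl /=.
  rewrite (bigD1_seq y.2) ?undup_uniq //=; last by rewrite mem_undup;
    exact: map_f.
  rewrite eqxx big1 ?addr0 // => p /negPf py.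
  by rewrite eq_sym py.
Qed.


(** A filtration of the algebra: sums of terms consisting of a path followed by at most [m] ghost
    arrows. *)
Fixpoint ghost_span m x : Prop :=
  if m is m'.+1 then exists (l : seq (L * arrow G)) b,
    [/\ forall p, p \in l -> ghost_span m' p.1, real_span b &
        x = \sum_(p <- l) p.1 ** g p.2 + b]
  else real_span x.

Lemma ghost_span_real m x : real_span x -> ghost_span m x.
Proof. by case: m => //= m rx; exists [::], x; rewrite big_nil add0r. Qed.

Lemma ghost_spanS m x : ghost_span m x -> ghost_span m.+1 x.
Proof.
elim: m x => [|m IH] x; first exact: (@ghost_span_real 1).
by move=> [l [b [hl rb xE]]]; exists l, b; split=> // p /hl /IH.
Qed.

Lemma ghost_spanW m n x : (m <= n)%N -> ghost_span m x -> ghost_span n x.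
Proof.
by move=> /subnKC <-; elim: (n - m)%N => [|k IH];
  rewrite ?addn0 ?addnS // => /IH /ghost_spanS.
Qed.

Lemma ghost_spanD m x y : ghost_span m x -> ghost_span m y ->
  ghost_span m (x + y).
Proof.
case: m => [|m] /=; first exact: real_spanD.
move=> [l [b [hl rb ->]]] [l' [b' [hl' rb' ->]]]; exists (l ++ l'), (b + b').
split; last by rewrite big_cat addrACA.
- by move=> p; rewrite mem_cat => /orP[/hl|/hl'].
- exact: real_spanD.
Qed.

Lemma ghost_span_map m (h : L -> L) :
  (forall x y, h (x + y) = h x + h y) -> (forall x y, h (x ** y) = h x ** y) ->
  (forall x, real_span x -> real_span (h x)) ->
  forall x, ghost_span m x -> ghost_span m (h x).
Proof.
move=> hD hM hr; elim: m => //= m IH x [l [b [hl rb ->]]].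
have h0 : h 0 = 0 by rewrite -[0 in LHS](nu0r 0) hM nu0r.
exists [seq (h p.1, p.2) | p <- l], (h b); split.
- by move=> _ /mapP[p /hl /IH gp ->].
- exact: hr.
- rewrite hD big_map; congr (_ + _).
  by elim/big_rec2: _ => // p y z _ <-; rewrite hD hM.
Qed.

Lemma ghost_spanZ m k x : ghost_span m x -> ghost_span m (k *: x).
Proof.
move: x; apply: ghost_span_map => [x y|x y|x]; rewrite ?scalerDr ?nuZl //.
exact: real_spanZ.
Qed.

(** By (CK1) the ghost arrow is absorbed by the first arrow of a path; only on a path of length 0
    does it survive, as a new ghost arrow. *)
Lemma ghost_span_lgl m e x : ghost_span m x -> ghost_span m.+1 (g e ** x).
Proof.
elim: m x => [|m IH] x.
  move=> [l [wl ->]]; rewrite nu_sumr.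
  elim: l wl => [_|[k [v s]] l IHl] /=; first by rewrite big_nil;
    exact: (@ghost_span_real 1 0 real_span0).
  case/andP => ws /IHl gl; rewrite big_cons; apply: (@ghost_spanD 1) gl.
  rewrite nuZr; apply: (@ghost_spanZ 1).
  case: s ws => [_|f s /= /andP[fv ws]].
    have [ev|ev] := eqVneq (src e) v; last first.
      by rewrite lgv_neq //; exact: (@ghost_span_real 1 0 real_span0).
    exists [:: (V (tgt e), e)], 0; split=> [p| |].
    - by rewrite inE => /eqP->; exact: (@real_span_path _ [::]).
    - exact: real_span0.
    - by rewrite big_seq1 addr0 /= lvg -ev lgv.
  apply: (@ghost_span_real 1); have [->|ef] := eqVneq e f.
    by rewrite lg_lpath //; exact: real_span_path.
  by rewrite lg_lpath_neq //; exact: real_span0.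
move=> [l [b [hl rb ->]]]; rewrite nuDr nu_sumr; apply: ghost_spanD; last first.
  exact/(ghost_spanW (n := m.+2) _)/IH/ghost_span_real.
exists [seq (g e ** p.1, p.2) | p <- l], 0;
  split=> [_ /mapP[p /hl /IH gp ->] //| |].
- exact: real_span0.
- by rewrite addr0 big_map; apply: eq_bigr => p _; rewrite mulgA.
Qed.

(** By (CK1) the last ghost arrow of each term meets [e] and becomes a vertex or 0. This drop in the
    filtration drives the induction of the reduction theorem. *)
Lemma ghost_span_lar m e x : ghost_span m.+1 x -> ghost_span m (x ** a e).
Proof.
have rvr n v y : ghost_span n y -> ghost_span n (y ** V v).
  case: n => [|n]; first exact: real_span_lvr.
  move=> [l [b [hl rb ->]]].
  exists [seq p <- l | src p.2 == v], (b ** V v); split.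
  - by move=> p; rewrite mem_filter => /andP[_ /hl].
  - exact: real_span_lvr.
  - rewrite nuDl nu_suml big_filter [in RHS]big_mkcond; congr (_ + _).
    apply: eq_bigr => p _; rewrite -mulgA; case: eqVneq => [<-|ev];
      first by rewrite lgv.
    by rewrite lgv_neq // nu0r.
move=> [l [b [hl rb ->]]]; rewrite nuDl; apply: ghost_spanD; last first.
  exact/ghost_span_real/real_span_lar.
elim: l hl => [|p l IH] hl; first by rewrite big_nil nu0l;
  exact/ghost_span_real/real_span0.
rewrite big_cons nuDl; apply: ghost_spanD; last first.
  by apply: IH => q ql; apply: hl; rewrite inE ql orbT.
rewrite -mulgA lga; case: ifP => _; last by rewrite nu0r;
  exact/ghost_span_real/real_span0.
by apply: rvr; apply: hl; rewrite mem_head.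
Qed.

Lemma ghost_span_exists x : exists m, ghost_span m x.
Proof.
(* Left multiplication by a generator respects the filtration, up to one level for a ghost arrow;
   taking a local unit for [y] gives the claim for [x]. *)
suff H : forall y m, ghost_span m y -> exists n, ghost_span n (x ** y).
  have [W xW] := right_unit_exists x.
  rewrite -(xW (undup W)) ?undup_uniq //; last by move=> v; rewrite mem_undup.
  apply: (H _ 0%N); apply: real_span_sum => v; exact: (@real_span_path _ [::]).
elim/leavitt_ind: x => [v|e|e||x y hx hy|k x hx|x y hx hy] z m gz.
- exists m; move: z gz; apply: ghost_span_map => [x y|x y|x];
    rewrite ?nuDr ?mulgA //.
  exact: real_span_lvl.
- exists m; move: z gz; apply: ghost_span_map => [x y|x y|x];
    rewrite ?nuDr ?mulgA //.
  exact: real_span_lal.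
- by exists m.+1; exact: ghost_span_lgl.
- by exists 0%N; rewrite nu0l; exact: real_span0.
- have [n1 h1] := hx _ _ gz; have [n2 h2] := hy _ _ gz; exists (maxn n1 n2).
  by rewrite nuDl; apply: ghost_spanD;
    [apply: ghost_spanW h1|apply: ghost_spanW h2];
    rewrite ?leq_maxl ?leq_maxr.
- by have [n h] := hx _ _ gz; exists n; rewrite nuZl; exact: ghost_spanZ.
- by have [n h] := hy _ _ gz; rewrite -mulgA; exact: hx h.
Qed.

End Spans.

(** * Proof of the reduction theorem *)

Section ReductionTheorem.
Context (F : fieldType) (G : digraph) (K : ideal (leavitt F G)).
Hypothesis Kred : ~ has_vertex_or_cycle K.
Local Notation L := (leavitt F G).
Local Notation V := (@lv F G).
Local Notation a := (@la F G).
Local Notation g := (@lg F G).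
Implicit Types (v w : vertex G) (e f : arrow G) (s t c : seq (arrow G)) (x y :
  L).

(** Otherwise [reduce_paths], applied to a shortest walk with nonzero coefficient, would produce
    what [Kred] forbids. *)
Lemma paths_free (P : seq (vertex G * seq (arrow G))) (k : vertex G * seq
  (arrow G) -> F) :
  uniq P -> (forall p, p \in P -> walk p.1 p.2) ->
  K (\sum_(p <- P) k p *: lpath F p.1 p.2) -> forall p, p \in P -> k p = 0.
Proof.
move=> uP wP Kx p pP; apply/eqP/negPn/negP => kp; apply: Kred.
pose Q := [seq p <- P | k p != 0].
have exn : exists n, has (fun q => size q.2 == n) Q.
  by exists (size p.2); apply/hasP; exists p; rewrite // mem_filter kp.
case: (ex_minnP exn) => n /hasP[q qQ /eqP qn] nmin.
apply: (@reduce_paths _ _ K n Q k q) => //.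
- exact: filter_uniq.
- move=> r rQ; split; first by move: rQ; rewrite mem_filter => /andP[_ /wP].
  by apply: nmin; apply/hasP; exists r.
- by move: qQ; rewrite mem_filter => /andP[].
- rewrite big_filter big_mkcond (eq_bigr (fun p => k p *: lpath F p.1 p.2)) //.
  by move=> r _; case: ifPn => // /negPn/eqP->; rewrite scale0r.
Qed.

Lemma real_span_free x : real_span x -> K x -> x = 0.
Proof.
move=> /real_span_uniq[P [k [uP wP ->]]] Kx.
rewrite big_seq big1 // => p pP.
by rewrite (paths_free uP wP Kx pP) scale0r.
Qed.

(* Appending [f] keeps distinct paths ending at [src f] distinct. *)
Lemma real_span_la_free x f : real_span x -> K (x ** a f) -> x ** V (src f) = 0.
Proof.
move=> /real_span_uniq[P [k [uP wP ->]]] Kx.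
pose Q := [seq p <- P | wend p.1 p.2 == src f].
pose ext (p : vertex G * seq (arrow G)) := (p.1, rcons p.2 f).
pose k' (p : vertex G * seq (arrow G)) := k (p.1, take (size p.2).-1 p.2).
have k'E p : k' (ext p) = k p.
  by rewrite /k' /ext /= size_rcons /= -cats1 take_size_cat //; case: p.
have eQ : uniq (map ext Q).
  rewrite map_inj_uniq ?filter_uniq // => -[u s] [v t] [-> /eqP].
  by rewrite eqseq_rcons => /andP[/eqP-> _].
have wQ p : p \in map ext Q -> walk p.1 p.2.
  move=> /mapP[q]; rewrite mem_filter => /andP[/eqP qf /wP wq ->] /=.
  by rewrite -cats1 walk_cat wq /= qf eqxx.
have KQ : K (\sum_(p <- map ext Q) k' p *: lpath F p.1 p.2).
  move: Kx; rewrite big_map big_filter [X in _ -> K X]big_mkcond nu_suml.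
  rewrite [X in _ -> K X](eq_bigr (fun p => (k p *: lpath F p.1 p.2) ** a f))
    // => p _; rewrite nuZl k'E.
  by case: ifPn => pf; [rewrite lpath_la // (eqP pf)|rewrite lpath_la_neq
    ?scaler0 // eq_sym].
rewrite nu_suml big_seq big1 // => p pP; rewrite nuZl.
have [pf|pf] := eqVneq (wend p.1 p.2) (src f);
  last by rewrite lpath_lv_neq // scaler0.
rewrite -k'E (paths_free eQ wQ KQ) ?scale0r //.
by apply: map_f; rewrite mem_filter pf eqxx.
Qed.

(** For [y = x ** V w] every [y ** a e] has fewer ghost arrows, so it vanishes by induction. It
    remains to write [y] as a right multiple of a sum of terms [e e^*]. If the ghost arrows of [x]
    exhaust the arrows out of [w], (CK2) does so. If some arrow [f] out of [w] is missing, [y f = 0]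
    forces the ghost-free part to vanish at [w], and the remaining terms are fixed by the sum over
    [T]. If [w] is a sink, [y] has no ghost arrows at all. *)
Theorem reduction x : K x -> x = 0.
Proof.
have [m] := ghost_span_exists x; elim: m x => [|m IH] x;
  first exact: real_span_free.
move=> gx Kx; have [W xW] := right_unit_exists x.
rewrite -(xW (undup W)) ?undup_uniq //; last by move=> v; rewrite mem_undup.
rewrite /right_unit nu_sumr big1 // => w _; set y := x ** V w.
have Ky : K y by apply: nuidealMr.
have ya e : y ** a e = 0.
  rewrite /y -mulgA; have [we|we] := eqVneq w (src e);
    last by rewrite lva_neq // nu0r.
  by rewrite we lva; apply: IH; [exact: ghost_span_lar|exact: nuidealMr].
have [l [b [hl rb xE]]] := gx.
have yE : y = \sum_(p <- l) p.1 ** (g p.2 ** V w) + b ** V w.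
  by rewrite /y xE nuDl nu_suml; congr (_ + _); apply: eq_bigr => p _;
    rewrite mulgA.
pose T := undup [seq p.2 | p <- l & src p.2 == w].
have TP e : e \in T -> src e = w.
  by rewrite mem_undup => /mapP[p]; rewrite mem_filter => /andP[/eqP ? _] ->.
have gT p : p \in l ->
    (g p.2 ** V w) ** (\sum_(e <- T) a e ** g e) = g p.2 ** V w.
  move=> pl; have [pw|pw] := eqVneq (src p.2) w;
    last by rewrite lgv_neq // nu0l.
  rewrite -pw lgv nu_sumr (bigD1_seq p.2) ?undup_uniq //=; last first.
    by rewrite mem_undup; apply: map_f; rewrite mem_filter pw eqxx.
  rewrite mulgA lgaid lvg big1 ?addr0 // => e ep.
  by rewrite mulgA lga_neq ?nu0l // eq_sym.
have [[f [fw fT]]|nof] := pselect (exists f, src f = w /\ f \notin T).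
  have bf : b ** a f = 0.
    have := ya f; rewrite yE nuDl -mulgA -fw lva => bf; rewrite -[RHS]bf.
    rewrite nu_suml big_seq big1 ?add0r // => p pl.
    rewrite -!mulgA lva lga_neq ?nu0r //; apply: contraNneq fT => pf.
    by rewrite mem_undup; apply/mapP; exists p => //;
      rewrite mem_filter pf fw eqxx.
  have bw : b ** V w = 0.
    by rewrite -fw; apply: real_span_la_free => //; rewrite bf; exact: nuideal0.
  have -> : y = y ** (\sum_(e <- T) a e ** g e).
    rewrite {1 2}yE bw addr0 nu_suml; apply: eq_big_seq => p pl.
    by rewrite -mulgA gT.
  by rewrite nu_sumr big1 // => e _; rewrite mulgA ya nu0l.
have TE e : e \in T <-> src e = w.
  split; first exact: TP.
  by move=> ew; apply/negPn/negP => eT; apply: nof; exists e.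
have [T0|T0] := eqVneq T [::].
  apply: real_span_free => //; rewrite yE big_seq big1 ?add0r;
    first exact: real_span_lvr.
  move=> p pl; rewrite -gT // T0 big_nil !nu0r //.
have -> : y = y ** V w by rewrite /y -mulgA lvvid.
rewrite (lCK2 F _ T0 TE) ?undup_uniq // nu_sumr big1 // => e _.
by rewrite mulgA ya nu0l.
Qed.

End ReductionTheorem.

(** * The gauge action and nonvanishing of polynomials in a cycle *)

Section Scaling.
Context (F : closedFieldType) (G : digraph).

Lemma gauge_exists (k : F) : k != 0 ->
  exists f : {linear leavitt F G -> leavitt F G},
  [/\ {morph f : x y / x ** y}, forall v, f (lv F v) = lv F v &
      forall e, f (la F e) = k *: la F e].
Proof.
move=> k0; pose h (x : leavitt_gen G) : leavitt F G := match x with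
  | GVertex v => lv F v | GArrow e => k *: la F e | GGhost e => k^-1 *: lg F e
    end.
have [] := @leavitt_hom_exists F G _ h; rewrite /h.
- exact: lvv.
- by move=> e; rewrite nuZr lva.
- by move=> e; rewrite nuZl lav.
- by move=> e; rewrite nuZr lvg.
- by move=> e; rewrite nuZl lgv.
- by move=> e f; rewrite nuZl nuZr scalerA mulVf // scale1r lga.
- move=> v r ur r0 rv; rewrite (lCK2 F ur r0 rv); apply: eq_bigr => e _.
  by rewrite nuZl nuZr scalerA mulfV // scale1r.
by move=> f [fM fv fa _]; exists f.
Qed.

Lemma gauge_cycle_pow (k : F) (f : {linear leavitt F G -> leavitt F G}) c n :
  {morph f : x y / x ** y} -> (forall v, f (lv F v) = lv F v) ->
  (forall e, f (la F e) = k *: la F e) ->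
  f (cycle_pow F c n) = k ^+ (size c * n) *: cycle_pow F c n.
Proof.
move=> fM fv fa; case: c => [|e c]; first by rewrite linear0 scaler0.
rewrite /cycle_pow; elim: n => [|n IH] /=; first by rewrite muln0 scale1r fv.
have fE (s : seq (arrow G)) (x : leavitt F G) : f (foldr (fun f y => la F f **
  y) x s) =
    k ^+ size s *: foldr (fun f y => la F f ** y) (f x) s.
  elim: s => [|h s IHs] /=; first by rewrite scale1r.
  by rewrite fM fa IHs nuZl nuZr scalerA exprS.
have fZ (s : seq (arrow G)) (x : leavitt F G) j :
    foldr (fun f y => la F f ** y) (j *: x) s =
    j *: foldr (fun f y => la F f ** y) x s.
  by elim: s => //= h s ->; rewrite nuZr.
rewrite -[la F e ** _]/(foldr (fun f y => la F f ** y) _ (e :: c)) fE IH fZ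
  scalerA.
by rewrite mulnS exprD.
Qed.

(* If [q(C) = 0] then [q(k^n C) = 0] for all [k != 0], and subtracting a
   multiple of [q] lowers the degree while keeping a nonzero constant term. *)
Lemma cycle_eval_neq0 c (q : {poly F}) : is_cycle c -> q.[0] != 0 ->
  cycle_eval c q = 0 -> cycle_pow F c 0 = 0 :> leavitt F G.
Proof.
move=> cc; have [n] := ubnP (size q); elim: n q => // n IH q;
  rewrite ltnS => qn q0 cq.
have [sq|sq] := leqP (size q) 1.
  move: cq q0; rewrite (size1_polyC sq) hornerC -[_%:P]mulr1 mul_polyC.
  rewrite cycle_evalZ -(expr0 'X) cycle_evalXn => cq q0.
  by apply: (scalerI q0); rewrite cq scaler0.
pose m := (size c * (size q).-1)%N.
have m0 : (0 < m)%N.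
  by rewrite muln_gt0 -subn1 subn_gt0 sq andbT; case: (c) cc.
(* With [m] the length of [c] times the degree of [q], the scalar [k ^+ m] is the factor gained by
   the leading term. Subtracting [k ^+ m *: q] cancels that term, and the constant term is only
   multiplied by [1 - k ^+ m], which is nonzero by the choice of [k]. *)
have [k] : exists k : F, ~~ root ('X * ('X^m - 1)) k.
  by apply/closed_nonrootP;
    rewrite mulf_neq0 ?polyX_eq0 // -size_poly_gt0 size_XnsubC.
rewrite rootM negb_or !rootE !hornerE => /andP[k0 km].
have [f [fM fv fa]] := gauge_exists k0.
pose r := \poly_(i < size q) (k ^+ (size c * i) * q`_i).
have fr : cycle_eval c r = f (cycle_eval c q).
  rewrite (@cycle_eval_widen _ _ _ _ (size q)) ?size_poly // linear_sum.
  apply: eq_bigr => i _; rewrite linearZ /= (gauge_cycle_pow _ _ fM fv fa).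
  by rewrite scalerA coef_poly ltn_ord mulrC.
pose r' := r - k ^+ m *: q.
apply: (IH r').
- have : (size r' <= (size q).-1)%N.
    apply/leq_sizeP => j jq; rewrite coefB coefZ coef_poly.
    case: ltnP => [jq'|jq']; last by rewrite nth_default // mulr0 subrr.
    have -> : j = (size q).-1 by lia.
    by rewrite subrr.
  by move=> h; lia.
- rewrite horner_coef0 coefB coefZ coef_poly; case: ltnP => [_|]; last by lia.
  rewrite muln0 expr0 -mulrBl mulf_neq0 -?horner_coef0 //.
  by rewrite -opprB oppr_eq0.
- by rewrite cycle_evalB cycle_evalZ fr cq linear0 scaler0 subrr.
Qed.

End Scaling.

(** * Canonical polynomials *)

Section CycleAlgebra.
Context (F : fieldType) (G : digraph).
Local Notation L := (leavitt F G).
Local Notation V := (@lv F G).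
Local Notation a := (@la F G).
Local Notation g := (@lg F G).
Implicit Types (v w : vertex G) (e f : arrow G) (s t c : seq (arrow G)) (p q :
  {poly F}).

Lemma is_cycle_loop e s : is_cycle (e :: s) -> loop_at (src e) (e :: s).
Proof.
by rewrite is_cycleE /loop_at /= eqxx => /and3P[-> /eqP <- _] /=; rewrite eqxx.
Qed.

Lemma cycle_pow_lpath v c n : loop_at v c ->
  cycle_pow F c n = lpath F v (flatten (nseq n c)).
Proof.
case: c => // e s vc; have ev : src e = v by case/and3P: vc => _ /= /andP[/eqP].
by case/and3P: vc => _ _ /eqP ends; rewrite -ev cycle_powE // ev.
Qed.

Lemma loop_flatten v c n : loop_at v c ->
  walk v (flatten (nseq n c)) /\ wend v (flatten (nseq n c)) = v.
Proof.
move=> /and3P[_ wc /eqP ends]; elim: n => //= n [wn en].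
by rewrite walk_cat wend_cat wc ends.
Qed.

Lemma lv_cycle_pow v c n : loop_at v c ->
  V v ** cycle_pow F c n = cycle_pow F c n.
Proof.
move=> vc; rewrite (cycle_pow_lpath _ vc) lv_lpath //.
by case: (loop_flatten n vc).
Qed.

Lemma lv_cycle_eval v c q : loop_at v c ->
  V v ** cycle_eval c q = cycle_eval c q.
Proof.
move=> vc; rewrite nu_sumr; apply: eq_bigr => i _.
by rewrite nuZr lv_cycle_pow.
Qed.

Lemma cycle_pow0 v c : loop_at v c -> cycle_pow F c 0 = V v.
Proof. by move=> vc; rewrite (cycle_pow_lpath _ vc). Qed.

Lemma cycle_eval1 v c : loop_at v c -> cycle_eval c 1 = V v.
Proof. by move=> vc; rewrite -(expr0 'X) cycle_evalXn (cycle_pow0 vc). Qed.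

Lemma cycle_powD v c m n : loop_at v c ->
  cycle_pow F c m ** cycle_pow F c n = cycle_pow F c (m + n).
Proof.
move=> vc; rewrite !(cycle_pow_lpath _ vc) nseqD flatten_cat.
have [wm em] := loop_flatten m vc; have [wn en] := loop_flatten n vc.
by rewrite -{2}em lpath_cat ?em.
Qed.

Lemma cycle_evalM v c p q : loop_at v c ->
  cycle_eval c (p * q) = cycle_eval c p ** cycle_eval c q.
Proof.
move=> vc; rewrite -{1}(coefK p) -{1}(coefK q) !poly_def mulr_suml
  cycle_eval_sum.
rewrite nu_suml; apply: eq_bigr => i _;
  rewrite mulr_sumr cycle_eval_sum nu_sumr.
apply: eq_bigr => j _;
  rewrite -scalerAl -scalerAr -exprD !cycle_evalZ cycle_evalXn.
by rewrite nuZl nuZr (cycle_powD _ _ vc).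
Qed.

(** Since [(e s)^i e = e (s e)^i], moving an arrow of the cycle across a polynomial in the cycle
    rotates the cycle. *)
Lemma cycle_eval_la v e s q : loop_at v (e :: s) ->
  cycle_eval (e :: s) q ** a e = a e ** cycle_eval (rcons s e) q.
Proof.
move=> vc; have vc' := loop_at_cons vc.
rewrite nu_suml nu_sumr; apply: eq_bigr => i _; rewrite nuZl nuZr;
  congr (_ *: _).
rewrite (cycle_pow_lpath _ vc) (cycle_pow_lpath _ vc').
have [wm em] := loop_flatten i vc;
  have ev : src e = v by case/and3P: vc => _ /= /andP[/eqP].
rewrite lpath_la ?em // -(lpath_cons _ v); congr lpath.
by elim: (i : nat) => //= n IH; rewrite rcons_cat IH -cat_rcons.
Qed.

(** The positive powers of [c] begin with an arrow different from [e] and are killed by (CK1); the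
    constant term alone survives. *)
Lemma lg_cycle_eval_la v c e q : loop_at v c -> src e = v -> e \notin c ->
  g e ** cycle_eval c q ** a e = q`_0 *: V (tgt e).
Proof.
move=> vc ev ec; rewrite (@cycle_eval_widen _ _ _ _ (size q).+1) // nu_sumr
  nu_suml.
rewrite big_ord_recl big1 ?addr0 => [|i _].
  by rewrite (cycle_pow0 vc) nuZr nuZl -ev lgv lgaid.
rewrite (cycle_pow_lpath _ vc) /=; case: c vc ec => // f c _.
by rewrite inE negb_or => /andP[ef _] /=;
  rewrite nuZr nuZl lg_lpath_neq // nu0l scaler0.
Qed.

(** The adjoint [s^*] of the path [s]. *)
Fixpoint ghost_path v s : L :=
  if s is e :: s' then ghost_path (tgt e) s' ** g e else V v.

Lemma ghost_pathK v s : walk v s ->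
  ghost_path v s ** lpath F v s = V (wend v s).
Proof.
elim: s v => [|e s IH] v /=; first by rewrite lvvid.
by case/andP => _ ws; rewrite -mulgA lg_lpath // IH.
Qed.

End CycleAlgebra.

Section CanonicalPolynomials.
Context (F : fieldType) (G : digraph) (J : ideal (leavitt F G)).
Local Notation L := (leavitt F G).
Local Notation V := (@lv F G).
Local Notation a := (@la F G).
Local Notation g := (@lg F G).
Implicit Types (v w : vertex G) (e : arrow G) (s t c : seq (arrow G)) (p q :
  {poly F}).

Lemma cycle_eval_rot1 c q : is_cycle c -> J (cycle_eval c q) ->
  J (cycle_eval (rot 1 c) q).
Proof.
move=> cc; have [e [s cE]] := is_cycle_cons cc; rewrite cE in cc *.
have lc := is_cycle_loop cc; rewrite rot1_cons => Jq.
rewrite -(lv_cycle_eval _ (loop_at_cons lc)) -lgaid -mulgA.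
by rewrite -(cycle_eval_la _ lc); apply/nuidealMl/nuidealMr.
Qed.

Lemma cycle_eval_rot k c q : is_cycle c ->
  J (cycle_eval (rot k c) q) <-> J (cycle_eval c q).
Proof.
have H j d : is_cycle d -> J (cycle_eval d q) -> J (cycle_eval (rot j d) q).
  move=> cd Jq; elim: j => [|j IH]; first by rewrite rot0.
  have [jd|jd] := ltnP j (size d);
    last by rewrite rot_oversize // (leq_trans jd).
  by rewrite rotS //; apply: cycle_eval_rot1 => //; rewrite is_cycle_rot.
move=> cc; split; last exact: H.
by rewrite -{2}(rotK k c); apply: H; rewrite is_cycle_rot.
Qed.

Lemma cycle_eval_dvd c p q : is_cycle c -> p %| q -> J (cycle_eval c p) ->
  J (cycle_eval c q).
Proof.
move=> cc /dvdpP[r ->] Jp; have [e [s cE]] := is_cycle_cons cc;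
  rewrite cE in cc Jp *.
by rewrite (cycle_evalM _ _ (is_cycle_loop cc)); exact: nuidealMl.
Qed.

(** The adjoint [C^*] is a left inverse of [C]. This is why a generator can be normalised by
    [f_C(0) = 1]. *)
Lemma cycle_evalX_cancel c q : is_cycle c -> J (cycle_eval c ('X * q)) ->
  J (cycle_eval c q).
Proof.
move=> cc; have [e [s cE]] := is_cycle_cons cc; rewrite cE in cc *.
have lc := is_cycle_loop cc;
  have [y ys] : exists y, y ** cycle_eval (e :: s) 'X = V (src e).
  have /and3P[_ wc /eqP ends] := lc.
  exists (ghost_path F (src e) (e :: s)); rewrite -[in RHS]ends -ghost_pathK //.
  by rewrite -['X]expr1 cycle_evalXn (cycle_pow_lpath _ _ lc) /= cats0.
rewrite (cycle_evalM _ _ lc) => /(nuidealMl y).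
by rewrite mulgA ys (lv_cycle_eval _ lc).
Qed.

(** A nonzero polynomial of least degree divides all others by Euclidean division, and a factor ['X]
    could be cancelled, contradicting minimality. *)
Lemma canon_poly_exists c : is_cycle c -> meets_properly J c ->
  exists f, is_canon_poly J c f.
Proof.
move=> cc [[f0 [Jf0 /eqP f00]] _].
have {}f00 : f0 != 0 by apply: contraNneq f00 => ->; rewrite cycle_eval0.
pose Q n := `[< exists f : {poly F}, [/\ f != 0,
  J (cycle_eval c f) & size f = n] >].
have exQ : exists n, Q n by exists (size f0); apply/asboolP; exists f0.
case: (ex_minnP exQ) => n /asboolP[f [f_neq0 Jf sf]] nmin.
have fdvd q : J (cycle_eval c q) <-> f %| q.
  split=> [Jq|fq]; last exact: cycle_eval_dvd Jf.
  rewrite /dvdp; apply/negPn/negP => r0.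
  have : (n <= size (q %% f)%R)%N.
    apply: nmin; apply/asboolP; exists (q %% f); split=> //.
    rewrite -[q %% f](addKr (q %/ f * f)) -divp_eq addrC cycle_evalB.
    by apply: nuidealB => //; apply: cycle_eval_dvd Jf => //; rewrite dvdp_mull.
  by rewrite -sf leqNgt ltn_modp f_neq0.
have f_0 : f.[0] != 0.
  apply/negP => /eqP f_0.
  have [q fE] : exists q, f = 'X * q.
    have /factor_theorem[q ->] : root f 0 by apply/eqP.
    by exists q; rewrite subr0 mulrC.
  have q0 : q != 0 by apply: contraNneq f_neq0 => q0; rewrite fE q0 mulr0.
  have : (n <= size q)%N.
    apply: nmin; apply/asboolP; exists q; split=> //.
    by apply: (cycle_evalX_cancel cc); rewrite -fE.
  by rewrite -sf fE mulrC size_mulX // ltnn.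
exists (f.[0]^-1 *: f); split; first by rewrite hornerZ mulVf.
by move=> q; rewrite fdvd dvdpZl // invr_eq0.
Qed.

Lemma canon_polyP c : is_cycle c -> meets_properly J c ->
  is_canon_poly J c (canon_poly J c).
Proof.
by move=> cc /(canon_poly_exists cc)[f fc];
  exact: (xgetPex 1 (ex_intro _ f fc)).
Qed.

Lemma canon_poly_rot k c : is_cycle c ->
  canon_poly J (rot k c) = canon_poly J c.
Proof.
move=> cc; rewrite /canon_poly; congr xget; apply/funext => f; apply/propext.
split=> -[f0 fJ]; split=> // q; rewrite -fJ; first by rewrite cycle_eval_rot.
by rewrite cycle_eval_rot.
Qed.

Lemma meets_properly_vertex c v : is_cycle c -> meets_properly J c ->
  v \in map src c -> ~ J (V v).
Proof.
move=> cc [_ [q nJq]] /mapP[e ec ->] Je; apply: nJq.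
have [k s rk] := rot_to ec; rewrite -(cycle_eval_rot k) // rk.
have lc : loop_at (src e) (e :: s) by apply: is_cycle_loop;
  rewrite -rk is_cycle_rot.
by rewrite -(lv_cycle_eval _ lc); exact: nuidealMr.
Qed.

(** Conjugating [f_C(C)] by an exit [e] leaves its constant term 1 times [t(e)], so the target of
    every exit lies in [J]. *)
Lemma meets_properly_exit c e : is_cycle c -> meets_properly J c ->
  src e \in map src c -> ~ J (V (tgt e)) -> e \in c.
Proof.
move=> cc Jc /mapP[f fc ef] Je; apply/negPn/negP => ec; apply: Je.
have [p [p0 pJ]] := canon_poly_exists cc Jc.
have Jp : J (cycle_eval c p) by apply/pJ.
have [k s rk] := rot_to fc.
have lc : loop_at (src f) (f :: s) by apply: is_cycle_loop;
  rewrite -rk is_cycle_rot.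
rewrite -(cycle_eval_rot k) // rk in Jp.
have := nuidealMr (a e) (nuidealMl (g e) Jp).
rewrite (lg_cycle_eval_la _ lc) //; last by rewrite -rk mem_rot.
by rewrite -horner_coef0 p0 scale1r.
Qed.

End CanonicalPolynomials.

(** * Cycles without exit in the quotient digraph *)

Section QuotientCycles.
Context (F : fieldType) (G : digraph) (I : ideal (leavitt F G)).
Local Notation Q := (quot_digraph I).
Implicit Types (c : seq (arrow G)).

Let lft (x : set_type [set e : arrow G | ~ ideal_vertices I (tgt e)]) : arrow Q
  := inl x.

Lemma is_cycle_quot s : is_cycle (map lft s) = is_cycle (map val s).
Proof.
rewrite /is_cycle -!size_eq0 !size_map; congr [&& _, _ & _].
  by case: s => //= x s; rewrite -!map_rcons !path_map; apply: eq_path.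
rewrite -!map_comp.
rewrite -(map_inj_uniq (f := fun v : vertex G => inl v : (vertex G + vertex
  G)%type)); last by move=> ? ? [].
have inj : injective (fun v : vertex Q => match v with inl x => inl (val x) |
  inr x => inr (val x) end : (vertex G + vertex G)%type).
  by move=> [x|x] [y|y] //= [] /val_inj->.
by rewrite -(map_inj_uniq inj) -!map_comp.
Qed.

(** The last condition excludes exits through primed arrows: if a vertex of the cycle were primed,
    the arrow of the cycle ending there would have a second copy, leaving the cycle for a sink. *)
Lemma no_exit_quotP c : no_exit_cycle_in_quot I c <->
  [/\ is_cycle c, forall e, e \in c -> ~ ideal_vertices I (tgt e),
      forall e, src e \in map src c -> ~ ideal_vertices I (tgt e) -> e \in c &
      forall v, v \in map src c -> ~ primed I v].
Proof.
split=> [[s [-> cs ns]]|[cc offc exc npc]].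
  have srcP e (Pe : quot_vertex I) : src e \in map src (map val s) ->
    (match Pe with inl x => val x = src e | inr _ => False end) -> 
    Pe \in map (@src Q) (map lft s).
    case: Pe => // x /mapP[_ /mapP[y ys ->] ->] xy.
    apply/mapP; exists (lft y); first exact: map_f.
    by congr inl; apply: val_inj.
  split.
  - by rewrite -is_cycle_quot.
  - by move=> _ /mapP[x _ ->]; have := set_mem (valP x).
  - move=> e es He; pose x := exist _ e (mem_set He) : set_type [set e : arrow
      G | ~ ideal_vertices I (tgt e)].
    have /mapP[y ys [xy]] : lft x \in map lft s by apply: ns; apply: (srcP e).
    by apply/mapP; exists y => //; rewrite -xy.
  - move=> v vs pv.
    have [e es ev] : exists2 e, e \in map val s & tgt e = v.
      by apply: is_cycle_pred => //; rewrite -is_cycle_quot.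
    have pe : primed I (tgt e) by rewrite ev.
    pose x : arrow Q := inr (exist _ e (mem_set pe) : set_type [set e : arrow G
      | primed I (tgt e)]).
    suff /mapP[y _ //] : x \in map lft s.
    by apply: ns; apply: (srcP e) => //; exact: map_f.
have [s cE] : exists s : seq (set_type [set e : arrow G | ~ ideal_vertices I
  (tgt e)]), c = map val s.
  elim: c offc {cc exc npc} => [|e c IH] h; first by exists [::].
  have [|s ->] := IH; first by move=> f fc; apply: h; rewrite inE fc orbT.
  by exists (exist _ e (mem_set (h e (mem_head _ _))) :: s).
exists s; rewrite cE in cc offc exc npc *; split=> //;
  first by rewrite is_cycle_quot.
have srcP (x : arrow Q) : src x \in map (@src Q) (map lft s) ->
    (match x with inl y => src (val y) | inr y => src (val y) end) \in map src
      (map val s).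
  move=> /mapP[_ /mapP[y ys ->]] xy; apply/mapP; exists (val y);
    first exact: map_f.
  by case: x xy => z [].
move=> [x|x] /srcP xs.
  have /mapP[y ys xy] := exc _ xs (set_mem (valP x)).
  by rewrite (val_inj xy); exact: map_f.
have px := set_mem (valP x).
have xc : val x \in map val s.
  apply: exc => //; case: px => -[_ [f [fx Hf]] _] _ Hx; apply: Hf.
  by apply: ideal_vertices_hereditary; rewrite fx.
by case: (npc _ (is_cycle_tgt cc xc)).
Qed.

End QuotientCycles.

(** * Comparison of [J] with its largest graded ideal *)

Section LargestGraded.
Context (F : fieldType) (G : digraph) (I J : ideal (leavitt F G)).
Hypothesis IJ : largest_graded_in I J.
Local Notation V := (@lv F G).
Local Notation a := (@la F G).
Local Notation g := (@lg F G).

Lemma homogeneous_sum n (T : Type) (r : seq T) (E : T -> leavitt F G) :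
  (forall i, homogeneous n (E i)) -> homogeneous n (\sum_(i <- r) E i).
Proof.
by move=> h; elim/big_rec: _ => [|i x _ hx]; [exact: homog_0|exact: homog_add].
Qed.

(** A homogeneous element of [J] generates a graded ideal inside [J], which is contained in [I] by
    maximality. *)
Lemma largest_graded_mem n x : homogeneous n x -> J x <-> I x.
Proof.
have [_ IsJ Imax] := IJ => hx; split; last exact: IsJ.
move=> Jx; apply: (Imax (ideal_gen [set x]%classic)).
- by exists [set x]%classic; split=> // _ ->; exists n.
- by apply: ideal_gen_min => _ ->.
- exact: mem_ideal_gen.
Qed.

Lemma ideal_vertices_eq : ideal_vertices I = ideal_vertices J.
Proof.
by apply/seteqP; split=> v /=;
  rewrite /ideal_vertices /= (largest_graded_mem (homog_v F v)).
Qed.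

Lemma primed_eq : primed I = primed J.
Proof.
have off : arrows_off I = arrows_off J by rewrite /arrows_off ideal_vertices_eq.
have br : breaking_vertices I = breaking_vertices J by rewrite
  /breaking_vertices off.
have elt v : breaking_elt I v = breaking_elt J v by rewrite /breaking_elt off.
rewrite /primed br; congr (_ `\` _)%classic.
apply/seteqP; split=> v; rewrite /ideal_breaking /= br elt => -[bv h];
  split=> //;
  apply/(@largest_graded_mem 0) => //; rewrite /breaking_elt -scaleN1r;
  apply: homog_add; [exact: homog_v| |exact: homog_v|];
  apply: homog_scale; apply: homogeneous_sum => e;
  exact: (homog_mul (homog_a F e) (homog_g F e)).
Qed.

Lemma breaking_eltE v (r : seq (arrow G)) : uniq r ->
  (forall e, e \in r <-> arrows_off J v e) ->
  breaking_elt J v = V v - \sum_(e <- r) a e ** g e.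
Proof. by move=> ur rP; rewrite /breaking_elt (set_of_seq rP) -fsbig_seq. Qed.

(** If a vertex [v] of the cycle is a breaking vertex, the arrow [e] of the cycle at [v] is the only
    one with target outside [J], so [v^H = v - e e^*]. This kills the positive powers of the cycle
    from the left, so [v^H f_C(C) = v^H] lies in [J] and [v] is not primed. *)
Lemma meets_properly_no_exit c : is_cycle c -> meets_properly J c ->
  no_exit_cycle_in_quot I c.
Proof.
move=> cc Jc; apply/no_exit_quotP; rewrite ideal_vertices_eq primed_eq.
have offc e : src e \in map src c -> ~ ideal_vertices J (tgt e) -> e \in c.
  exact: meets_properly_exit.
split=> //.
  by move=> e ec; apply: (meets_properly_vertex cc Jc); exact: is_cycle_tgt.
move=> v vc [bv]; apply; split=> //.
have [p [p0 pJ]] := canon_poly_exists cc Jc.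
have Jp : J (cycle_eval c p) by apply/pJ.
have /mapP[e ec ve] := vc; have [k s rk] := rot_to ec.
have ces : is_cycle (e :: s) by rewrite -rk is_cycle_rot.
have lc : loop_at v (e :: s) by rewrite ve; exact: is_cycle_loop.
rewrite -(cycle_eval_rot J k) // rk in Jp.
have eP f : f \in [:: e] <-> arrows_off J v f.
  rewrite inE; split=> [/eqP->|[fv Hf]]; first split=> //.
    by apply: (meets_properly_vertex cc Jc); exact: is_cycle_tgt.
  apply/eqP/(is_cycle_src_inj cc) => //; last by rewrite fv.
  by apply: offc => //; rewrite fv.
have := nuidealMl (breaking_elt J v) Jp;
  rewrite (breaking_eltE _ eP) // big_seq1.
suff -> : (V v - a e ** g e) ** cycle_eval (e :: s) p = V v - a e ** g e by [].
rewrite (@cycle_eval_widen _ _ _ _ (size p).+1) // nu_sumr big_ord_recl /=.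
rewrite nuZr -horner_coef0 p0 scale1r big1 ?addr0 => [|i _].
  by rewrite nuBl -mulgA lgv -ve lvvid.
by rewrite nuZr mulgA nuBl -mulgA lgaid lav ve lva subrr nu0l scaler0.
Qed.

End LargestGraded.

(** * Splitting the vertices *)

Section Lagrange.
Context (F : fieldType).
Implicit Types (r : seq F) (q : {poly F}).

Definition lagrange r i : {poly F} :=
  \prod_(z <- r | z != r`_i) ((r`_i - z)^-1 *: ('X - z%:P)).

Lemma lagrange_horner r i j : uniq r -> (i < size r)%N -> (j < size r)%N ->
  (lagrange r i).[r`_j] = (i == j)%:R.
Proof.
move=> ur ir jr; rewrite /lagrange horner_prod; have [->|ij] := eqVneq i j.
  rewrite big1 // => z zj; rewrite hornerZ hornerXsubC mulVf //.
  by rewrite subr_eq0 eq_sym.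
apply/eqP; rewrite prodf_seq_eq0; apply/hasP; exists r`_j; first exact: mem_nth.
by rewrite nth_uniq // eq_sym ij hornerZ hornerXsubC subrr mulr0 eqxx.
Qed.

Lemma dvdp_roots r k q : uniq r -> k != 0 ->
  (k *: \prod_(z <- r) ('X - z%:P) %| q) <-> (forall i, (i < size r)%N ->
    q.[r`_i] = 0).
Proof.
move=> ur k0; rewrite dvdpZl //; split=> [rq i ir|h].
  apply/rootP; move: rq => /dvdpP[s ->];
    rewrite rootM root_prod_XsubC mem_nth ?orbT //.
apply: uniq_roots_dvdp; last by rewrite uniq_rootsE.
by apply/allP => z /(nthP 0)[i ir <-]; apply/rootP/h.
Qed.

End Lagrange.

Section Splitting.
Context (F : closedFieldType) (G : digraph) (J : ideal (leavitt F G)).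
Variable beta : set (seq (arrow G)).
Implicit Types (v w : vertex G) (e f : arrow G) (s t c : seq (arrow G)).

Local Notation H v := `[< J (lv F v) >].

Hypothesis beta_cycle : forall c, beta c -> is_cycle c.
Hypothesis beta_rot : forall k c, beta c -> beta (rot k c).
Hypothesis beta_meets : forall c, beta c -> meets_properly J c.
Hypothesis beta_exit : forall c e, beta c -> src e \in map src c ->
  ~ J (lv F (tgt e)) -> e \in c.
Hypothesis beta_primed : forall c v, beta c -> v \in map src c -> ~ primed J v.
Hypothesis beta_dlf : forall c, beta c ->
  distinct_linear_factors (canon_poly J c).

Local Notation A := (nuquot J).
Local Notation pv v := (nupi J (lv F v)).
Local Notation pa e := (nupi J (la F e)).
Local Notation pg e := (nupi J (lg F e)).

Lemma qvv u v : pv u ** pv v = if u == v then pv u else 0.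
Proof. by rewrite -nupiM lvv; case: ifP. Qed.
Lemma qvvid v : pv v ** pv v = pv v. Proof. by rewrite qvv eqxx. Qed.
Lemma qva e : pv (src e) ** pa e = pa e. Proof. by rewrite -nupiM lva. Qed.
Lemma qav e : pa e ** pv (tgt e) = pa e. Proof. by rewrite -nupiM lav. Qed.
Lemma qvg e : pv (tgt e) ** pg e = pg e. Proof. by rewrite -nupiM lvg. Qed.
Lemma qgv e : pg e ** pv (src e) = pg e. Proof. by rewrite -nupiM lgv. Qed.
Lemma qga e f : pg e ** pa f = if e == f then pv (tgt e) else 0.
Proof. by rewrite -nupiM lga; case: ifP. Qed.

Lemma beta_off c e : beta c -> e \in c -> ~ J (lv F (tgt e)).
Proof.
move=> bc ec; apply: (meets_properly_vertex (beta_cycle bc) (beta_meets bc)).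
by apply: is_cycle_tgt => //; exact: beta_cycle.
Qed.

Lemma beta_vertex c v : beta c -> v \in map src c -> ~ J (lv F v).
Proof.
by move=> bc; exact: (meets_properly_vertex (beta_cycle bc) (beta_meets bc)).
Qed.

Lemma beta_sole c : beta c -> sole_exits (fun e => ~~ H (tgt e)) c.
Proof.
move=> bc e f ec /asboolPn Hf fe;
  apply: (is_cycle_src_inj (beta_cycle bc)) => //.
by apply: (beta_exit bc) => //; rewrite fe; exact: map_f.
Qed.

Lemma beta_prefix e s t : beta (e :: s) -> loop_at (src e) t ->
  all (fun e => ~~ H (tgt e)) t -> exists t', t = (e :: s) ++ t'.
Proof.
move=> bc /and3P[t0 wt /eqP endt] tP.
exact: (cycle_prefix (beta_cycle bc) (beta_sole bc)).
Qed.

Lemma beta_all c : beta c -> all (fun e => ~~ H (tgt e)) c.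
Proof.
by move=> bc; apply/allP => e ec; apply/asboolPn; exact: beta_off ec.
Qed.

Lemma beta_uniq v c d : beta c -> beta d -> loop_at v c -> loop_at v d -> c = d.
Proof.
case: c => // e s; case: d => // f t bc bd lc ld.
have ev : src e = v by case/and3P: lc => _ /= /andP[/eqP].
have fv : src f = v by case/and3P: ld => _ /= /andP[/eqP].
have [t1 E1] : exists t', f :: t = (e :: s) ++ t'.
  by apply: beta_prefix => //; [rewrite ev|exact: beta_all].
have [t2 E2] : exists t', e :: s = (f :: t) ++ t'.
  by apply: beta_prefix => //; [rewrite fv|exact: beta_all].
have t10 : size t1 = 0%N.
  by move: (congr1 size E1) (congr1 size E2); rewrite !size_cat; lia.
by rewrite E1 (size0nil t10) cats0.
Qed.

(** At most one member of [beta] starts at a given vertex, so this is the representative based at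
    [v] of the cycle through [v]; the empty default marks a vertex on no cycle of [beta]. *)
Definition cyc v : seq (arrow G) := xget [::] [set c | beta c /\
  loop_at v c]%classic.
Definition oncyc v : bool := cyc v != [::].

Lemma cycE v c : beta c -> loop_at v c -> cyc v = c.
Proof.
move=> bc lc; rewrite /cyc; case: xgetP => [d _ [bd ld]|/(_ c) []//].
exact: (@beta_uniq v).
Qed.

Lemma oncycP v : oncyc v -> beta (cyc v) /\ loop_at v (cyc v).
Proof. by rewrite /oncyc /cyc; case: xgetP => [d -> //|_ /eqP]. Qed.

Lemma oncycI c v : beta c -> v \in map src c -> oncyc v.
Proof.
move=> bc /mapP[e ec ->]; have [k s rk] := rot_to ec.
have bes : beta (e :: s) by rewrite -rk; exact: beta_rot.
by rewrite /oncyc (cycE bes (is_cycle_loop (beta_cycle bes))).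
Qed.

Lemma oncyc_cons v : oncyc v -> exists e s,
  [/\ cyc v = e :: s, src e = v, beta (e :: s), loop_at v (e :: s) &
      loop_at (tgt e) (rcons s e) /\ cyc (tgt e) = rcons s e].
Proof.
move=> /oncycP[bc lc]; case: (cyc v) bc lc => // e s bc lc; exists e, s.
have ev : src e = v by case/and3P: lc => _ /= /andP[/eqP].
have lc' := loop_at_cons lc.
by split=> //; split=> //; apply: cycE => //; rewrite -rot1_cons;
  exact: beta_rot.
Qed.

Lemma oncyc_mem v : oncyc v -> v \in map src (cyc v).
Proof. by case/oncyc_cons => e [s [-> <- _ _ _]]; rewrite mem_head. Qed.

Lemma oncyc_off v : oncyc v -> ~ J (lv F v).
Proof.
by move=> ov; have [bc _] := oncycP ov; exact: beta_vertex bc (oncyc_mem ov).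
Qed.

Lemma oncyc_primed v : oncyc v -> ~ primed J v.
Proof.
by move=> ov; have [bc _] := oncycP ov; exact: beta_primed bc (oncyc_mem ov).
Qed.

Lemma oncyc_step e : oncyc (src e) -> ~ J (lv F (tgt e)) ->
  exists s, cyc (src e) = e :: s /\ cyc (tgt e) = rcons s e.
Proof.
move=> oe He; have [f [s [cE fe bc lc [_ cE']]]] := oncyc_cons oe.
have ef : e = f by apply: (beta_sole bc); rewrite ?mem_head //; apply/asboolPn.
by exists s; rewrite cE ef.
Qed.

Lemma oncyc_tgt e : oncyc (src e) -> ~ J (lv F (tgt e)) -> oncyc (tgt e).
Proof.
by move=> oe He; have [s [_ E]] := oncyc_step oe He; rewrite /oncyc E;
  case: (s).
Qed.

(** The list is chosen from the canonical polynomial alone, so all vertices of one cycle get the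
    same roots in the same order, and an index denotes the same root all along the cycle. *)
Definition roots_at v : seq F := xget [::] [set r | uniq r /\
  exists2 k, k != 0 & canon_poly J (cyc v) = k *: \prod_(z <- r) ('X -
    z%:P)]%classic.

Lemma roots_atP v : oncyc v -> uniq (roots_at v) /\
  exists2 k, k != 0 & canon_poly J (cyc v) = k *: \prod_(z <- roots_at v) ('X -
    z%:P).
Proof.
move=> /oncycP[bc _]; have [k [r [k0 ur cE]]] := beta_dlf bc.
apply: (@xgetPex _ [::] [set r | uniq r /\
  exists2 k, k != 0 & canon_poly J (cyc v) = k *: \prod_(z <- r) ('X -
    z%:P)]%classic).
by exists r; split=> //; exists k.
Qed.

Lemma roots_at_step e : oncyc (src e) -> ~ J (lv F (tgt e)) ->
  roots_at (tgt e) = roots_at (src e).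
Proof.
move=> oe He; have [s [E1 E2]] := oncyc_step oe He.
have cc : is_cycle (e :: s) by rewrite -E1; apply: beta_cycle;
  case: (oncycP oe).
by rewrite /roots_at E1 E2 -rot1_cons canon_poly_rot.
Qed.

Lemma cycle_eval_roots v q : oncyc v ->
  J (cycle_eval (cyc v) q) <-> (forall i, (i < size (roots_at v))%N ->
    q.[(roots_at v)`_i] = 0).
Proof.
move=> ov; have [bc _] := oncycP ov.
have [_ ->] := canon_polyP (beta_cycle bc) (beta_meets bc).
by have [ur [k k0 ->]] := roots_atP ov; exact: dvdp_roots.
Qed.

Lemma roots_at_neq0 v i : oncyc v -> (i < size (roots_at v))%N ->
  (roots_at v)`_i != 0.
Proof.
move=> ov ir; have [bc _] := oncycP ov.
have [f0 _] := canon_polyP (beta_cycle bc) (beta_meets bc).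
have [ur [k k0 fE]] := roots_atP ov; apply: contra_eq_neq f0 => r0.
rewrite fE hornerZ horner_prod (_ : \prod_(z <- _) _ = 0) ?mulr0 1?eq_sym
  ?oner_neq0 //.
apply/eqP; rewrite prodf_seq_eq0; apply/hasP; exists (roots_at v)`_i;
  first exact: mem_nth.
by rewrite hornerXsubC r0 subrr eqxx.
Qed.

Lemma roots_at_gt0 v : oncyc v -> (0 < size (roots_at v))%N.
Proof.
move=> ov; rewrite lt0n; apply/negP => /eqP r0; apply: (oncyc_off ov).
have [bc lc] := oncycP ov.
by rewrite -(cycle_eval1 _ lc); apply/(cycle_eval_roots _ ov); rewrite r0.
Qed.

Definition ceval v q : A := nupi J (cycle_eval (cyc v) q).

(** Modulo [J], polynomials in the cycle are functions on its roots; identities between Lagrange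
    polynomials can thus be checked pointwise. *)
Lemma ceval_eq v p q : oncyc v ->
  (forall i, (i < size (roots_at v))%N ->
    p.[(roots_at v)`_i] = q.[(roots_at v)`_i]) ->
  ceval v p = ceval v q.
Proof.
move=> ov pq; apply/nupi_eq; rewrite -cycle_evalB;
  apply/(cycle_eval_roots _ ov) => i ir.
by rewrite hornerD hornerN pq // subrr.
Qed.

Lemma cevalM v p q : oncyc v -> ceval v (p * q) = ceval v p ** ceval v q.
Proof. by case/oncycP => _ lc; rewrite /ceval (cycle_evalM _ _ lc) nupiM. Qed.

Lemma ceval1 v : oncyc v -> ceval v 1 = pv v.
Proof. by case/oncycP => _ lc; rewrite /ceval (cycle_eval1 _ lc). Qed.

Lemma ceval_vl v p : oncyc v -> pv v ** ceval v p = ceval v p.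
Proof. by move=> ov; rewrite -ceval1 // -cevalM // mul1r. Qed.

Lemma ceval_vr v p : oncyc v -> ceval v p ** pv v = ceval v p.
Proof. by move=> ov; rewrite -ceval1 // -cevalM // mulr1. Qed.

Lemma ceval_a e q : oncyc (src e) -> ~ J (lv F (tgt e)) ->
  ceval (src e) q ** pa e = pa e ** ceval (tgt e) q.
Proof.
move=> oe He; have [s [E1 E2]] := oncyc_step oe He; have [_ lc] := oncycP oe.
by rewrite /ceval E1 E2 -!nupiM (cycle_eval_la (v := src e)) // -E1.
Qed.

(* [2] counts a primed vertex [v] and its copy [v'] in [Gamma/J]. *)
Definition npieces v : nat :=
  if H v then 0 else if oncyc v then size (roots_at v)
  else if `[< primed J v >] then 2 else 1.

Definition gap v : A := nupi J (breaking_elt J v).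

(** At a primed vertex, index 0 is [v - v^H], the idempotent of [v] in [Gamma/J], and index 1 is
    [v^H], that of its copy [v']. Only indices below [npieces v] are meaningful. *)
Definition piece v i : A :=
  if oncyc v then ceval v (lagrange (roots_at v) i)
  else if `[< primed J v >] then (if i == 0%N then pv v - gap v else gap v)
  else pv v.

Lemma npieces_gt0 v : (0 < npieces v)%N <-> ~ J (lv F v).
Proof.
rewrite /npieces; case: asboolP => // nJ; split=> // _.
by case: ifP => [/roots_at_gt0 //|_]; case: ifP.
Qed.

Lemma primed_gap v : primed J v -> exists r : seq (arrow G),
  [/\ uniq r, r != [::], forall e, e \in r <-> arrows_off J v e &
      gap v = pv v - \sum_(e <- r) pa e ** pg e].
Proof.
move=> [[_ [e0 He0] fin] _].
have rP e : e \in (fset_set (arrows_off J v) : seq (arrow G)) <-> arrows_off J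
  v e.
  by rewrite in_fset_set //; split=> [/set_mem|/mem_set].
exists (fset_set (arrows_off J v)); split=> //.
  by apply/negP => /eqP r0; move/rP: He0; rewrite r0.
rewrite /gap (breaking_eltE _ rP) // nupiB nupi_sum.
by congr (_ - _); apply: eq_bigr => e _; rewrite nupiM.
Qed.

Lemma sum_ag_vl v (r : seq (arrow G)) : (forall e, e \in r -> src e = v) ->
  pv v ** (\sum_(e <- r) pa e ** pg e) = \sum_(e <- r) pa e ** pg e.
Proof.
by move=> rv; rewrite nu_sumr; apply: eq_big_seq => e /rv <-; rewrite mulgA qva.
Qed.

Lemma sum_ag_vr v (r : seq (arrow G)) : (forall e, e \in r -> src e = v) ->
  (\sum_(e <- r) pa e ** pg e) ** pv v = \sum_(e <- r) pa e ** pg e.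
Proof.
by move=> rv; rewrite nu_suml; apply: eq_big_seq => e /rv <-;
  rewrite -mulgA qgv.
Qed.

Lemma sum_ag_a (r : seq (arrow G)) e : uniq r -> e \in r ->
  (\sum_(f <- r) pa f ** pg f) ** pa e = pa e.
Proof.
move=> ur er; rewrite nu_suml (bigD1_seq e) //= -mulgA qga eqxx qav big1 ?addr0
  // => f fe.
by rewrite -mulgA qga (negPf fe) nu0r.
Qed.

Lemma sum_ag_g (r : seq (arrow G)) e : uniq r -> e \in r ->
  pg e ** (\sum_(f <- r) pa f ** pg f) = pg e.
Proof.
move=> ur er; rewrite nu_sumr (bigD1_seq e) //= mulgA qga eqxx qvg big1 ?addr0
  // => f fe.
by rewrite mulgA qga eq_sym (negPf fe) nu0l.
Qed.

Lemma sum_ag_id (r : seq (arrow G)) : uniq r ->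
  (\sum_(e <- r) pa e ** pg e) ** (\sum_(e <- r) pa e ** pg e) = \sum_(e <- r)
    pa e ** pg e.
Proof.
by move=> ur; rewrite {2}big_seq nu_sumr [RHS]big_seq; apply: eq_bigr => e er;
   rewrite mulgA sum_ag_a.
Qed.

Lemma piece_vl v i : pv v ** piece v i = piece v i.
Proof.
rewrite /piece; case: ifP => [ov|_]; first exact: ceval_vl.
case: asboolP => [/primed_gap[r [ur _ rP ->]]|_]; last exact: qvvid.
have rv e : e \in r -> src e = v by case/rP.
by case: ifP => _; rewrite !nuBr ?qvvid sum_ag_vl // nuBr qvvid sum_ag_vl.
Qed.

Lemma piece_vr v i : piece v i ** pv v = piece v i.
Proof.
rewrite /piece; case: ifP => [ov|_]; first exact: ceval_vr.
case: asboolP => [/primed_gap[r [ur _ rP ->]]|_]; last exact: qvvid.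
have rv e : e \in r -> src e = v by case/rP.
by case: ifP => _; rewrite !nuBl ?qvvid sum_ag_vr // nuBl qvvid sum_ag_vr.
Qed.

Lemma piece_id v i j : (i < npieces v)%N -> (j < npieces v)%N ->
  piece v i ** piece v j = if i == j then piece v i else 0.
Proof.
rewrite /npieces /piece; case: asboolP => // _; case: ifP => [ov|_] iv jv.
  have [ur _] := roots_atP ov;
    rewrite -cevalM // -[0]/(nupi J 0) -[X in nupi J X](cycle_eval0 F (cyc v)).
  rewrite -/(ceval v 0); case: ifP => ij; apply: ceval_eq => // k kv.
    by rewrite -(eqP ij) hornerM !lagrange_horner //; case: eqP;
      rewrite ?mulr1 ?mulr0.
  rewrite hornerM !lagrange_horner // horner0; have [<-|] := eqVneq i k;
    last by rewrite mul0r.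
  by rewrite eq_sym ij mulr0.
case: asboolP iv jv => [/primed_gap[r [ur _ rP ->]]|_]; last first.
  by case: i j => [|//] [|//] _ _; rewrite qvvid.
have rv e : e \in r -> src e = v by case/rP.
rewrite opprB addrC subrK.
case: i j => [|[|//]] [|[|//]] _ _ //=.
- exact: sum_ag_id.
- by rewrite nuBr sum_ag_vr // sum_ag_id // subrr.
- by rewrite nuBl sum_ag_vl // sum_ag_id // subrr.
- by rewrite nuBr nuBl qvvid sum_ag_vr // nuBl sum_ag_vl // sum_ag_id // subrr
    subr0.
Qed.

Lemma piece_sum v : pv v = \sum_(0 <= i < npieces v) piece v i.
Proof.
rewrite /npieces /piece; case: asboolP => [Jv|_]; first by rewrite big_geq //;
  apply/nupi0P.
case: ifP => [ov|_].
  have [ur _] := roots_atP ov; rewrite -nupi_sum -cycle_eval_sum -ceval1 //.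
  apply: ceval_eq => // i ir; rewrite horner_sum hornerC.
  rewrite (bigD1_seq i) ?mem_index_iota ?iota_uniq //= lagrange_horner // eqxx.
  rewrite big_seq_cond big1 ?addr0 // => j /andP[];
    rewrite mem_index_iota => /= jr ji.
  by rewrite lagrange_horner // (negPf ji).
case: asboolP => _; last by rewrite big_nat1.
by rewrite big_ltn // big_nat1 /= subrK.
Qed.

(** A Lagrange polynomial has value 1 at its own root. At a primed vertex, [v^H] is not in [J] by
    definition, and [v - v^H] fixes an arrow that is nonzero modulo [J], its target being outside
    [J]. *)
Lemma piece_neq0 v i : (i < npieces v)%N -> piece v i <> 0.
Proof.
rewrite /npieces /piece; case: asboolP => // nJ; case: ifP => [ov iv|_].
  have [ur _] := roots_atP ov;
    move=> /nupi0P /(cycle_eval_roots _ ov) /(_ _ iv).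
  by rewrite lagrange_horner // eqxx => /eqP; rewrite oner_eq0.
case: asboolP => [pr|_ _ /nupi0P //].
case: i => [|[|//]] _ /=; last by move=> /nupi0P Jv; case: pr => bv; apply.
have [r [ur r0 rP ->]] := primed_gap pr; rewrite opprB addrC subrK => s0.
case: r r0 ur rP s0 => // e r _ ur rP s0;
  have [_] : arrows_off J v e by apply/rP; rewrite mem_head.
apply; apply/nupi0P; rewrite -[e in tgt e]/e.
have := sum_ag_a ur (mem_head e r); rewrite s0 nu0l => ae.
by have := qga e e; rewrite -ae nu0r eqxx.
Qed.

(** A copy of an arrow on a cycle of [beta] stays on one copy of the cycle. All other arrows leave
    from index 0; in particular the copy [v'] of a primed vertex is a sink. *)
Definition src_index e i : nat := if oncyc (src e) then i else 0.

Lemma npieces_src e i : (i < npieces (tgt e))%N ->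
  (src_index e i < npieces (src e))%N.
Proof.
move=> ie; have He : ~ J (lv F (tgt e)) by apply/npieces_gt0;
  case: (npieces _) ie.
rewrite /src_index; case: ifP => oe; last first.
  by apply/npieces_gt0 => Js; apply: He; exact: (ideal_vertices_hereditary Js).
move: ie; rewrite /npieces (oncyc_tgt oe He) oe roots_at_step //.
by case: asboolP => // _; case: asboolP => // /(oncyc_off oe).
Qed.

Lemma piece_a e i : (i < npieces (tgt e))%N ->
  piece (src e) (src_index e i) ** (pa e ** piece (tgt e) i) = pa e ** piece
    (tgt e) i.
Proof.
move=> ie; have He : ~ J (lv F (tgt e)) by apply/npieces_gt0;
  case: (npieces _) ie.
rewrite {1}/piece /src_index; case oe: (oncyc (src e)).
  rewrite mulgA ceval_a // -roots_at_step // -[ceval _ _]/(ceval (tgt e)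
    (lagrange (roots_at (tgt e)) i)).
  have -> : ceval (tgt e) (lagrange (roots_at (tgt e)) i) = piece (tgt e) i.
    by rewrite /piece (oncyc_tgt oe He).
  by rewrite -mulgA piece_id // eqxx.
case: asboolP => [/primed_gap[r [ur _ rP ->]] /=|_]; last by rewrite mulgA qva.
rewrite opprB addrC subrK mulgA sum_ag_a //.
by apply/rP; split.
Qed.

(** (CK2) modulo [J]. If [v] emits finitely many arrows, those with target in [J] vanish in the
    quotient; if infinitely many, [v] is a breaking vertex and [v^H] lies in [J] because [v] is not
    primed. *)
Lemma qag v (r : seq (arrow G)) : ~ primed J v -> uniq r -> r != [::] ->
  (forall e, e \in r <-> arrows_off J v e) -> pv v = \sum_(e <- r) pa e ** pg e.
Proof.
move=> np ur r0 rP.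
have [fin|inf] := pselect (finite_set [set e | src e = v]%classic); last first.
  have bv : breaking_vertices J v.
    split=> //; last by rewrite (set_of_seq rP); exact: finite_seq.
    by case: (r) r0 rP => // e r' _ rP; exists e; apply/rP; rewrite mem_head.
  have : J (breaking_elt J v) by apply: contrapT => nJ; apply: np;
    split=> // -[].
  rewrite (breaking_eltE ur rP) => /nupi0P; rewrite nupiB nupi_sum => /eqP.
  by rewrite subr_eq0 => /eqP->; apply: eq_bigr => e _; rewrite nupiM.
pose R : seq (arrow G) := fset_set [set e | src e = v]%classic.
have RP e : e \in R <-> src e = v by rewrite /R in_fset_set //;
  split=> [/set_mem|/mem_set].
have R0 : R != [::].
  case: r r0 rP {ur} => // e r _ rP; apply/negP => /eqP R0.
  have /RP : src e = v by have /rP[] := mem_head e r.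
  by rewrite R0.
rewrite (lCK2 F (fset_uniq _) R0 RP) nupi_sum (bigID (mem r)) /= [X in _ +
  X]big1_seq ?addr0.
  rewrite -big_filter; under eq_bigr do rewrite nupiM; apply: perm_big.
  apply: uniq_perm => //; first by rewrite filter_uniq // fset_uniq.
  move=> e; rewrite mem_filter andb_idr // => /rP[ev _]; exact/RP.
move=> e /andP[er /RP ev]; rewrite nupiM.
suff -> : pa e = 0 by rewrite nu0l.
rewrite -qav (_ : pv (tgt e) = 0) ?nu0r //; apply/nupi0P.
by apply: contrapT => Je; move/negP: er; apply; apply/rP.
Qed.

Lemma oncyc_ag e : oncyc (src e) -> ~ J (lv F (tgt e)) ->
  pa e ** pg e = pv (src e).
Proof.
move=> oe He; rewrite (@qag _ [:: e]) ?big_seq1 //; first exact: oncyc_primed.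
move=> f; rewrite inE; split=> [/eqP->|[fe Hf]]; first by split.
have [bc _] := oncycP oe; apply/eqP; apply: (beta_sole bc) => //;
  last by apply/asboolPn.
by have [s [-> _]] := oncyc_step oe He; rewrite mem_head.
Qed.

Lemma piece_g e i : (i < npieces (tgt e))%N ->
  (piece (tgt e) i ** pg e) ** piece (src e) (src_index e i) = piece (tgt e) i
    ** pg e.
Proof.
move=> ie; have He : ~ J (lv F (tgt e)) by apply/npieces_gt0;
  case: (npieces _) ie.
rewrite {2}/piece /src_index; case oe: (oncyc (src e)).
  have pE : piece (tgt e) i = ceval (tgt e) (lagrange (roots_at (src e)) i).
    by rewrite /piece (oncyc_tgt oe He) roots_at_step.
  (* Inserting [e e^*] for the source vertex reduces the commutation of [e^*] with polynomials in
     the cycle to that of [e]. *)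
  rewrite -[X in _ ** X]ceval_vr // -oncyc_ag // -!mulgA.
  rewrite [X in _ ** (_ ** X)]mulgA ceval_a // -pE -!mulgA.
  by rewrite [X in _ ** X]mulgA qga eqxx mulgA piece_vr mulgA piece_id // eqxx.
case: asboolP => [/primed_gap[r [ur _ rP ->]] /=|_]; last by rewrite -mulgA qgv.
rewrite opprB addrC subrK -mulgA sum_ag_g //.
by apply/rP; split.
Qed.


(* [choose] depends only on the extension of the predicate, so exactly one
   arrow of each geometric cycle of [beta] is marked. *)
Definition marked e : bool :=
  `[< exists c, [/\ beta c, e \in c & choose (mem c) e = e] >].

Lemma marked_oncyc e : marked e -> oncyc (src e).
Proof. by move=> /asboolP[c [bc ec _]]; apply: (oncycI bc); exact: map_f. Qed.

Lemma beta_mem_cyc c v : beta c -> v \in map src c -> cyc v =i c.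
Proof.
move=> bc /mapP[e ec ->]; have [k s rk] := rot_to ec.
have bes : beta (e :: s) by rewrite -rk; exact: beta_rot.
rewrite (cycE bes (is_cycle_loop (beta_cycle bes))) -rk => f.
by rewrite mem_rot.
Qed.

Lemma markedE c e : beta c -> e \in c -> marked e = (choose (mem c) e == e).
Proof.
move=> bc ec; apply/asboolP/eqP => [[d [bd ed <-]]|ce]; last by exists c.
have cd : mem c =1 mem d.
  move=> f; rewrite /= -(beta_mem_cyc bc (map_f src ec)).
  by rewrite (beta_mem_cyc bd (map_f src ed)).
rewrite (eq_choose cd); apply: choose_id; rewrite -?cd //.
by rewrite cd; exact: (@chooseP _ (mem d)).
Qed.

Lemma marked_exists c : beta c -> exists2 e, e \in c & marked e.
Proof.
move=> bc; have [e [s cE]] := is_cycle_cons (beta_cycle bc).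
have ec : mem c e by rewrite cE /= mem_head.
have mc : mem c (choose (mem c) e) by apply: chooseP.
exists (choose (mem c) e) => //; rewrite (markedE bc) //.
by apply/eqP; apply: choose_id.
Qed.

Lemma marked_uniq c e f : beta c -> e \in c -> f \in c -> marked e ->
  marked f -> e = f.
Proof.
move=> bc ec fc; rewrite (markedE bc ec) (markedE bc fc) => /eqP<- /eqP<-.
exact: choose_id.
Qed.

Local Notation split_vertex := {x : vertex G * nat | (x.2 < npieces x.1)%N}.
Local Notation split_arrow :=
  {x : arrow G * nat | (x.2 < npieces (tgt x.1))%N && ~~ marked x.1}.

Lemma split_srcP (x : split_arrow) :
  (src_index (val x).1 (val x).2 < npieces (src (val x).1))%N.
Proof. by apply: npieces_src; case/andP: (valP x). Qed.

Lemma split_tgtP (x : split_arrow) : ((val x).2 < npieces (tgt (val x).1))%N.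
Proof. by case/andP: (valP x). Qed.

(* Every vertex is replaced by its pieces, an arrow is repeated once for each
   piece of its target, and one arrow is removed from each cycle of [beta]:
   on each piece it is a multiple of the adjoint of the rest of the cycle. *)
Definition split_digraph : digraph := @Digraph split_vertex split_arrow
  (fun x => exist _ (src (val x).1,
    src_index (val x).1 (val x).2) (split_srcP x))
  (fun x => exist _ (tgt (val x).1, (val x).2) (split_tgtP x)).

Local Notation G' := split_digraph.

Definition vpiece (x : vertex G') : A := piece (val x).1 (val x).2.
Definition apiece (y : arrow G') : A := pa (val y).1 ** piece (tgt (val y).1)
  (val y).2.
Definition gpiece (y : arrow G') : A := piece (tgt (val y).1) (val y).2 ** pg
  (val y).1.

Lemma split_offP (y : arrow G') : ~ J (lv F (tgt (val y).1)).
Proof. by apply/npieces_gt0; exact: leq_ltn_trans (split_tgtP y). Qed.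

(** On a cycle of [beta] a single arrow leaves [x], and its term moves the idempotent back along the
    cycle to that of [x]. Elsewhere the idempotents of each target add up to the target, and the sum
    becomes that of [e e^*] over the arrows with target outside [J]: this is [v - v^H] if [v] is
    primed and [v] otherwise. *)
Lemma split_CK2 (x : vertex G') (r : seq (arrow G')) : uniq r -> r != [::] ->
  (forall y, y \in r <-> src y = x) ->
    vpiece x = \sum_(y <- r) apiece y ** gpiece y.
Proof.
move=> ur r0 rP; have agE (y : arrow G') : apiece y ** gpiece y =
    pa (val y).1 ** piece (tgt (val y).1) (val y).2 ** pg (val y).1.
  rewrite /apiece /gpiece -!mulgA [X in _ ** X]mulgA piece_id ?eqxx //;
    exact: split_tgtP.
under eq_bigr do rewrite agE.
have [y0 y0r] : exists y, y \in r by case: (r) r0 => // y r' _; exists y;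
  exact: mem_head.
have srcE (y : arrow G') : y \in r ->
    src (val y).1 = (val x).1 /\ src_index (val y).1 (val y).2 = (val x).2.
  by move=> /rP <-.
case ov : (oncyc (val x).1).
  have eq0 y : y \in r -> y = y0.
    move=> yr; have [sy iy] := srcE _ yr; have [sy0 iy0] := srcE _ y0r.
    apply: val_inj; rewrite [val y]surjective_pairing [val
      y0]surjective_pairing.
    have [s [E1 _]] := @oncyc_step (val y0).1 ltac:(by rewrite sy0)
      (@split_offP y0).
    have [t [E2 _]] := @oncyc_step (val y).1 ltac:(by rewrite sy) (@split_offP
      y).
    move: iy iy0; rewrite /src_index sy sy0 ov => -> ->.
    by move: E1 E2; rewrite sy sy0 => -> [->].
  have -> : r = [:: y0].
    case: r ur {r0} y0r eq0 {rP srcE} => // y1 [|y2 r] /= u _ h.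
      by rewrite (h y1) ?mem_head.
    by move: u; rewrite (h y1) ?mem_head // (h y2) ?inE ?eqxx ?orbT.
  have [sy iy] := srcE _ y0r; rewrite big_seq1 /vpiece -sy -iy.
  have o0 : oncyc (src (val y0).1) by rewrite sy.
  have H0 := @split_offP y0.
  have -> : pa (val y0).1 ** piece (tgt (val y0).1) (val y0).2 =
     piece (src (val y0).1) (src_index (val y0).1 (val y0).2) ** pa (val y0).1.
    by rewrite /piece o0 oncyc_tgt // ceval_a // roots_at_step // /src_index o0.
  by rewrite -mulgA oncyc_ag // piece_vr.
have x2 : (val x).2 = 0%N by have [sy <-] := srcE _ y0r;
  rewrite /src_index sy ov.
pose R := undup [seq (val y).1 | y <- r].
have RP e : e \in R <-> arrows_off J (val x).1 e.
  rewrite mem_undup; split=> [/mapP[y yr ->]|[ev He]].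
    by have [sy _] := srcE _ yr; split=> //; exact: split_offP.
  have ie : (0 < npieces (tgt e))%N by apply/npieces_gt0.
  have me : ~~ marked e by apply/negP => /marked_oncyc; rewrite ev ov.
  pose y : arrow G' := exist _ (e, 0%N) (introT andP (conj ie me)).
  apply/mapP; exists y => //; apply/rP; apply: val_inj.
  by rewrite /= /src_index ev ov [RHS]surjective_pairing x2.
have -> : \sum_(y <- r) pa (val y).1 ** piece (tgt (val y).1) (val y).2 ** pg
  (val y).1
    = \sum_(e <- R) pa e ** pg e.
  rewrite -(big_map val xpredT (fun z : arrow G * nat =>
     pa z.1 ** piece (tgt z.1) z.2 ** pg z.1)).
  (* Off the cycles of [beta] no arrow is marked and every copy starts at index 0, so [r] lists all
     copies of all arrows of [R]. *)
  rewrite (perm_big [seq (e, i) | e <- R, i <- iota 0 (npieces (tgt e))]) /=;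
    last first.
    apply: uniq_perm.
    - by rewrite map_inj_uniq //; exact: val_inj.
    - apply: allpairs_uniq_dep => [|e _|[? ?] [? ?] _ _ /= [-> ->] //].
        exact: undup_uniq.
      exact: iota_uniq.
    - move=> [e i]; apply/mapP/allpairsPdep => [[y yr yE]|[f [j [fR ji [->
        ->]]]]].
        exists e, i; split=> //; first by rewrite mem_undup; apply/mapP;
          exists y => //; exact: (congr1 fst yE).
        rewrite mem_iota add0n; have := split_tgtP y.
        by rewrite -[val y]/(sval y) -yE.
      have [fv Hf] := (RP f).1 fR.
      have mf : ~~ marked f by apply/negP => /marked_oncyc; rewrite fv ov.
      rewrite mem_iota add0n /= in ji.
      pose y : arrow G' := exist _ (f, j) (introT andP (conj ji mf)).
      exists y => //; apply/rP; apply: val_inj.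
      by rewrite /= /src_index fv ov [RHS]surjective_pairing x2.
  rewrite big_allpairs_dep /=; apply: eq_bigr => e _.
  rewrite -nu_suml -nu_sumr (_ : \sum_(i <- iota 0 _) _ = pv (tgt e)) ?qav //.
  by rewrite piece_sum /index_iota subn0.
rewrite /vpiece /piece ov x2 /=; case: asboolP => [|np].
  move=> /primed_gap[r' [ur' _ rP' ->]]; rewrite opprB addrC subrK;
    apply: perm_big.
  apply: uniq_perm; rewrite ?undup_uniq // => e; apply/idP/idP => [/rP'|/RP];
    first by move/RP.
  by move/rP'.
apply: qag; rewrite ?undup_uniq //.
apply/negP => /eqP R0; have : (val y0).1 \in R by rewrite mem_undup;
  exact: map_f.
by rewrite R0.
Qed.

Lemma split_hom_exists : exists f : {linear leavitt F G' -> A},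
  [/\ {morph f : x y / x ** y}, forall x, f (lv F x) = vpiece x,
      forall y, f (la F y) = apiece y & forall y, f (lg F y) = gpiece y].
Proof.
apply: (@leavitt_hom_exists F G' A (fun z => match z with
  | GVertex x => vpiece x | GArrow y => apiece y | GGhost y => gpiece y end)).
- move=> [[u i] ui] [[v j] vj]; rewrite /vpiece -val_eqE /= xpair_eqE.
  have [uv|uv] /= := eqVneq u v; last first.
    by rewrite -piece_vr -(piece_vl v j) mulgA -(mulgA (piece u i)) qvv (negPf
      uv) nu0r nu0l.
  by rewrite /= in ui vj; rewrite -uv in vj *; rewrite piece_id.
- by move=> y; rewrite /vpiece /apiece /= piece_a // split_tgtP.
- by move=> y; rewrite /vpiece /apiece /= -mulgA piece_id ?eqxx // split_tgtP.
- by move=> y; rewrite /vpiece /gpiece /= mulgA piece_id ?eqxx // split_tgtP.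
- by move=> y; rewrite /vpiece /gpiece /= piece_g // split_tgtP.
- move=> [[e i] ei] [[f j] fj];
    rewrite /gpiece /apiece /vpiece -val_eqE /= xpair_eqE.
  rewrite mulgA -(mulgA (piece _ _)) qga; have [ef|ef] /= := eqVneq e f;
    last first.
    by rewrite nu0r nu0l.
  case/andP: ei => /= ei _; case/andP: fj => /= fj _.
  by rewrite piece_vr -ef in fj *; rewrite piece_id.
- exact: split_CK2.
Qed.

(** * Bijectivity of the homomorphism onto the quotient *)

Section SplitHom.
Variable phi : {linear leavitt F G' -> A}.
Hypothesis phiM : {morph phi : x y / x ** y}.
Hypothesis phi_v : forall x, phi (lv F x) = vpiece x.
Hypothesis phi_a : forall y, phi (la F y) = apiece y.
Hypothesis phi_g : forall y, phi (lg F y) = gpiece y.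

Definition hit z : Prop := exists x, phi x = z.

Lemma hitD x y : hit x -> hit y -> hit (x + y).
Proof. by move=> [x' <-] [y' <-]; exists (x' + y'); rewrite linearD. Qed.

Lemma hitZ k x : hit x -> hit (k *: x).
Proof. by move=> [x' <-]; exists (k *: x'); rewrite linearZ. Qed.

Lemma hitM x y : hit x -> hit y -> hit (x ** y).
Proof. by move=> [x' <-] [y' <-]; exists (x' ** y'); rewrite phiM. Qed.

Lemma hit0 : hit 0. Proof. by exists 0; rewrite linear0. Qed.

Lemma hit_sum n (E : nat -> A) :
  (forall i, (i < n)%N -> hit (E i)) -> hit (\sum_(0 <= i < n) E i).
Proof.
move=> h; rewrite big_mkord; elim/big_rec: _ => [|i x _ hx]; first exact: hit0.
by apply: hitD => //; exact: h.
Qed.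

Lemma hit_piece v i : (i < npieces v)%N -> hit (piece v i).
Proof.
by move=> iv; exists (lv F (exist _ (v, i) iv : vertex G')); rewrite phi_v.
Qed.

Lemma hit_vertex v : hit (pv v).
Proof. by rewrite piece_sum; apply: hit_sum => i; exact: hit_piece. Qed.

Lemma hit_arrow e : (forall i, (i < npieces (tgt e))%N ->
  hit (pa e ** piece (tgt e) i)) ->
  hit (pa e).
Proof. by move=> h; rewrite -qav piece_sum nu_sumr; exact: hit_sum. Qed.

Lemma hit_ghost e : (forall i, (i < npieces (tgt e))%N ->
  hit (piece (tgt e) i ** pg e)) ->
  hit (pg e).
Proof. by move=> h; rewrite -qvg piece_sum nu_suml; exact: hit_sum. Qed.

Lemma hit_unmarked e : ~~ marked e -> hit (pa e) /\ hit (pg e).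
Proof.
move=> me; split; [apply: hit_arrow|apply: hit_ghost] => i ie;
  pose y : arrow G' := exist _ (e, i) (introT andP (conj ie me)).
- by exists (la F y); rewrite phi_a.
- by exists (lg F y); rewrite phi_g.
Qed.

Lemma hit_lpath v s : (forall e, e \in s -> ~~ marked e) ->
  hit (nupi J (lpath F v s)) /\ hit (nupi J (ghost_path F v s)).
Proof.
elim: s v => [|e s IH] v h /=; first by split; exact: hit_vertex.
have [ha hg] := hit_unmarked (h e (mem_head _ _)).
have [hs1 hs2] := IH (tgt e) (fun f fs => h f (mem_behead (s := e :: s) fs)).
by rewrite lpath_cons !nupiM; split; apply: hitM.
Qed.

(** Let [P] be the rest of the cycle, a product of unmarked arrows. On the idempotent [p_i] at the
    target of [e] the cycle acts as [r_i], that is [P e p_i = r_i p_i]. Hence [e p_i = r_i P^* p_i],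
    and [p_i e^* = r_i^-1 P p_i'] with [p_i'] the idempotent at the source. *)
Lemma hit_marked e : marked e -> hit (pa e) /\ hit (pg e).
Proof.
move=> me; have oe := marked_oncyc me; have [bc _] := oncycP oe.
have ec : e \in cyc (src e).
  move: me => /asboolP[c [bc' ec _]].
  by rewrite (beta_mem_cyc bc' (map_f src ec)).
have He : ~ J (lv F (tgt e)) := beta_off bc ec.
have [s [E1 E2]] := oncyc_step oe He.
have um f : f \in s -> ~~ marked f.
  move=> fs; apply/negP => mf.
  have ef : e = f by apply: (marked_uniq bc) => //; rewrite E1 inE fs orbT.
  have : uniq (cyc (src e)) by apply: (@map_uniq _ _ src);
    case/and3P: (beta_cycle bc).
  by rewrite E1 /= ef fs.
have ot := oncyc_tgt oe He; have [bt lt] := oncycP ot.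
have [hp hgp] := hit_lpath (tgt e) um.
set P := nupi J (lpath F (tgt e) s) in hp.
have cc : is_cycle (e :: s) by rewrite -E1; exact: beta_cycle.
have [ws /eqP ends] : walk (tgt e) s /\ wend (tgt e) s == src e.
  by move: cc; rewrite is_cycleE => /and3P[].
have PX : P ** pa e = ceval (tgt e) 'X.
  rewrite /P /ceval E2 -nupiM lpath_la ?ends // -['X]expr1 cycle_evalXn.
  by rewrite (cycle_pow_lpath _ (v := tgt e)) -?E2 //= cats0.
have lagX i : (i < size (roots_at (tgt e)))%N ->
    P ** (pa e ** ceval (tgt e) (lagrange (roots_at (tgt e)) i)) =
    (roots_at (tgt e))`_i *: ceval (tgt e) (lagrange (roots_at (tgt e)) i).
  move=> ir; have [ur _] := roots_atP ot.
  rewrite mulgA PX -cevalM // /ceval -nupiZ -cycle_evalZ;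
    apply: ceval_eq => // j jr.
  rewrite hornerM hornerX hornerZ !lagrange_horner //.
  by have [->|_] := eqVneq i j; rewrite ?mulr0.
have npE : npieces (tgt e) = size (roots_at (tgt e)).
  by rewrite /npieces ot; case: asboolP.
have pE i : piece (tgt e) i = ceval (tgt e) (lagrange (roots_at (tgt e)) i).
  by rewrite /piece ot.
split.
- apply: hit_arrow => i ie.
  have -> : pa e ** piece (tgt e) i =
      nupi J (ghost_path F (tgt e) s) ** (P ** (pa e ** piece (tgt e) i)).
    have gP : nupi J (ghost_path F (tgt e) s) ** P = pv (src e).
      by rewrite -nupiM ghost_pathK // ends.
    by rewrite [RHS]mulgA gP mulgA qva.
  apply: hitM => //; rewrite pE lagX -?npE // -pE.
  exact/hitZ/hit_piece.
- apply: hit_ghost => i ie;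
    have ir : (i < size (roots_at (tgt e)))%N by rewrite -npE.
  have r0 := roots_at_neq0 ot ir.
  rewrite -[X in hit X](scalerK r0) -nuZl pE -lagX // -ceval_a // -!mulgA.
  rewrite oncyc_ag // ceval_vr //; apply/hitZ/hitM => //.
  have -> : ceval (src e) (lagrange (roots_at (tgt e)) i) = piece (src e) i.
    by rewrite /piece oe roots_at_step.
  apply: hit_piece; have := npieces_src ie; by rewrite /src_index oe.
Qed.

Lemma phi_surj z : hit z.
Proof.
have hae e : hit (pa e) /\ hit (pg e).
  by case me: (marked e); [exact: hit_marked|apply: hit_unmarked; rewrite me].
rewrite -(nureprK z); elim/leavitt_ind: (nurepr z) => [v|e|e||x y|k x|x y].
- exact: hit_vertex.
- by case: (hae e).
- by case: (hae e).
- exact: hit0.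
- by rewrite nupiD; exact: hitD.
- by rewrite nupiZ; exact: hitZ.
- by rewrite nupiM; exact: hitM.
Qed.

Local Notation fs y := (val (y : arrow G')).1.

Lemma split_walk (x : vertex G') (t : seq (arrow G')) :
  walk x t -> walk (val x).1 (map (fun y => fs y) t) /\
  wend (val x).1 (map (fun y => fs y) t) = (val (wend x t)).1.
Proof.
elim: t x => //= y t IH x /andP[/eqP<- /IH[wt et]].
by rewrite eqxx.
Qed.

Lemma split_loop (x : vertex G') (t : seq (arrow G')) :
  loop_at x t -> loop_at (val x).1 (map (fun y => fs y) t).
Proof.
move=> /and3P[t0 /split_walk[wt et] /eqP endt]; apply/and3P; split=> //.
  by rewrite -size_eq0 size_map size_eq0.
by rewrite et endt.
Qed.

Hypothesis beta_max : forall c, is_cycle c -> meets_properly J c -> beta c.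

(** Projected to the original digraph, such a cycle would run through a whole cycle of [beta], hence
    through its marked arrow, no copy of which is left. *)
Lemma split_cycle_oncyc (c : seq (arrow G')) y : is_cycle c -> y \in c ->
  ~~ oncyc (src (fs y)).
Proof.
move=> cc yc; apply/negP => oy; have [k t rk] := rot_to yc.
have lt : loop_at (src (fs y)) (map (fun y => fs y) (y :: t)).
  by apply: (@split_loop (src y)); apply: is_cycle_loop;
    rewrite -rk is_cycle_rot.
have [e [s [_ ev be _ _]]] := oncyc_cons oy; rewrite -ev in lt.
have [t' tE] : exists t', map (fun y => fs y) (y :: t) = (e :: s) ++ t'.
  apply: (beta_prefix be lt); apply/allP => _ /mapP[z _ ->].
  by apply/asboolPn; exact: split_offP.
have [m ms mm] := marked_exists be.
have /mapP[z _ mz] : m \in map (fun y => fs y) (y :: t) by rewrite tE mem_cat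
  ms.
by have /andP[_] := valP z; rewrite -mz mm.
Qed.

Lemma split_cycle_tgt (c : seq (arrow G')) y : is_cycle c -> y \in c ->
  (val y).2 = 0%N /\ ~~ oncyc (tgt (fs y)).
Proof.
move=> cc yc; have /mapP[z zc yz] := is_cycle_tgt cc yc.
have oz := split_cycle_oncyc cc zc.
have [-> ->] := congr1 val yz; split=> //.
by rewrite /src_index (negPf oz).
Qed.

(** Otherwise the copy [z] of the same arrow ending at index 1 would be an exit. *)
Lemma split_cycle_primed (c : seq (arrow G')) y : is_cycle c -> no_exit c ->
  y \in c ->
  ~ primed J (tgt (fs y)).
Proof.
move=> cc ne yc pr; have [y0 oy] := split_cycle_tgt cc yc.
have i1 : (1 < npieces (tgt (fs y)))%N.
  rewrite /npieces (negPf oy); case: asboolP => [Jy|_];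
    first by have := @split_offP y.
  by case: asboolP.
have my : ~~ marked (fs y) by case/andP: (valP y).
pose z : arrow G' := exist _ (fs y, 1%N) (introT andP (conj i1 my)).
have zc : z \in c.
  apply: ne; apply/mapP; exists y => //; apply: val_inj => /=.
  by rewrite /src_index (negPf (split_cycle_oncyc cc yc)).
by have [] := split_cycle_tgt cc zc.
Qed.

Lemma split_cycle_piece (c : seq (arrow G')) y : is_cycle c -> no_exit c ->
  y \in c ->
  piece (tgt (fs y)) (val y).2 = pv (tgt (fs y)).
Proof.
move=> cc ne yc; have [_ oy] := split_cycle_tgt cc yc.
rewrite /piece (negPf oy); case: asboolP => // pr.
by case: (split_cycle_primed cc ne yc).
Qed.

Lemma split_cycle_src (c : seq (arrow G')) y : is_cycle c -> no_exit c ->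
  y \in c ->
  vpiece (src y) = pv (src (fs y)).
Proof.
move=> cc ne yc; have [z zc zy] := is_cycle_pred cc (map_f _ yc).
by rewrite -zy /vpiece /= (split_cycle_piece cc ne zc) -[src (fs y)]/(val (src
  y)).1 -zy.
Qed.

Lemma split_cycle_is_cycle (c : seq (arrow G')) : is_cycle c ->
  is_cycle (map (fun y => fs y) c).
Proof.
move=> cc; have [y [t cE]] := is_cycle_cons cc.
have /and3P[_ wc /eqP endc] : loop_at (src (fs y)) (map (fun y => fs y) c).
  by rewrite cE; apply: (@split_loop (src y)); apply: is_cycle_loop;
    rewrite -cE.
suff uc : uniq (map src (map (fun y => fs y) c)).
  rewrite cE /= in wc endc uc *; rewrite is_cycleE; apply/and3P; split=> //.
    by case/andP: wc.
  by apply/eqP.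
rewrite -map_comp map_inj_in_uniq; first by apply: (@map_uniq _ _ src);
  case/and3P: cc.
move=> z1 z2 z1c z2c /= zz; apply: (is_cycle_src_inj cc) => //;
  apply: val_inj => /=.
by rewrite /src_index zz (negPf (split_cycle_oncyc cc z2c)).
Qed.

Lemma split_cycle_eval (c : seq (arrow G')) q : is_cycle c -> no_exit c ->
  phi (cycle_eval c q) = nupi J (cycle_eval (map (fun y => fs y) c) q).
Proof.
move=> cc ne; rewrite /cycle_eval linear_sum nupi_sum; apply: eq_bigr => i _.
rewrite linearZ nupiZ /=; congr (_ *: _).
have [y [t cE]] := is_cycle_cons cc.
have phi_fold (s : seq (arrow G')) x z : {subset s <= c} -> phi x = nupi J z ->
    phi (foldr (fun (f : arrow G') y => la F f ** y) x s) =
    nupi J (foldr (fun f y => la F f ** y) z (map (fun y => fs y) s)).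
  elim: s => //= h s IHs sc xz.
  rewrite phiM nupiM IHs //; last by move=> f fs'; apply: sc;
    rewrite inE fs' orbT.
  congr (_ * _)%g; rewrite phi_a /apiece (split_cycle_piece cc ne) ?qav //.
  by apply: sc; rewrite mem_head.
rewrite cE /cycle_pow /=; elim: (i : nat) => [|n IH] /=.
  by rewrite phi_v; apply: (split_cycle_src cc ne); rewrite cE mem_head.
have -> u : la F y ** foldr (fun (f : arrow G') y => la F f ** y) u t =
  foldr (fun (f : arrow G') y => la F f ** y) u (y :: t) by [].
by rewrite (phi_fold _ _ _ _ IH) // -cE.
Qed.

Lemma phi_is_ideal : is_ideal [set x | phi x = 0]%classic.
Proof.
split=> [|x y /= x0 y0|k x /= x0|x y /= y0|x y /= x0] /=.
- exact: linear0.
- by rewrite linearD x0 y0 addr0.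
- by rewrite linearZ /= x0 scaler0.
- by rewrite phiM y0 nu0r.
- by rewrite phiM x0 nu0l.
Qed.

Lemma phi_inj x : phi x = 0 -> x = 0.
Proof.
move=> x0; apply: (@reduction F G' (Ideal phi_is_ideal)) => //.
move=> [[v /= v0]|[c [q [cc ne q0 /= cq]]]].
  by move: v0; rewrite phi_v; apply: piece_neq0; exact: (valP v).
pose C := map (fun y => fs y) c;
  have CC : is_cycle C := split_cycle_is_cycle cc.
have JC : J (cycle_eval C q) by apply/nupi0P; rewrite -split_cycle_eval.
have [y [t cE]] := is_cycle_cons cc; have yc : y \in c by rewrite cE mem_head.
have lC : loop_at (src (fs y)) C.
  by rewrite /C cE; apply: is_cycle_loop; move: CC; rewrite /C cE.
have ny : ~ J (lv F (src (fs y))).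
  have [z zc zy] := is_cycle_pred CC (map_f src (map_f (fun y => fs y) yc)).
  by rewrite -zy; case/mapP: zc => w _ ->; exact: split_offP.
suff bC : beta C.
  have := split_cycle_oncyc cc yc; rewrite (oncycI bC) //.
  by apply: map_f; apply: map_f.
apply: beta_max => //; split.
  exists q; split=> // Cq0; apply: ny.
  (* The intersection of [J] with [F[C]] is nonzero because [q(C)] is: otherwise the source of [C]
     would be 0, hence in [J]. *)
  by rewrite -(cycle_pow0 F lC) (cycle_eval_neq0 CC q0 Cq0); exact: nuideal0.
by exists 1; rewrite (cycle_eval1 _ lC).
Qed.

End SplitHom.

Hypothesis beta_max : forall c, is_cycle c -> meets_properly J c -> beta c.

Theorem split_iso : nualg_isomorphic A (leavitt F G').
Proof.
have [phi [phiM phi_v phi_a phi_g]] := split_hom_exists.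
have surj z : exists x, phi x = z by exact: phi_surj.
have inj : injective phi.
  move=> x y xy; apply/subr0_eq/(phi_inj phiM phi_v phi_a beta_max).
  by rewrite linearB xy subrr.
pose psi z := projT1 (cid (surj z)).
have psiK : cancel psi phi by move=> z; rewrite /psi; case: cid.
have phiK : cancel phi psi by move=> x; apply: inj; rewrite psiK.
have psi_lin : linear psi by move=> k x y; apply: inj; rewrite linearP !psiK.
pose psiL : {linear A -> leavitt F G'} :=
  HB.pack psi (GRing.isLinear.Build F A (leavitt F G') *:%R psi psi_lin).
exists psiL; split; last by exists phi.
by move=> x y; apply: inj; rewrite phiM !psiK.
Qed.

End Splitting.

(** * Density of the points with distinct linear factors *)

Section Discriminant.
Context (n : nat).

(** The ring is arbitrary so that the coefficients can be field elements or the variables of a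
    polynomial ring; the latter exhibit [disc] as a polynomial function. *)
Definition gen_poly (R : comNzRingType) (a : 'I_n -> R) : {poly R} :=
  1 + \sum_(i < n) a i *: 'X^(i.+1).

(* The Sylvester matrix of [f] and [f'] for the formal degrees [n] and [n - 1]:
   its size does not depend on the actual degree of [f']. *)
Definition sylvester (R : comNzRingType) (a : 'I_n -> R) : 'M[R]_(n.-1 + n) :=
  col_mx (\matrix_(i, k) ('X^i * gen_poly a)`_k)
         (\matrix_(i, k) ('X^i * (gen_poly a)^`())`_k).

Definition disc (R : comNzRingType) (a : 'I_n -> R) : R := \det (sylvester a).

Lemma disc_morph (R S : comNzRingType) (h : {rmorphism R -> S}) (a : 'I_n ->
  R) :
  h (disc a) = disc (h \o a).
Proof.
have fE : map_poly h (gen_poly a) = gen_poly (h \o a).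
  rewrite rmorphD rmorph1 rmorph_sum; congr (_ + _).
  by apply: eq_bigr => j _; rewrite -[LHS]/(map_poly h _) map_polyZ map_polyXn.
rewrite /disc -det_map_mx map_col_mx; congr (\det (col_mx _ _));
  apply/matrixP => i k;
    rewrite !mxE -coef_map rmorphM /= map_polyXn -?deriv_map fE //.
Qed.

Lemma rVpolyE (R : nzRingType) m (u : 'rV[R]_m) : rVpoly u = \sum_(i < m) u 0 i
  *: 'X^i.
Proof. by rewrite /rVpoly poly_def; apply: eq_bigr => i _; rewrite valK. Qed.

Lemma mulmx_sylvester (R : comNzRingType) (a : 'I_n -> R) u w k :
  (row_mx u w *m sylvester a) 0 k =
  (rVpoly u * gen_poly a + rVpoly w * (gen_poly a)^`())`_k.
Proof.
rewrite mul_row_col coefD !mxE !rVpolyE !mulr_suml !coef_sum.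
by congr (_ + _); apply: eq_bigr => i _; rewrite mxE -scalerAl coefZ.
Qed.

(** The left kernel of the Sylvester matrix consists of the pairs [(U, W)] within the size bounds
    with [U f + W f' = 0]. If [f] and [f'] are coprime, [f] divides the smaller [W], so both vanish;
    if [h] is a nonconstant common divisor, [U = - f' / h] and [W = f / h] is a nonzero solution. *)
Lemma disc_eq0 (F : fieldType) (a : 'I_n -> F) : size (gen_poly a) = n.+1 ->
  (disc a != 0) = separable_poly (gen_poly a).
Proof.
set f := gen_poly a => sf; have f0 : f != 0 by rewrite -size_poly_eq0 sf.
have sf' : (size f^`() <= n)%N by rewrite -ltnS -sf lt_size_deriv.
rewrite unlock; apply/idP/idP; last first.
  move=> cop; apply/negP => /det0P[v v0 /matrixP v_syl].
  pose u := lsubmx v; pose w := rsubmx v.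
  have eq0 : rVpoly u * f + rVpoly w * f^`() = 0.
    apply/polyP => k; rewrite coef0; have [kn|kn] := ltnP k (n.-1 + n).
      have := v_syl 0 (Ordinal kn);
        rewrite -(hsubmxK v) mulmx_sylvester -/f => ->.
      by rewrite mxE.
    rewrite nth_default //; apply: leq_trans kn;
      apply: leq_trans (size_polyD _ _) _.
    rewrite geq_max; apply/andP; split; apply: leq_trans (size_polyMleq _ _) _.
      by have : (size (rVpoly u) <= n.-1)%N := size_poly _ _; rewrite sf; lia.
    have : (size (rVpoly w) <= n)%N := size_poly _ _.
    by move: (size (rVpoly w)) (size f^`()) sf' => x y; lia.
  have w0 : rVpoly w = 0.
    apply/eqP/negPn/negP => w0; have : f %| rVpoly w * f^`().
      by rewrite -[_ * _](addKr (rVpoly u * f)) eq0 addr0 -mulNr dvdp_mull.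
    rewrite (Gauss_dvdpl _ cop) => /(dvdp_leq w0); rewrite sf.
    by rewrite ltnNge (size_poly _ _ : (size (rVpoly w) <= n)%N).
  have u0 : rVpoly u = 0.
    by move/eqP: eq0; rewrite w0 mul0r addr0 mulf_eq0 (negPf f0) orbF => /eqP.
  case/eqP: v0; rewrite -(hsubmxK v) -/u -/w -(rVpolyK u) -(rVpolyK w) u0 w0.
  by rewrite !linear0 row_mx0.
apply: contraNT => cop; apply/det0P; pose h := gcdp f f^`().
have h0 : h != 0 by rewrite gcdp_eq0 negb_and f0.
have sh : (1 < size h)%N.
  by move: cop; rewrite /coprimep -/h => sh;
    rewrite ltn_neqAle eq_sym sh size_poly_gt0.
pose U := - (f^`() %/ h); pose W := f %/ h.
have sU : (size U <= n.-1)%N by rewrite size_polyN size_divp // ;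
  move: (size f^`()) (size h) sf' sh => x y; lia.
have sW : (size W <= n)%N by rewrite size_divp // sf; lia.
have UW : U * f + W * f^`() = 0.
  have fE : f = W * h by rewrite divpK // dvdp_gcdl.
  have f'E : f^`() = (f^`() %/ h) * h by rewrite divpK // dvdp_gcdr.
  by rewrite {1}fE {1}f'E /U mulNr (mulrCA _ W) addNr.
exists (row_mx (poly_rV U) (poly_rV W)).
  apply/negP => /eqP /(congr1 rsubmx); rewrite row_mxKr => /(congr1 rVpoly).
  rewrite poly_rV_K // => W0; have : W = 0 by rewrite W0 !linear0.
  by move/eqP; rewrite dvdp_div_eq0 ?dvdp_gcdl // (negPf f0).
by apply/rowP => k; rewrite mulmx_sylvester !poly_rV_K // UW coef0 mxE.
Qed.



End Discriminant.

(** * Zariski topology on the affine factors *)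

Section AffineFactor.
Context (F : closedFieldType).

Lemma size_poly_of_point n (a : 'rV[F]_n) : (0 < n)%N -> affine_factor F n a ->
  size (poly_of_point a) = n.+1.
Proof.
case: n a => // n a _ aff.
have -> : poly_of_point a = \poly_(k < n.+2) (if k is j.+1 then a 0 (inord j)
  else 1).
  rewrite poly_def big_ord_recl /= scale1r; congr (_ + _).
  by apply: eq_bigr => i _; rewrite inord_val.
by apply: size_poly_eq; apply: aff; rewrite inordK.
Qed.

Lemma poly_of_point_row n (f : {poly F}) : size f = n.+1 -> f.[0] = 1 ->
  poly_of_point (\row_(i < n) f`_(i.+1)) = f.
Proof.
move=> sf f0; rewrite -[RHS]coefK poly_def sf big_ord_recl /= -horner_coef0 f0
  scale1r.
by congr (_ + _); apply: eq_bigr => i _; rewrite mxE.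
Qed.

Lemma affine_factor_row n (f : {poly F}) : size f = n.+1 ->
  affine_factor F n (\row_(i < n) f`_(i.+1)).
Proof.
move=> sf i id; rewrite mxE id; have := lead_coef_eq0 f.
by rewrite lead_coefE sf /= -size_poly_eq0 sf => ->.
Qed.

Lemma separable_dlf (f : {poly F}) : f != 0 ->
  separable_poly f <-> distinct_linear_factors f.
Proof.
move=> f0; split=> [|[k [r [k0 ur ->]]]]; last first.
  by rewrite (eqp_separable (eqp_scale _ k0)) separable_prod_XsubC.
have [r fE] := closed_field_poly_normal f.
have l0 : lead_coef f != 0 by rewrite lead_coef_eq0.
rewrite {1}fE (eqp_separable (eqp_scale _ l0)) separable_prod_XsubC => ur.
by exists (lead_coef f), r.
Qed.

Lemma dlf_pointsE n : (0 < n)%N -> dlf_points F n =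
  (affine_factor F n `&` [set a | disc (fun i => a 0%R i) != 0%R])%classic.
Proof.
move=> n0; apply/seteqP; split=> a /= [aff h]; split=> //;
  have sf := size_poly_of_point n0 aff;
  have f0 : poly_of_point a != 0 by rewrite -size_poly_eq0 sf.
- by rewrite disc_eq0 //; apply/separable_dlf.
- by apply/(separable_dlf f0); rewrite disc_eq0 in h.
Qed.

Definition discm n : mpoly.mpoly n F := disc (fun i => mpoly.mpolyX F
  (mpoly.mnm1 i)).

Lemma meval_discm n (v : 'I_n -> F) : mpoly.meval v (discm n) = disc v.
Proof.
rewrite /discm (disc_morph (mpoly.meval v)); congr disc.
by apply/funext => i; exact: mpoly.mevalXU.
Qed.

Lemma discm_open n : zariski_open [set a : 'rV[F]_n | disc (fun i => a 0%R i)
  != 0%R]%classic.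
Proof.
exists [set discm n]%classic; apply/seteqP; split=> a /=.
  by move=> /negP/negPn/eqP ha p ->; rewrite meval_discm.
by move=> /(_ _ erefl); rewrite meval_discm => ->; rewrite eqxx.
Qed.

Definition secant n (a b : 'rV[F]_n) (t : F) : 'rV[F]_n := \row_i (a 0 i + t *
  (b 0 i - a 0 i)).

Lemma secant0 n (a b : 'rV[F]_n) : secant a b 0 = a.
Proof. by apply/rowP => i; rewrite mxE mul0r addr0. Qed.

Lemma secant1 n (a b : 'rV[F]_n) : secant a b 1 = b.
Proof. by apply/rowP => i; rewrite mxE mul1r addrC subrK. Qed.

Lemma meval_secant n (a b : 'rV[F]_n) (p : mpoly.mpoly n F) :
  exists q : {poly F}, forall t,
    q.[t] = mpoly.meval (fun i => secant a b t 0 i) p.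
Proof.
exists (\sum_(m <- mpoly.msupp p) mpoly.mcoeff m p *:
  \prod_i ((a 0 i)%:P + (b 0 i - a 0 i) *: 'X) ^+ (m : mpoly.multinom n) i) =>
    t.
rewrite mpoly.mevalE horner_sum; apply: eq_bigr => m _.
rewrite hornerZ horner_prod; congr (_ * _); apply: eq_bigr => i _.
by rewrite horner_exp !hornerE mxE mulrC.
Qed.

Lemma uniq_units m : exists r : seq F, [/\ uniq r, 0 \notin r & size r = m].
Proof.
elim: m => [|m [r [ur r0 sr]]]; first by exists [::].
have [x] : exists x : F, ~~ root (\prod_(z <- 0 :: r) ('X - z%:P)) x.
  by apply/closed_nonrootP; rewrite monic_neq0 // monic_prod_XsubC.
rewrite root_prod_XsubC inE negb_or => /andP[x0 xr].
by exists (x :: r); rewrite /= inE negb_or eq_sym x0 r0 xr ur sr.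
Qed.

(** An algebraically closed field is infinite, so there are [n] distinct nonzero roots; as none is
    0, the product can be scaled to have constant term 1. *)
Lemma dlf_point_exists n : exists b, dlf_points F n b.
Proof.
have [r [ur r0 sr]] := uniq_units n; pose p := \prod_(z <- r) ('X - z%:P).
have p0 : p.[0] != 0 by rewrite -rootE root_prod_XsubC.
pose f := p.[0]^-1 *: p; have i0 : p.[0]^-1 != 0 by rewrite invr_eq0.
have sf : size f = n.+1 by rewrite size_scale // size_prod_XsubC sr.
exists (\row_i f`_(i.+1)); split; first exact: affine_factor_row.
rewrite poly_of_point_row // ?hornerZ ?mulVf //.
by exists p.[0]^-1, r.
Qed.

(* On the line from [a] to a point with distinct linear factors, the last
   coordinate does not vanish at [0], nor does the discriminant at [1]. *)
Lemma secant_dlf n (a : 'rV[F]_n) : (0 < n)%N -> affine_factor F n a ->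
  exists b (q : {poly F}), q != 0 /\ forall t, ~~ root q t ->
    dlf_points F n (secant a b t).
Proof.
move=> n0 aff; have [b db] := dlf_point_exists n; exists b.
have [q1 q1E] := meval_secant a b (discm n).
have ln : (n.-1 < n)%N by rewrite prednK.
pose l : 'I_n := Ordinal ln.
pose q2 : {poly F} := (a 0 l)%:P + (b 0 l - a 0 l) *: 'X.
have q2E t : q2.[t] = secant a b t 0 l by rewrite !hornerE mxE mulrC.
exists (q1 * q2); split.
  rewrite mulf_neq0 //.
    apply: contra_neq (_ : q1.[1] != 0) => [->|]; first by rewrite horner0.
    by move: db; rewrite dlf_pointsE // q1E secant1 meval_discm => -[].
  apply: contra_neq (_ : q2.[0] != 0) => [->|]; first by rewrite horner0.
  by rewrite q2E secant0; apply: aff; rewrite /= prednK.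
move=> t; rewrite rootM negb_or !rootE q1E q2E meval_discm => /andP[h1 h2].
rewrite dlf_pointsE //; split=> // i il.
by suff -> : i = l by []; apply: val_inj; exact: (congr1 predn il).
Qed.

(** For density, take an equation [p] of the complement of [O] not vanishing at [a]. Its restriction
    to the line of [secant_dlf] is nonzero at parameter 0, so it and [q] have a common nonroot. *)
Theorem dlf_zariski n : (0 < n)%N ->
  open_dense_in (@zariski_open F n) (affine_factor F n) (dlf_points F n).
Proof.
move=> n0; split.
  by exists [set a : 'rV[F]_n | disc (fun i => a 0%R i) != 0%R]%classic; split;
    [exact: discm_open|exact: dlf_pointsE].
move=> O [S OE] [a [aff Oa]].
have [p [Sp pa]] : exists p, S p /\ mpoly.meval (fun i => a 0 i) p != 0.
  apply: contrapT => np; have : (~` O)%classic a.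
    by rewrite OE => p Sp; apply: contrapT => /eqP pa; apply: np; exists p.
  by apply.
have [b [q [q0 qd]]] := secant_dlf n0 aff.
have [r rE] := meval_secant a b p.
have r0 : r != 0.
  apply: contra_neq (_ : r.[0] != 0) => [->|]; first by rewrite horner0.
  by rewrite rE secant0.
have /closed_nonrootP[t] : q * r != 0 by rewrite mulf_neq0.
rewrite rootM negb_or => /andP[qt]; rewrite rootE rE => rt.
exists (secant a b t); split; first exact: qd.
apply: contrapT => nO; have : (~` O)%classic (secant a b t) by [].
by rewrite OE => /(_ _ Sp) rt0; rewrite rt0 eqxx in rt.
Qed.

End AffineFactor.

(** * Euclidean topology on the affine factors *)

Section Euclidean.
Local Open Scope classical_set_scope.
Context (K : numFieldType) (n : nat).

Lemma meval_continuous (p : mpoly.mpoly n K) :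
  continuous (fun a : 'rV[K]_n => mpoly.meval (fun i => a 0 i) p).
Proof.
have cont_sum (I : Type) (r : seq I) (f : I -> 'rV[K]_n -> K) :
    (forall i, continuous (f i)) -> continuous (fun a => \sum_(i <- r) f i a).
  move=> cf x; elim: r => [|i r IH].
    by rewrite (_ : (fun a => _) = cst 0);
      [exact: cst_continuous|apply/funext => a; rewrite big_nil].
  rewrite (_ : (fun a => _) = (f i \+ (fun a => \sum_(i <- r) f i a))).
    by apply: continuousD => //; exact: cf.
  by apply/funext => a; rewrite big_cons.
have cont_prod (I : Type) (r : seq I) (f : I -> 'rV[K]_n -> K) :
    (forall i, continuous (f i)) -> continuous (fun a => \prod_(i <- r) f i a).
  move=> cf x; elim: r => [|i r IH].
    by rewrite (_ : (fun a => _) = cst 1);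
      [exact: cst_continuous|apply/funext => a; rewrite big_nil].
  rewrite (_ : (fun a => _) = (f i \* (fun a => \prod_(i <- r) f i a))).
    by apply: continuousM => //; exact: cf.
  by apply/funext => a; rewrite big_cons.
rewrite (_ : (fun a => _) = fun a : 'rV[K]_n =>
  \sum_(m <- mpoly.msupp p) mpoly.mcoeff m p * \prod_i \prod_(j < m i) a 0 i).
  apply: cont_sum => m x; apply: continuousM; first exact: cst_continuous.
  by apply: (cont_prod _ _ _) => i; apply: (cont_prod _ _ _) => _;
    exact: coord_continuous.
apply/funext => a; rewrite mpoly.mevalE; apply: eq_bigr => m _; congr (_ * _).
by apply: eq_bigr => i _; rewrite prodr_const card_ord.
Qed.

Lemma meval_neq0_open (p : mpoly.mpoly n K) :
  open [set a : 'rV[K]_n | mpoly.meval (fun i => a 0 i) p != 0].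
Proof.
apply: (@open_comp _ _ (fun a : 'rV[K]_n => mpoly.meval (fun i => a 0 i) p)
  [set y | y != 0]).
  by move=> x _; exact: meval_continuous.
rewrite openE => x /= x0; apply/nbhs_ballP; exists `|x|;
  first by rewrite /= normr_gt0.
move=> y; rewrite -ball_normE /= => xy; apply: contraTneq xy => ->.
by rewrite subr0 ltxx.
Qed.

Lemma small_nonroot (q : {poly K}) (e : K) : q != 0 -> 0 < e ->
  exists2 t, `|t| < e & ~~ root q t.
Proof.
move=> q0 e0; apply: contrapT => h.
(* These are more points than [q] can have roots; the denominators start at 2 to keep all of them
   strictly below [e]. *)
pose s := [seq e / k.+2%:R | k <- iota 0 (size q)].
have us : uniq s.
  rewrite map_inj_uniq ?iota_uniq // => i j /(mulfI (lt0r_neq0 e0)) /invr_inj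
    /eqP.
  by rewrite eqr_nat => /eqP[].
have rs : all (root q) s.
  apply/allP => _ /mapP[k _ ->]; apply/negPn/negP => kr; apply: h.
  exists (e / k.+2%:R) => //; rewrite ger0_norm ?divr_ge0 ?ler0n ?(ltW e0) //.
  by rewrite ltr_pdivrMr ?ltr0n // ltr_pMr // ltr1n.
by have := max_poly_roots q0 rs us; rewrite size_map size_iota ltnn.
Qed.

Lemma secant_near (a b : 'rV[K]_n) (O : set 'rV[K]_n) : open O -> O a ->
  exists2 e : K, 0 < e & forall t, `|t| < e ->
    O (\row_i (a 0 i + t * (b 0 i - a 0 i))).
Proof.
move=> oO Oa; have /nbhs_ballP[e /= e0 eO] : nbhs a O by exact: open_nbhs_nbhs.
(* An upper bound for all coordinates of [b - a]; the summand 1 keeps it positive even when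
   [a = b]. *)
pose M := 1 + \sum_i `|b 0 i - a 0 i|.
have M0 : 0 < M by rewrite ltr_pwDl ?ltr01 // sumr_ge0.
exists (e / M); first by rewrite divr_gt0.
move=> t te; apply: eO; split=> // i j; rewrite -ball_normE /= mxE (ord1 i).
rewrite opprD addrA subrr sub0r normrN normrM.
have : `|t| * `|b 0 j - a 0 j| <= `|t| * M.
  rewrite ler_wpM2l // /M (bigD1 j) //= addrCA lerDl.
  by rewrite addr_ge0 ?ler01 // sumr_ge0.
by move/le_lt_trans; apply; rewrite -ltr_pdivlMr.
Qed.

End Euclidean.

Theorem dlf_euclidean (R : realType) n : (0 < n)%N ->
  open_dense_in (@euclidean_open R n) (affine_factor R[i] n) (dlf_points R[i]
    n).
Proof.
move=> n0; split.
  exists [set a : 'rV[R[i]]_n | disc (fun i => a 0%R i) != 0%R]%classic; split;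
    last exact: dlf_pointsE.
  have := @meval_neq0_open (R[i] : numFieldType) n (discm _ n).
  rewrite /euclidean_open; congr open; apply/funext => a /=.
  by rewrite meval_discm.
move=> O oO [a [aff Oa]]; have [b [q [q0 qd]]] := secant_dlf n0 aff.
have [e e0 eO] := @secant_near (R[i] : numFieldType) n a b O oO Oa.
have [t te qt] := small_nonroot q0 e0.
by exists (secant a b t); split; [exact: qd|exact: eO].
Qed.

(** * Strata *)

Section StratumTheory.
Context (F : closedFieldType) (G : digraph) (I J : ideal (leavitt F G)).
Variables (beta : set (seq (arrow G))) (d : seq (arrow G) -> nat).
Hypothesis beta_geo : geometric_cycle_set beta.
Hypothesis SJ : stratum_deg I beta d J.

Lemma stratum_largest : largest_graded_in I J.
Proof. by case: SJ => -[]. Qed.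

Lemma stratum_cycle c : beta c -> is_cycle c.
Proof. by case/(@beta_geo c 0). Qed.

Lemma stratumE c : beta c <-> no_exit_cycle_in_quot I c /\ meets_properly J c.
Proof. by case: SJ => -[_ ->]. Qed.

Lemma stratum_canon c : beta c -> is_canon_poly J c (canon_poly J c).
Proof.
by move=> bc; apply: (canon_polyP (stratum_cycle bc)); case/stratumE: bc.
Qed.

Lemma poly_of_coordinate c : beta c ->
  poly_of_point (coordinate J c (d c)) = canon_poly J c.
Proof.
move=> bc; apply: poly_of_point_row; first by case: SJ => _; apply.
by case: (stratum_canon bc).
Qed.

Lemma coordinate_affine c : beta c ->
  affine_factor F (d c) (coordinate J c (d c)).
Proof. by move=> bc; apply: affine_factor_row; case: SJ => _; apply. Qed.

Lemma coordinate_dlf c : beta c ->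
  dlf_points F (d c) (coordinate J c (d c)) <-> distinct_linear_factors
    (canon_poly J c).
Proof.
move=> bc; rewrite /dlf_points /= poly_of_coordinate //; split=> [[]//|h].
by split=> //; exact: coordinate_affine.
Qed.

(** Meeting [J] properly already implies having no exit in the quotient digraph, so the condition
    that [J] be dlf, stated for all cycles, concerns exactly those of [beta]. *)
Lemma stratum_max c : is_cycle c -> meets_properly J c -> beta c.
Proof.
move=> cc Jc; apply/stratumE; split=> //.
exact: (meets_properly_no_exit stratum_largest).
Qed.

Lemma stratum_dlf : dlf J <->
  forall c, beta c -> dlf_points F (d c) (coordinate J c (d c)).
Proof.
split=> [dJ c bc|h c cc Jc].
  apply/(coordinate_dlf bc); apply: dJ; first exact: stratum_cycle.
  by case/stratumE: bc.
by have bc := stratum_max cc Jc; apply/(coordinate_dlf bc)/h.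
Qed.

Lemma stratum_quotient : (forall c, beta c ->
  dlf_points F (d c) (coordinate J c (d c))) ->
  exists G' : digraph, nualg_isomorphic (nuquot J) (leavitt F G').
Proof.
move=> h; have quotP c : beta c -> [/\ is_cycle c, forall e, e \in c ->
  ~ ideal_vertices J (tgt e),
      forall e, src e \in map src c -> ~ ideal_vertices J (tgt e) -> e \in c &
      forall v, v \in map src c -> ~ primed J v].
  case/stratumE => /no_exit_quotP.
  by rewrite (ideal_vertices_eq stratum_largest) (primed_eq stratum_largest).
eexists; apply: (@split_iso F G J beta) => //.
- exact: stratum_cycle.
- by move=> k c bc; case: (beta_geo k bc).
- by move=> c /stratumE[].
- by move=> c e /quotP[_ _ + _]; apply.
- by move=> c v /quotP[_ _ _]; apply.
- by move=> c bc; apply/(coordinate_dlf bc)/h.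
- exact: stratum_max.
Qed.

End StratumTheory.

(** The factor for [c] depends only on [d c], so the topological clauses mention no ideal; the
    coordinates of each [J] in the stratum link these factors with the ideals. *)
Theorem theorem34 :
  (forall (F : closedFieldType) (G : digraph) (I : ideal (leavitt F G))
      (beta : set (seq (arrow G))) (d : seq (arrow G) -> nat),
    graded_ideal I ->
    geometric_cycle_set beta ->
    (forall c, beta c -> no_exit_cycle_in_quot I c) ->
    (forall c, beta c -> (0 < d c)%N) ->
    (forall c k, beta c -> d (rot k c) = d c) ->
    [/\ (forall c, beta c ->
           open_dense_in (@zariski_open F (d c))
             (affine_factor F (d c)) (dlf_points F (d c))),
        (forall J, stratum_deg I beta d J -> forall c, beta c ->
           affine_factor F (d c) (coordinate J c (d c)) /\
           is_canon_poly J c (poly_of_point (coordinate J c (d c)))),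
        (forall J, stratum_deg I beta d J ->
           (dlf J <->
            forall c, beta c -> dlf_points F (d c) (coordinate J c (d c)))) &
        (forall J, stratum_deg I beta d J ->
           (forall c, beta c -> dlf_points F (d c) (coordinate J c (d c))) ->
           exists G' : digraph, nualg_isomorphic (nuquot J) (leavitt F G'))])
  /\
  (forall (R : realType) (G : digraph) (I : ideal (leavitt R[i] G))
      (beta : set (seq (arrow G))) (d : seq (arrow G) -> nat),
    graded_ideal I ->
    geometric_cycle_set beta ->
    (forall c, beta c -> no_exit_cycle_in_quot I c) ->
    (forall c, beta c -> (0 < d c)%N) ->
    (forall c k, beta c -> d (rot k c) = d c) ->
    forall c, beta c ->
      open_dense_in (@euclidean_open R (d c))
        (affine_factor R[i] (d c)) (dlf_points R[i] (d c))).
Proof.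
split=> [F G I beta d grI beta_geo ne dpos drot|R G I beta d _ _ _ dpos _ c bc]; last first.
  exact/dlf_euclidean/dpos.
split=> [c bc|J SJ c bc|J SJ|J SJ].
- exact/dlf_zariski/dpos.
- rewrite (poly_of_coordinate beta_geo SJ bc).
  by split; [exact: (coordinate_affine SJ)|exact: (stratum_canon beta_geo SJ)].
- exact: (stratum_dlf beta_geo SJ).
- exact: (stratum_quotient beta_geo SJ).
Qed.
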